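(* Let $T=\sum_{k=0}^\infty a_kD^k=h(D)e^{i\lambda D}$ be a differential operator with constant coefficients $a_k\in\mathbb{C}$, where $h\in\overline{\mathcal{P}}(H^* )$, let $T^*=\sum_{k=0}^\infty\bar a_kD^k$, and write $h(w)=e^{-\gamma w^2}h_1(w)$ with $\gamma\ge0$ and $h_1$ entire of genus at most one. For $\mu\ge\lambda\ge0$, $0<a<1/(4\gamma)$ and $b>a/(1-4\gamma a)$, the operator $T+T^*$ maps $\mathscr{F}_a$ into $\mathscr{F}_b$, and $$(T+T^* )\big(\mathscr{F}_a\cap\overline{\mathcal{S}}_\mu(\mathbb{R})\big)\subseteq\overline{\mathcal{S}}_\delta(\mathbb{R}),$$ where $\delta=\sqrt{\max\{\mu^2-\lambda^2,0\}}$.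
   Context: $D=d/dz$; a constant-coefficient operator $\sum c_kD^k$ acts on an entire function $\varphi$ by the series $\sum c_k\varphi^{(k)}$ (locally uniformly convergent in the present situation). If $\gamma=0$, $1/(4\gamma)$ is read as $\infty$. $H^*=\{z:\operatorname{Im}z<0\}$, and $\overline{\mathcal{P}}(H^* )$ is the closure, under uniform limits on compact subsets of $\mathbb{C}$, of the polynomials with no zeros in $H^*$; every nonzero function in this class admits a factorization $e^{-\gamma w^2}h_1(w)$ as in the claim. $\mathcal{S}_\mu$ is the set of complex polynomials whose zeros all lie in $|\operatorname{Im}z|\le\mu$, $\overline{\mathcal{S}}_\mu$ is its closure under uniform limits on compact subsets of $\mathbb{C}$, and $\overline{\mathcal{S}}_\mu(\mathbb{R})$ is the set of real entire functions (real on the real axis) in $\overline{\mathcal{S}}_\mu$. For $\beta>0$, $\mathscr{F}_\beta$ is the space of entire functions $f(z)=\sum_{k\ge0}f_kz^k$ with $\|f\|_\beta^2=\sum_k\frac{k!}{\beta^k}|f_k|^2<\infty$. *)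

(* Defs.v *)
From HB Require Import structures.
From mathcomp Require Import all_boot all_order all_algebra.
From mathcomp Require Import complex.
From mathcomp Require Import all_classical all_reals all_analysis.

Set Implicit Arguments.
Unset Strict Implicit.
Unset Printing Implicit Defensive.

Import Order.TTheory GRing.Theory Num.Theory.
Import numFieldNormedType.Exports.

Local Open Scope classical_set_scope.
Local Open Scope ring_scope.
Local Open Scope complex_scope.

(* The topology and norm of C = R[i] are those that MathComp-Analysis puts on
   any numFieldType, seen as a normed module over itself. *)
HB.instance Definition _ (R : realType) := NormedModule.copy R[i] R[i]^o.

(* The complex exponential, by Euler's formula. *)
Definition cexp (R : realType) (z : R[i]) : R[i] :=
  (expR (complex.Re z))%:C * (cos (complex.Im z) +i* sin (complex.Im z)).

Definition is_taylor (R : realType) (c : nat -> R[i]) (f : R[i] -> R[i]) : Prop :=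
  forall z, series (fun k => c k * z ^+ k) @ \oo --> f z.

Definition entire (R : realType) (f : R[i] -> R[i]) : Prop :=
  exists c, is_taylor c f.

(* Weierstrass primary factor E_p(u) = (1 - u) exp(u + u^2/2 + ... + u^p/p). *)
Definition primary_factor (R : realType) (p : nat) (u : R[i]) : R[i] :=
  (1 - u) * cexp (\sum_(1 <= j < p.+1) u ^+ j / j%:R).

(* f(z) = z^m e^(Q(z)) prod_k E_p(z / z_k) with deg Q <= p and
   sum_k |z_k|^-(p+1) < oo.  The sequence r lists the inverses 1 / z_k; a value
   r k = 0 contributes the factor E_p(0) = 1, so finite (or empty) lists of
   zeros are included. *)
Definition hadamard_product (R : realType) (p : nat) (f : R[i] -> R[i]) : Prop :=
  exists (m : nat) (Q : {poly R[i]}) (r : nat -> R[i]),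
    [/\ (size Q <= p.+1)%N,
        cvgn (series (fun k => Normc.normc (r k) ^+ p.+1)) &
        forall z, (fun n => z ^+ m * cexp Q.[z] *
                     \prod_(k < n) primary_factor p (r k * z)) @ \oo --> f z].

(* The genus is the least p for which a product as above exists; the zero
   function is counted as having genus 0. *)
Definition genus_le (R : realType) (q : nat) (f : R[i] -> R[i]) : Prop :=
  (forall z, f z = 0) \/ exists2 p, (p <= q)%N & hadamard_product p f.

(* {family compact, _ -> _} carries the topology of uniform convergence on
   compact sets.  The zero polynomial vanishes everywhere, so the zero function
   enters the closures below only as a limit. *)
Definition compact_closure (R : realType) (P : {poly R[i]} -> Prop) :
    set (R[i] -> R[i]) :=
  closure ([set f : R[i] -> R[i] | exists2 p : {poly R[i]}, P p & f = horner p]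
           : set {family compact, R[i] -> R[i]}).

Definition no_zeros_lower (R : realType) (p : {poly R[i]}) : Prop :=
  forall z : R[i], complex.Im z < 0 -> ~~ root p z.

Definition zeros_in_strip (R : realType) (mu : R) (p : {poly R[i]}) : Prop :=
  forall z : R[i], root p z -> `|complex.Im z| <= mu.

Definition Pbar_lower (R : realType) : set (R[i] -> R[i]) :=
  compact_closure (@no_zeros_lower R).

Definition Sbar (R : realType) (mu : R) : set (R[i] -> R[i]) :=
  compact_closure (zeros_in_strip mu).

Definition SbarR (R : realType) (mu : R) : set (R[i] -> R[i]) :=
  [set f | [/\ entire f, Sbar mu f & forall x : R, complex.Im (f x%:C) = 0]].

Definition Fock (R : realType) (beta : R) : set (R[i] -> R[i]) :=
  [set f | exists2 c, is_taylor c f &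
     cvgn (series (fun k => k`!%:R / beta ^+ k * Normc.normc (c k) ^+ 2))].

(* The operator sum_k a_k D^k.  limn is total, so diffop a f z is meaningful only
   where the series converges; diffop_cvg asserts that it converges uniformly on
   compact sets. *)
Definition diffop_partial (R : realType) (a : nat -> R[i]) (f : R[i] -> R[i])
    (n : nat) : R[i] -> R[i] :=
  fun z => \sum_(k < n) a k * derive1n k f z.

Definition diffop (R : realType) (a : nat -> R[i]) (f : R[i] -> R[i]) :
    R[i] -> R[i] :=
  fun z => limn (fun n => diffop_partial a f n z).

Definition diffop_cvg (R : realType) (a : nat -> R[i]) (f : R[i] -> R[i]) : Prop :=
  {family compact, diffop_partial a f @ \oo --> diffop a f}.

Definition conj_coef (R : realType) (a : nat -> R[i]) : nat -> R[i] :=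
  fun k => (a k)^*%C.

(* Main.v *)
(* Below F* denotes the function z |-> conj(F(conj z)).

   Symbol.  Polynomials p with zeros in Im > 0 approximate h, and their Jensen
   transforms sum_k n(n-1)...(n-k+1)/n^k p_k w^k keep the zeros there.  Since
   |h(w)| <= C e^(kappa |w|^2) for every kappa > gamma, the coefficients obtained
   after multiplication by e^(i lambda' w), with lambda' decreasing to lambda, are
   uniformly O(sqrt(y^k / k!)) for every y > 2 gamma, and they converge to the a_k.
   If q is a real polynomial with zeros in |Im| <= mu, then F = q(. + i lambda')
   satisfies |F| > |F*| for Im > delta (de Bruijn).  Operators D - alpha with
   Im alpha > 0 preserve this, so F + F* has its zeros in |Im| <= delta at the end.

   Limits.  For f in F_a, the inequality C(j+k, k) x^j y^k <= 1 with x + y = 1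
   dominates sum_k a_k D^k f geometrically and gives the Fock bound on the image;
   dominated convergence allows n -> oo.  For fixed n the symbol is of exponential
   type, so q may be replaced by f using Cauchy's estimates on large discs.

   Real approximants.  The closure only provides complex polynomials f_m -> f.  Fix
   z0 with Im z0 >= mu and f(z0) != 0.  Comparing f_m at z0 and z0 + i bounds
   sum |z0 - alpha|^-2 over the zeros of f_m.  An ultrafilter limit of the zeros close
   to z0 yields f(z0 + u) = f(z0) P(z0 + u) e^(S u - s u^2/2) (1 + small) on a large
   disc, with P a polynomial, Re s >= 0 and Im s small.  As f = f*, all zeros of P
   that are not far away belong to the real polynomial G = gcd(P, P* ); the remaining factor
   is close to a real multiple of a real Gaussian, which is approximated by
   (1 + b z/n)^n (1 - s z^2/(2n))^n. *)

Require Import Defs.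
From HB Require Import structures.
From mathcomp Require Import all_boot all_order all_algebra.
From mathcomp Require Import cyclic separable cyclotomic.
From mathcomp Require Import complex.
From mathcomp Require Import all_classical all_reals all_analysis.
From mathcomp Require Import ring lra zify.

Set Implicit Arguments.
Unset Strict Implicit.
Unset Printing Implicit Defensive.

Import Order.TTheory GRing.Theory Num.Theory.
Import numFieldNormedType.Exports.

Local Open Scope classical_set_scope.
Local Open Scope ring_scope.
Local Open Scope complex_scope.

(** The weights sqrt(x^k / k!) sit at the boundary of the Fock spaces, so every loss (a polynomial
    factor in k, a convolution with exponential coefficients, the passage from coefficients back to
    a norm) is paid by a slightly larger parameter; the strict bounds on a and b supply the room.
    The Jensen transform is forced by the mode of approximation: an approximant of h is controlled
    on one disc only, hence so are only its first coefficients, and the transform removes the others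
    without letting a zero leave the upper half-plane. The shift exceeds lambda because strict
    domination of F* requires a positive shift, also when lambda = 0. The two limits are nested in a
    fixed order: polynomials approach f on compact sets, not in the Fock norm, so q is chosen after
    n, against a symbol with |b_k| k! = O(L^k). Real polynomials are indispensable, since de
    Bruijn's comparison pairs each zero with its conjugate, and symmetrising a complex approximant
    may move zeros out of the strip. *)

Local Notation nc := Normc.normc.

(** * Real-valued modulus, real and imaginary parts, limits in [R[i]] *)

Section ComplexModulus.
Variable R : realType.
Implicit Types (z w : R[i]) (x y r e : R).

Lemma norm_nc z : `|z| = (nc z)%:C.
Proof. by []. Qed.

Lemma nc_ge0 z : 0 <= nc z.
Proof. by case: z => a b; rewrite sqrtr_ge0. Qed.

Lemma nc0 : nc (0 : R[i]) = 0.
Proof. exact: Normc.normc0. Qed.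

Lemma nc1 : nc (1 : R[i]) = 1.
Proof. exact: Normc.normc1. Qed.

Lemma ncM z w : nc (z * w) = nc z * nc w.
Proof. exact: Normc.normcM. Qed.

Lemma ncV z : nc z^-1 = (nc z)^-1.
Proof. exact: Normc.normcV. Qed.

Lemma ncX z n : nc (z ^+ n) = nc z ^+ n.
Proof.
elim: n => [|n IH]; first by rewrite !expr0 nc1.
by rewrite !exprS ncM IH.
Qed.

Lemma ncN z : nc (- z) = nc z.
Proof. exact: normcN. Qed.

Lemma nc_sub z w : nc (z - w) = nc (w - z).
Proof. by rewrite -ncN opprB. Qed.

Lemma ncD z w : nc (z + w) <= nc z + nc w.
Proof. exact: le_normcD. Qed.

Lemma ncB z w : nc (z - w) <= nc z + nc w.
Proof. by rewrite -(ncN w); exact: ncD. Qed.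

Lemma nc_eq0 z : (nc z == 0) = (z == 0).
Proof.
by apply/eqP/eqP => [|->]; [exact: Normc.eq0_normc|exact: nc0].
Qed.

Lemma nc_gt0 z : (0 < nc z) = (z != 0).
Proof. by rewrite lt_def nc_ge0 andbT nc_eq0. Qed.

Lemma ncR x : nc x%:C = `|x|.
Proof. by rewrite /= expr0n /= addr0 sqrtr_sqr. Qed.

Lemma ncJ z : nc z^*%C = nc z.
Proof. by case: z => a b /=; rewrite sqrrN. Qed.

Lemma ncM_nat n : nc (n%:R : R[i]) = n%:R.
Proof. by rewrite -(rmorph_nat (real_complex R)) ncR ger0_norm. Qed.

Lemma sqr_nc z : nc z ^+ 2 = complex.Re z ^+ 2 + complex.Im z ^+ 2.
Proof. by case: z => a b /=; rewrite sqr_sqrtr // addr_ge0 // sqr_ge0. Qed.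

Lemma nc_ge_Re z : `|complex.Re z| <= nc z.
Proof.
rewrite -(@ler_pXn2r _ 2) ?nnegrE ?nc_ge0 // sqr_nc real_normK ?num_real //.
by rewrite lerDl sqr_ge0.
Qed.

Lemma nc_ge_Im z : `|complex.Im z| <= nc z.
Proof.
rewrite -(@ler_pXn2r _ 2) ?nnegrE ?nc_ge0 // sqr_nc real_normK ?num_real //.
by rewrite lerDr sqr_ge0.
Qed.

Lemma nc_le_ReIm z : nc z <= `|complex.Re z| + `|complex.Im z|.
Proof.
rewrite -(@ler_pXn2r _ 2) ?nnegrE ?nc_ge0 ?addr_ge0 // sqr_nc.
rewrite sqrrD !real_normK ?num_real //.
have : 0 <= `|complex.Re z| * `|complex.Im z| by rewrite mulr_ge0.
lra.
Qed.

Lemma nc_sum (I : Type) (s : seq I) (P : pred I) (F : I -> R[i]) :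
  nc (\sum_(i <- s | P i) F i) <= \sum_(i <- s | P i) nc (F i).
Proof.
elim/big_ind2 : _ => [|u v u' v' h h'|//]; first by rewrite nc0.
by apply: le_trans (ncD _ _) _; exact: lerD.
Qed.

Lemma nc_prod (I : Type) (s : seq I) (P : pred I) (F : I -> R[i]) :
  nc (\prod_(i <- s | P i) F i) = \prod_(i <- s | P i) nc (F i).
Proof. by elim/big_ind2 : _ => [|u v u' v' <- <-|//]; rewrite ?nc1 ?ncM. Qed.

Lemma ReD z w : complex.Re (z + w) = complex.Re z + complex.Re w.
Proof. by case: z; case: w. Qed.

Lemma ImD z w : complex.Im (z + w) = complex.Im z + complex.Im w.
Proof. by case: z; case: w. Qed.

Lemma ReN z : complex.Re (- z) = - complex.Re z.
Proof. by case: z. Qed.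

Lemma ImN z : complex.Im (- z) = - complex.Im z.
Proof. by case: z. Qed.

Lemma ReM z w : complex.Re (z * w) =
  complex.Re z * complex.Re w - complex.Im z * complex.Im w.
Proof. by case: z; case: w. Qed.

Lemma ImM z w : complex.Im (z * w) =
  complex.Re z * complex.Im w + complex.Im z * complex.Re w.
Proof. by case: z => a b; case: w => c d /=; rewrite addrC [b * _]mulrC. Qed.

Lemma ImV z : complex.Im z^-1 = - complex.Im z / nc z ^+ 2.
Proof. by rewrite sqr_nc; case: z => p q /=; rewrite ?mulNr. Qed.

Lemma Re_sum (I : Type) (s : seq I) (P : pred I) (F : I -> R[i]) :
  complex.Re (\sum_(i <- s | P i) F i) = \sum_(i <- s | P i) complex.Re (F i).
Proof. by elim/big_ind2 : _ => [//|u v u' v' <- <-|//]; rewrite ReD. Qed.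

Lemma Im_sum (I : Type) (s : seq I) (P : pred I) (F : I -> R[i]) :
  complex.Im (\sum_(i <- s | P i) F i) = \sum_(i <- s | P i) complex.Im (F i).
Proof. by elim/big_ind2 : _ => [//|u v u' v' <- <-|//]; rewrite ImD. Qed.

(** In the order of [R[i]], 0 < e forces e to be real, so the complex epsilons of the normed module
    reduce to real ones. *)
Lemma cvg_ncP (T : Type) (F : set_system T) {FF : Filter F} (f : T -> R[i]) l :
  (f @ F --> l) <-> (forall e, 0 < e -> \forall t \near F, nc (f t - l) < e).
Proof.
split => [/cvgrPdist_lt h e e0|h].
  have /h : 0 < e%:C by rewrite ltcR.
  by apply: filterS => t; rewrite distrC norm_nc ltcR.
apply/cvgrPdist_lt => e e0.
have er : e = (complex.Re e)%:C.
  by move: e0; rewrite ltcE /= => /andP[/eqP]; case: (e) => a b /= ->.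
have /h : 0 < complex.Re e by move: e0; rewrite er ltcR.
by apply: filterS => t; rewrite er distrC norm_nc ltcR.
Qed.

Section ComplexLimits.
Context {T : Type} {F : set_system T} {FF : Filter F}.
Implicit Types (u v : T -> R[i]) (a b : R[i]).

Lemma cvgcD u v a b : u @ F --> a -> v @ F --> b -> (fun t => u t + v t) @ F --> a + b.
Proof. by move=> h1 h2; exact: (@cvgD R[i] R[i] T F FF u v a b h1 h2). Qed.

Lemma cvgcB u v a b : u @ F --> a -> v @ F --> b -> (fun t => u t - v t) @ F --> a - b.
Proof. by move=> h1 h2; exact: (@cvgB R[i] R[i] T F FF u v a b h1 h2). Qed.

Lemma cvgcM u v a b : u @ F --> a -> v @ F --> b -> (fun t => u t * v t) @ F --> a * b.
Proof. by move=> h1 h2; exact: (@cvgM R[i] T F FF u v a b h1 h2). Qed.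

Lemma cvgc_cst a : (fun _ : T => a) @ F --> a.
Proof. exact: cvg_cst. Qed.

Lemma cvgc_sum (I : Type) (s : seq I) (u : I -> T -> R[i]) (a : I -> R[i]) :
  (forall i, u i @ F --> a i) -> (fun t => \sum_(i <- s) u i t) @ F --> \sum_(i <- s) a i.
Proof.
move=> h; elim: s => [|i s IH].
  rewrite big_nil (_ : (fun t => _) = fun=> 0); first exact: cvgc_cst.
  by apply/funext => t; rewrite big_nil.
rewrite big_cons (_ : (fun t => _) = fun t => u i t + \sum_(j <- s) u j t).
  exact: (cvgcD (h i) IH).
by apply/funext => t; rewrite big_cons.
Qed.

Lemma cvgc_prod (I : Type) (s : seq I) (u : I -> T -> R[i]) (a : I -> R[i]) :
  (forall i, u i @ F --> a i) -> (fun t => \prod_(i <- s) u i t) @ F --> \prod_(i <- s) a i.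
Proof.
move=> h; elim: s => [|i s IH].
  rewrite big_nil (_ : (fun t => _) = fun=> 1); first exact: cvgc_cst.
  by apply/funext => t; rewrite big_nil.
rewrite big_cons (_ : (fun t => _) = fun t => u i t * \prod_(j <- s) u j t).
  exact: (cvgcM (h i) IH).
by apply/funext => t; rewrite big_cons.
Qed.

End ComplexLimits.

End ComplexModulus.

Arguments cvgc_cst {R T F FF} a.

(** * The compact-open topology expressed by discs *)

Section LocallyUniform.
Variable R : realType.
Implicit Types (z w : R[i]) (x y r e : R) (f g : R[i] -> R[i]).

Lemma nc_ent e : 0 < e -> entourage [set xy : R[i] * R[i] | nc (xy.1 - xy.2) < e].
Proof.
move=> e0; rewrite -entourage_ballE; exists e%:C => /=; first by rewrite ltcR.
by move=> [x y] /=; rewrite -ball_normE /ball_ /= norm_nc ltcR.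
Qed.

Lemma ent_nc (E : set (R[i] * R[i])) : entourage E ->
  exists2 e, 0 < e & forall x y : R[i], nc (x - y) < e -> E (x, y).
Proof.
rewrite -entourage_ballE => -[e /= e0 eE].
have er : e = (complex.Re e)%:C.
  by move: e0; rewrite ltcE /= => /andP[/eqP]; case: (e) => a b /= ->.
exists (complex.Re e); first by move: e0; rewrite er ltcR.
by move=> x y h; apply: eE; rewrite /= -ball_normE /ball_ /= norm_nc er ltcR.
Qed.

Lemma nc_continuous : continuous (@nc R).
Proof.
move=> z; apply/(@cvgrPdist_lt _ _ _ (nbhs z) (nbhs_filter z)) => e e0.
have /(_ e e0) := (@cvg_ncP R _ (nbhs z) (nbhs_filter z) id z).1 (@cvg_id _ _).
apply: filterS => w; apply: le_lt_trans.
have h1 := ncD (w - z) z; have h2 := ncD (z - w) w.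
by rewrite !subrK (nc_sub z w) in h1 h2; rewrite ler_norml; apply/andP; split; lra.
Qed.

Lemma compact_nc_bounded (A : set R[i]) :
  compact A -> exists M, forall z, A z -> nc z <= M.
Proof.
move=> cA; have cncA : compact (@nc R @` A).
  by apply: continuous_compact => //; apply: continuous_subspaceT => z; exact: nc_continuous.
have [M [_ hM]] := compact_bounded cncA.
exists (M + 1) => z Az; apply: le_trans (ler_norm _) _.
by apply: hM; [rewrite ltrDl|exists z].
Qed.

Lemma compact_disc r : exists2 A : set R[i], compact A &
  forall z, nc z <= r -> A z.
Proof.
pose I := `[- r, r]%classic : set R.
exists ((fun p : R * R => p.1 +i* p.2) @` (I `*` I)); last first.
  move=> z zr; exists (complex.Re z, complex.Im z); last by case: z zr.
  rewrite /I; split; rewrite /= in_itv /= -ler_norml.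
    exact: le_trans (nc_ge_Re _) _.
  exact: le_trans (nc_ge_Im _) _.
apply: continuous_compact; last by apply: compact_setX; exact: segment_compact.
apply: continuous_subspaceT => -[a b].
apply/cvg_ncP => e e0.
have e2 : 0 < e / 2 by rewrite divr_gt0.
near=> p; apply: le_lt_trans (nc_le_ReIm _) _.
rewrite ReD ReN ImD ImN /= (splitr e); apply: ltrD.
  near: p; have : @fst R R @ nbhs (a, b) --> a by exact: cvg_fst.
  by move/cvgrPdist_lt => /(_ _ e2); apply: filterS => p; rewrite distrC.
near: p; have : @snd R R @ nbhs (a, b) --> b by exact: cvg_snd.
by move/cvgrPdist_lt => /(_ _ e2); apply: filterS => p; rewrite distrC.
Unshelve. all: by end_near. Qed.

Lemma compact_cvgP (u : nat -> R[i] -> R[i]) f :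
  {family compact, u @ \oo --> f} <->
  (forall r e, 0 < e -> \forall n \near \oo, forall z, nc z <= r -> nc (u n z - f z) < e).
Proof.
split => [/fam_cvgP h r e e0|h].
  have [A cA hA] := compact_disc r.
  have nf : nbhs (f : {uniform` A -> R[i]})
      [set g | forall z, A z -> nc (f z - g z) < e].
    apply/uniform_nbhs; exists [set xy : R[i] * R[i] | nc (xy.1 - xy.2) < e].
    by split => //; exact: nc_ent.
  have : \forall n \near \oo, forall z, A z -> nc (f z - u n z) < e := h A cA _ nf.
  by apply: filterS => n hn z zr; rewrite nc_sub; apply: hn; exact: hA.
apply/fam_cvgP => A cA; have [M hM] := compact_nc_bounded cA.
move=> P /uniform_nbhs [E [/ent_nc [e e0 eE]]] EP.
have := h M e e0; apply: filterS => n hn; apply: EP => z /hM zM.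
by apply: eE; rewrite nc_sub; exact: hn.
Qed.

Lemma compact_closureP (P : {poly R[i]} -> Prop) f :
  compact_closure P f <->
  (forall r e, 0 < e -> exists2 p, P p & forall z, nc z <= r -> nc (p.[z] - f z) < e).
Proof.
split => [h r e e0|h].
  have [A cA hA] := compact_disc r.
  have /h [_ [[p Pp ->]] hp] : nbhs (f : {family compact, R[i] -> R[i]})
     [set g | forall z, A z -> [set xy : R[i] * R[i] | nc (xy.1 - xy.2) < e] (f z, g z)].
    by apply: fam_nbhs => //; exact: nc_ent.
  by exists p => // z zr; rewrite nc_sub; apply: hp; exact: hA.
(* A sequence that is 1/(n+1)-close on the disc of radius n converges uniformly on compact sets,
   hence enters every neighbourhood of f. *)
have /choice[p hp] : forall n : nat, exists p, P p /\ forall z, nc z <= n%:R ->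
    nc (p.[z] - f z) < n.+1%:R^-1 :> R.
  move=> n; have [|p Pp hp] := h n%:R n.+1%:R^-1; first by rewrite invr_gt0.
  by exists p.
have pf : {family compact, (fun n => horner (p n)) @ \oo --> f}.
  apply/compact_cvgP => r e e0; near=> n => z zr.
  apply: (@lt_trans _ _ n.+1%:R^-1).
    apply: (hp n).2; apply: le_trans zr _.
    by near: n; exact: nbhs_infty_ger.
  by near: n; exact: near_infty_natSinv_lt (PosNum e0).
move=> B nB.
have [n _ hn] : \forall n \near \oo, B (horner (p n)) by exact: pf.
by exists (horner (p n)); split; [exists (p n) => //; exact: (hp n).1|exact: (hn n (leqnn n))].
Unshelve. all: by end_near. Qed.

End LocallyUniform.

(** * Everywhere convergent power series and Cauchy's estimates *)

Section TaylorSeries.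
Variable R : realType.
Implicit Types (z w : R[i]) (x y r e : R) (f g : R[i] -> R[i]) (c d : nat -> R[i]).

Lemma cvg_nc_le (T : Type) (F : set_system T) {FF : ProperFilter F} (u : T -> R[i]) l M :
  u @ F --> (l : R[i]) -> (\forall t \near F, nc (u t) <= M) -> nc l <= M.
Proof.
move=> /cvg_ncP ul uM; apply/ler_addgt0Pr => e e0.
have [t [h1 h2]] := filter_ex (filterI (ul e e0) uM).
have := ncD (l - u t) (u t); rewrite subrK => h3.
rewrite nc_sub in h1; apply: le_trans h3 _; rewrite [M + e]addrC.
by apply: lerD => //; exact: ltW.
Qed.

Lemma cvg_unique_nc (T : Type) (F : set_system T) {FF : ProperFilter F}
  (u : T -> R[i]) l1 l2 : u @ F --> (l1 : R[i]) -> u @ F --> (l2 : R[i]) -> l1 = l2.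
Proof.
move=> /cvg_ncP u1 /cvg_ncP u2; apply/eqP; rewrite -subr_eq0 -nc_eq0.
rewrite eq_le nc_ge0 andbT; apply/ler_addgt0Pr => e e0; rewrite add0r.
have e2 : 0 < e / 2 by rewrite divr_gt0.
have [t [h1 h2]] := filter_ex (filterI (u1 _ e2) (u2 _ e2)).
have := ncD (l1 - u t) (u t - l2); rewrite addrA subrK => h3.
rewrite nc_sub in h1; lra.
Qed.

Lemma sum_geom_le (s : R) n : 0 <= s -> s < 1 -> \sum_(k < n) s ^+ k <= (1 - s)^-1.
Proof.
move=> s0 s1; have s1' : 0 < 1 - s by lra.
rewrite -[leRHS]mul1r ler_pdivlMr // mulrC.
have -> : 1 - s = - (s - 1) by lra.
by rewrite mulNr -subrX1; have := exprn_ge0 n s0; lra.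
Qed.

(** The convergence criterion behind nearly all series here; completeness is used through the real
    and imaginary parts. The explicit tail at n = 0 also bounds the sum itself. *)
Lemma geometric_series (u : nat -> R[i]) M (s : R) : 0 <= s -> s < 1 ->
  (forall k, nc (u k) <= M * s ^+ k) ->
  exists2 l, series u @ \oo --> l &
     forall n, nc (l - \sum_(k < n) u k) <= M * s ^+ n / (1 - s).
Proof.
move=> s0 s1 hu.
have M0 : 0 <= M by have := hu 0%N; rewrite expr0 mulr1; apply: le_trans; exact: nc_ge0.
have gs : cvgn (series (fun k => M * s ^+ k)).
  rewrite (_ : (fun k => M * s ^+ k) = geometric M s) //.
  by apply: is_cvg_geometric_series; rewrite ger0_norm.
have cre (v : nat -> R) : (forall k, `|v k| <= M * s ^+ k) -> cvgn (series v).
  move=> hv; apply: normed_cvg; apply: series_le_cvg gs => // k.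
    exact: normr_ge0.
  exact: le_trans (normr_ge0 (v k)) (hv k).
have /cre cRe : forall k, `|complex.Re (u k)| <= M * s ^+ k.
  by move=> k; apply: le_trans (nc_ge_Re _) _.
have /cre cIm : forall k, `|complex.Im (u k)| <= M * s ^+ k.
  by move=> k; apply: le_trans (nc_ge_Im _) _.
pose l := lim (series (fun k => complex.Re (u k)) @ \oo)
   +i* lim (series (fun k => complex.Im (u k)) @ \oo).
have ul : series u @ \oo --> l.
  apply/cvg_ncP => e e0; have e2 : 0 < e / 2 by rewrite divr_gt0.
  have /cvgrPdist_lt /(_ _ e2) h1 := cRe.
  have /cvgrPdist_lt /(_ _ e2) h2 := cIm.
  near=> n; apply: le_lt_trans (nc_le_ReIm _) _.
  rewrite ReD ReN ImD ImN /series /= Re_sum Im_sum (splitr e).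
  apply: ltrD; rewrite distrC.
    by near: n; exact: h1.
  by near: n; exact: h2.
exists l => // n.
have : (fun m => series u m - \sum_(k < n) u k) @ \oo --> l - \sum_(k < n) u k.
  exact: (cvgcB ul (cvgc_cst _)).
move/cvg_nc_le; apply; near=> m.
have nm : (n <= m)%N by near: m; exact: nbhs_infty_ge.
rewrite /series /= -(big_mkord xpredT u) (big_cat_nat (n := n)) //= addrAC subrr add0r.
apply: le_trans (nc_sum _ _ _) _.
apply: le_trans (ler_sum _ (fun k _ => hu k)) _.
rewrite -{1}[n]add0n big_addn big_mkord.
under eq_bigr do rewrite exprD mulrCA.
rewrite -mulr_suml mulrC ler_wpM2l ?sum_geom_le //.
by rewrite mulr_ge0 // exprn_ge0.
Unshelve. all: by end_near. Qed.

Lemma poly_is_taylor (p : {poly R[i]}) : is_taylor (fun k => p`_k) (horner p).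
Proof.
move=> z; apply/cvg_ncP => e e0; near=> n.
have np : (size p <= n)%N by near: n; exact: nbhs_infty_ge.
by rewrite /series /= big_mkord -horner_coef_wide // subrr nc0.
Unshelve. all: by end_near. Qed.

Lemma is_taylorD c d f g : is_taylor c f -> is_taylor d g ->
  is_taylor (fun k => c k + d k) (fun z => f z + g z).
Proof.
move=> cf dg z; have -> : series (fun k => (c k + d k) * z ^+ k) =
  series (fun k => c k * z ^+ k) \+ series (fun k => d k * z ^+ k).
  apply/funext => n; rewrite /series /= -big_split /=.
  by apply: eq_bigr => k _; rewrite mulrDl.
exact: (cvgcD (cf z) (dg z)).
Qed.

Lemma is_taylorZ c f (a : R[i]) : is_taylor c f ->
  is_taylor (fun k => a * c k) (fun z => a * f z).
Proof.
move=> cf z; have -> : series (fun k => (a * c k) * z ^+ k) =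
  (fun n => a * series (fun k => c k * z ^+ k) n).
  apply/funext => n; rewrite /series /= mulr_sumr.
  by apply: eq_bigr => k _; rewrite mulrA.
exact: (cvgcM (cvgc_cst _) (cf z)).
Qed.

Lemma is_taylorB c d f g : is_taylor c f -> is_taylor d g ->
  is_taylor (fun k => c k - d k) (fun z => f z - g z).
Proof.
move=> cf dg z; have h := is_taylorD cf (is_taylorZ (a := -1) dg).
have := h z; rewrite mulN1r.
by under eq_fun do rewrite mulN1r.
Qed.

(** A term is the difference of two consecutive partial sums, both eventually within 1 of the limit;
    the finitely many earlier terms are added to the bound. *)
Lemma is_taylor_bounded c f r : is_taylor c f ->
  exists2 M, 0 <= M & forall k, nc (c k) * r ^+ k <= M.
Proof.
move=> cf; have := cf r%:C => /[dup] /cvg_ncP /(_ 1 ltr01) [N _ hN] _.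
exists (1 + 1 + \sum_(k < N) `|nc (c k) * r ^+ k|).
  by rewrite addr_ge0 // sumr_ge0.
move=> k; have [kN|Nk] := ltnP k N.
  apply: le_trans (ler_norm _) _.
  rewrite (bigD1 (Ordinal kN)) //= addrCA lerDl addr_ge0 // ?sumr_ge0 //.
apply: le_trans (_ : 1 + 1 <= _); last by rewrite lerDl sumr_ge0.
have h1 := hN k Nk; have h2 := hN k.+1 (leqW Nk).
have E : c k * r%:C ^+ k = (series (fun k => c k * r%:C ^+ k) k.+1 - f r%:C)
   - (series (fun k => c k * r%:C ^+ k) k - f r%:C).
  by rewrite /series /= big_nat_recr //= opprB addrA subrK addrAC subrr add0r.
apply: le_trans (_ : nc (c k * r%:C ^+ k) <= _).
  by rewrite ncM ncX ncR ler_wpM2l ?nc_ge0 // -normrX ler_norm.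
rewrite E; apply: le_trans (ncB _ _) _.
by apply: lerD; exact: ltW.
Qed.

Lemma is_taylor_tail c f r M : is_taylor c f -> 0 <= r ->
  (forall k, nc (c k) * (2 * r) ^+ k <= M) ->
  forall n z, nc z <= r -> nc (f z - \sum_(k < n) c k * z ^+ k) <= 2 * M / 2 ^+ n.
Proof.
move=> cf r0 hM n z zr.
have [|||l hl hn] := @geometric_series (fun k => c k * z ^+ k) M (2^-1); [lra|lra| |].
  move=> k; rewrite exprVn ler_pdivlMr ?exprn_gt0 //.
  apply: le_trans (hM k); rewrite ncM ncX -mulrA ler_wpM2l ?nc_ge0 //.
  by rewrite mulrC exprMn ler_wpM2l ?exprn_ge0 // lerXn2r ?nnegrE ?nc_ge0.
rewrite -(cvg_unique_nc hl (cf z)); apply: le_trans (hn n) _.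
by rewrite exprVn le_eqVlt; apply/orP; left; apply/eqP; field; rewrite expf_neq0.
Qed.

Lemma is_taylor_le c f r M : is_taylor c f -> 0 <= r ->
  (forall k, nc (c k) * (2 * r) ^+ k <= M) -> forall z, nc z <= r -> nc (f z) <= 2 * M.
Proof.
move=> cf r0 hM z zr; have := is_taylor_tail cf r0 hM 0 zr.
by rewrite big_ord0 subr0 expr0 divr1.
Qed.

Lemma taylor_exists c : (forall r, 0 < r -> exists M, forall k, nc (c k) * r ^+ k <= M) ->
  exists f, is_taylor c f.
Proof.
move=> h; suff H : forall z, exists l : R[i], series (fun k => c k * z ^+ k) @ \oo --> l.
  by have [f hf] := choice H; exists f.
move=> z; have r0 : 0 < nc z + 1 by have := nc_ge0 z; lra.
have [|M hM] := h (2 * (nc z + 1)); first by lra.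
have [|||l hl hn] := @geometric_series (fun k => c k * z ^+ k) M (2^-1); [lra|lra| |by exists l].
move=> k; rewrite exprVn ler_pdivlMr ?exprn_gt0 //.
apply: le_trans (hM k); rewrite ncM ncX -mulrA ler_wpM2l ?nc_ge0 //.
rewrite mulrC exprMn ler_wpM2l ?exprn_ge0 // lerXn2r ?nnegrE ?nc_ge0 //; lra.
Qed.

(** Roots of unity replace the circle integral in Cauchy's estimate. In characteristic 0 the
    polynomial X^n - 1 is separable, so it has n distinct roots, one of which is primitive. *)
Lemma prim_root_exists n : (0 < n)%N -> exists z : R[i], n.-primitive_root z.
Proof.
move=> n0; have [r rE] := closed_field_poly_normal ('X^n - 1 : {poly R[i]}).
rewrite (monicP (monic_Xn_sub_1 _ n0)) scale1r in rE.
have : has n.-primitive_root r; last by move/hasP => [z _ hz]; exists z.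
apply: has_prim_root => //.
- apply/allP => z zr; rewrite unity_rootE; move: (root_prod_XsubC r z).
  by rewrite -rE zr rootE !hornerE ?hornerXn subr_eq0 => ->.
- rewrite -separable_prod_XsubC -rE; apply: separable_Xn_sub_1.
  by rewrite pnatr_eq0 -lt0n.
- by rewrite -ltnS -(size_prod_XsubC r id) -rE size_XnsubC.
Qed.

(* Averaging p(r w^j) w^(-jk) over the powers of a primitive root w of large
   order isolates the k-th coefficient. *)
Lemma poly_cauchy (p : {poly R[i]}) r M : 0 <= r ->
  (forall z, nc z <= r -> nc p.[z] <= M) -> forall k, nc p`_k * r ^+ k <= M.
Proof.
move=> r0 hM k; pose N := (size p + k).+1.
have [w wN] := @prim_root_exists N isT.
have nw : nc w = 1.
  apply/eqP; rewrite -(@pexpr_eq1 _ _ N) ?nc_ge0 //.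
  by rewrite -ncX (prim_expr_order wN) nc1.
have E : \sum_(j < N) p.[r%:C * w ^+ j] * w ^+ (j * (N - k)) =
    N%:R * (p`_k * r%:C ^+ k).
  under eq_bigr => j _.
    rewrite (@horner_coef_wide _ N) ?mulr_suml; last by rewrite /N ltnW // ltnS leq_addr.
    over.
  rewrite exchange_big /=.
  have kN : (k < N)%N by rewrite /N ltnS leq_addl.
  have -> : N%:R * (p`_k * r%:C ^+ k) = \sum_(i < N) (if i == Ordinal kN then N%:R * (p`_k * r%:C ^+ k) else 0).
    by rewrite -big_mkcond big_pred1_eq.
  apply: eq_bigr => i _; under eq_bigr => j _.
    rewrite exprMn -exprM -!mulrA -exprD -mulnDr [(j * _)%N]mulnC; over.
  rewrite -mulr_sumr -mulr_sumr.
  case: eqP => [->|ik] /=.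
    rewrite subnKC; last exact: ltnW.
    under eq_bigr do rewrite exprM (prim_expr_order wN) expr1n.
    by rewrite sumr_const card_ord; ring.
  have wn1 : w ^+ (i + (N - k)) != 1.
    rewrite -(prim_order_dvd wN); apply/negP => /dvdnP [q hq]; apply: ik.
    apply/val_inj => /=; have iN := ltn_ord i.
    (* The exponent i + (N - k) lies strictly between 0 and 2N, so it is a multiple of N only for i
       = k; N - k plays the role of -k. *)
    case: q hq => [|[|q]]; rewrite ?mul0n ?mul1n => hq.
    - by have : (0 < N - k)%N; [rewrite subn_gt0|move: hq; lia].
    - by move: hq; lia.
    - have : (N + N <= i + (N - k))%N by rewrite hq !mulSn addnA leq_addr.
      by lia.
  have /eqP : (w ^+ (i + (N - k)) - 1) * \sum_(j < N) w ^+ ((i + (N - k)) * j) = 0.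
    under eq_bigr do rewrite exprM.
    by rewrite -subrX1 -exprM mulnC exprM (prim_expr_order wN) expr1n subrr.
  by rewrite mulf_eq0 subr_eq0 (negPf wn1) /= => /eqP ->; rewrite !mulr0.
have N0 : 0 < N%:R :> R by rewrite ltr0n.
rewrite -(ler_pM2l N0).
have -> : N%:R * (nc p`_k * r ^+ k) = nc (N%:R * (p`_k * r%:C ^+ k)).
  by rewrite !ncM ncM_nat ncX ncR ger0_norm.
rewrite -E; apply: le_trans (nc_sum _ _ _) _.
apply: (@le_trans _ _ (\sum_(j < N) M)); last first.
  by rewrite sumr_const card_ord mulr_natl.
apply: ler_sum => j _; rewrite ncM ncX nw expr1n mulr1; apply: hM.
by rewrite ncM ncX nw expr1n mulr1 ncR ger0_norm.
Qed.

(** A Taylor polynomial of length n > k has the same k-th coefficient as f and is e-close to f on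
    the disc, which reduces the claim to polynomials. *)
Lemma cauchy_estimate c f r M : is_taylor c f -> 0 <= r ->
  (forall z, nc z <= r -> nc (f z) <= M) -> forall k, nc (c k) * r ^+ k <= M.
Proof.
move=> cf r0 hM k.
have [B B0 hB] := is_taylor_bounded (2 * r) cf.
apply/ler_addgt0Pr => e e0.
have [n kn hn] : exists2 n, (k < n)%N & 2 * B / 2 ^+ n <= e.
  have : (fun n => (2 * B) * 2^-1 ^+ n) @ \oo --> (0 : R).
    rewrite -[0](mulr0 (2 * B)); apply: cvgM; first exact: cvg_cst.
    by apply: cvg_expr; rewrite ger0_norm; lra.
  move=> /cvgrPdist_lt /(_ _ e0) h.
  near \oo => n; exists n; first by near: n; exact: nbhs_infty_gt.
  apply: le_trans (ler_norm _) _; rewrite -normrN -[- _]add0r -exprVn; apply: ltW.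
  by near: n.
pose p := \poly_(i < n) c i.
have pE z : p.[z] = \sum_(i < n) c i * z ^+ i by rewrite horner_poly.
have := @poly_cauchy p r (M + e) r0 _ k.
rewrite coef_poly kn; apply => z zr.
have := ncD (f z) (p.[z] - f z); rewrite addrC subrK => h.
apply: le_trans h _; apply: lerD; first exact: hM.
by apply: le_trans hn; rewrite nc_sub pE; exact: is_taylor_tail zr.
Unshelve. all: by end_near. Qed.

End TaylorSeries.

(** * Termwise differentiation *)

Section Derivatives.
Variable R : realType.
Implicit Types (z w : R[i]) (x y r e : R) (f g : R[i] -> R[i]) (c d : nat -> R[i]).

(** Quadratic in u with only a polynomial factor in n, so that it can be summed against Taylor
    coefficients. The bound 1 <= r allows powers of r to be rounded up. *)
Lemma binomial_remainder r z (u : R[i]) n : 1 <= r -> nc z <= r -> nc (z + u) <= r ->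
  nc ((z + u) ^+ n - z ^+ n - n%:R * z ^+ n.-1 * u) <= nc u ^+ 2 * (n%:R ^+ 2 * r ^+ n).
Proof.
move=> r1 zr zur; elim: n => [|n IH].
  by rewrite !expr0 subrr !mul0r subr0 nc0 mulr_ge0 // ?sqr_ge0 // mulr_ge0 ?ler01 // ?sqr_ge0.
have E : (z + u) ^+ n.+1 - z ^+ n.+1 - n.+1%:R * z ^+ n.+1.-1 * u =
  (z + u) * ((z + u) ^+ n - z ^+ n - n%:R * z ^+ n.-1 * u) + n%:R * z ^+ n.-1 * u ^+ 2.
  case: n {IH} => [|n] /=; first by ring.
  by rewrite !exprS; ring.
rewrite E; apply: le_trans (ncD _ _) _; rewrite !ncM !ncX ncM_nat.
have rn0 : 0 <= r ^+ n by rewrite exprn_ge0 //; lra.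
have h1 : nc (z + u) * nc ((z + u) ^+ n - z ^+ n - n%:R * z ^+ n.-1 * u) <=
   r * (nc u ^+ 2 * (n%:R ^+ 2 * r ^+ n)) by apply: ler_pM => //; exact: nc_ge0.
have h2 : nc z ^+ n.-1 <= r ^+ n.+1.
  apply: (@le_trans _ _ (r ^+ n.-1)).
    by rewrite lerXn2r ?nnegrE ?nc_ge0 //; lra.
  by apply: ler_weXn2l => //; case: (n) => // m; rewrite ltnW // ltnS leqnSn.
have h3 : n%:R * nc z ^+ n.-1 * nc u ^+ 2 <= n%:R * r ^+ n.+1 * nc u ^+ 2.
  by rewrite ler_wpM2r ?sqr_ge0 // ler_wpM2l.
apply: le_trans (lerD h1 h3) _.
have rs0 : 0 <= r ^+ n.+1 by rewrite exprn_ge0 //; lra.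
rewrite -natr1 -subr_ge0.
have -> : nc u ^+ 2 * ((n%:R + 1) ^+ 2 * r ^+ n.+1) -
  (r * (nc u ^+ 2 * (n%:R ^+ 2 * r ^+ n)) + n%:R * r ^+ n.+1 * nc u ^+ 2) =
  nc u ^+ 2 * (r ^+ n.+1 * (n%:R + 1)) by rewrite !exprS; ring.
by rewrite mulr_ge0 ?sqr_ge0 // mulr_ge0 // addr_ge0.
Qed.

(** The differentiated series defines a candidate g first; then |f(z + u) - f(z) - g(z) u| <= 2 M
    |u|^2 identifies it with the limit in [derive1]. *)
Lemma is_taylor_derive1 c f : is_taylor c f ->
  is_taylor (fun j => j.+1%:R * c j.+1) (derive1 f).
Proof.
move=> cf; have [g gt] : exists g, is_taylor (fun j => j.+1%:R * c j.+1) g.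
  apply: taylor_exists => r r0; have [M M0 hM] := is_taylor_bounded (2 * r) cf.
  exists (M / r) => k; rewrite ler_pdivlMr // -mulrA -exprSr.
  apply: le_trans (hM k.+1); rewrite ncM ncM_nat exprMn -[leLHS]mulrA mulrCA.
  rewrite ler_wpM2l ?nc_ge0 // ler_wpM2r ?(exprn_ge0 _ (ltW r0)) //.
  by rewrite -natrX ler_nat ltnW // ltn_expl.
suff -> : derive1 f = g by [].
apply/funext => z; rewrite /derive1; apply: cvg_lim; first exact: norm_hausdorff.
pose r := nc z + 1; have r1 : 1 <= r by have := nc_ge0 z; rewrite /r; lra.
(* Of 8^n = 2^n 2^n 2^n, two factors absorb the n^2 of the remainder and the third gives a geometric
   series of ratio 1/2. *)
have [M M0 hM] := is_taylor_bounded (8 * r) cf.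
have key u : nc u <= 1 -> nc (f (z + u) - f z - g z * u) <= nc u ^+ 2 * (2 * M).
  move=> u1; have zr : nc z <= r by rewrite /r; lra.
  have zur : nc (z + u) <= r by have := ncD z u; rewrite /r; lra.
  pose v n := c n * ((z + u) ^+ n - z ^+ n - n%:R * z ^+ n.-1 * u).
  have vl : series v @ \oo --> f (z + u) - f z - g z * u.
    have gs : series (fun n => n%:R * c n * z ^+ n.-1) @ \oo --> g z.
      rewrite -cvg_shiftS (_ : [sequence _]_n = series (fun j => j.+1%:R * c j.+1 * z ^+ j)).
        exact: gt.
      by apply/funext => n; rewrite /series /= big_nat_recl //= !mul0r add0r.
    have -> : series v = (fun n => series (fun n => c n * (z + u) ^+ n) n -
       series (fun n => c n * z ^+ n) n - series (fun n => n%:R * c n * z ^+ n.-1) n * u).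
      apply/funext => n; rewrite /series /= mulr_suml -sumrB -sumrB.
      by apply: eq_bigr => i _; rewrite /v; ring.
    exact: (cvgcB (cvgcB (cf _) (cf _)) (cvgcM gs (cvgc_cst _))).
  have [|||l vl' lb] := @geometric_series _ v (nc u ^+ 2 * M) 2^-1; [lra|lra| |].
    move=> k; rewrite /v ncM; apply: le_trans (ler_wpM2l (nc_ge0 _) (binomial_remainder k r1 zr zur)) _.
    rewrite [leLHS]mulrCA -[leRHS]mulrA; apply: ler_wpM2l; first exact: sqr_ge0.
    rewrite exprVn ler_pdivlMr ?exprn_gt0 //.
    apply: le_trans (hM k); rewrite -[leLHS]mulrA; apply: ler_wpM2l; first exact: nc_ge0.
    have -> : 8 = 2 * 2 * 2 :> R by lra.
    rewrite [leRHS](_ : _ = (2 ^+ k * 2 ^+ k) * (r ^+ k * 2 ^+ k)); last by rewrite !exprMn; ring.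
    rewrite -[leLHS]mulrA; apply: ler_wpM2r.
      by rewrite mulr_ge0 ?exprn_ge0 //; lra.
    by rewrite expr2; apply: ler_pM => //; rewrite -natrX ler_nat ltnW // ltn_expl.
  rewrite -(cvg_unique_nc vl' vl); have := lb 0%N; rewrite big_ord0 subr0 => h.
  by apply: le_trans h _; rewrite expr0 mulr1 le_eqVlt; apply/orP; left; apply/eqP; field.
apply/(@cvg_ncP _ _ _ (dnbhs_filter _)) => e e0.
pose d := e / (2 * M + 1); have d0 : 0 < d by rewrite divr_gt0 //; lra.
have nd (x : R) : 0 < x -> \forall u \near (0 : R[i])^', nc u < x.
  move=> x0; have x0' : 0 < x%:C by rewrite ltcR.
  apply: (@filterS _ _ (dnbhs_filter (0 : R[i])) _ _ _ (@dnbhs0_lt R[i] R[i] _ x0')) => u.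
  by rewrite norm_nc ltcR.
near=> u.
have un0 : u != 0 by near: u; exact: nbhs_dnbhs_neq.
have u1 : nc u <= 1 by apply: ltW; near: u; exact: nd.
have ud : nc u < d by near: u; exact: nd.
have -> : u^-1 *: (f (u + z) - f z) - g z = u^-1 * (f (z + u) - f z - g z * u).
  by rewrite [u + z]addrC mulrBr (mulrC (g z)) mulKf.
rewrite ncM ncV; apply: le_lt_trans (ler_wpM2l _ (key u u1)) _.
  by rewrite invr_ge0 nc_ge0.
have nu0 : nc u != 0 by rewrite nc_eq0.
rewrite expr2 -mulrA mulKf //; move: ud; rewrite /d ltr_pdivlMr; last lra.
by have := nc_ge0 u; lra.
Unshelve. all: by end_near. Qed.

Lemma is_taylor_derive1n k c f : is_taylor c f ->
  is_taylor (fun j => ((j + k) ^_ k)%:R * c (j + k)%N) (derive1n k f).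
Proof.
move=> cf; elim: k => [|k /is_taylor_derive1 IH].
  rewrite (_ : (fun j => _) = c) //; apply/funext => j.
  by rewrite addn0 ffactn0 mul1r.
move: IH; rewrite (_ : (fun j => _) = fun j => ((j + k.+1) ^_ k.+1)%:R * c (j + k.+1)%N) //.
apply/funext => j; rewrite mulrA -natrM addnS addSn ffactnSr mulnC.
by congr (((_ * _)%N)%:R * _); lia.
Qed.

Lemma ffact_bin_le j k : ((j + k) ^_ k <= 2 ^ (j + k) * k`!)%N.
Proof.
have hk : (k < (j + k).+1)%N by rewrite ltnS leq_addl.
rewrite -bin_ffact leq_mul2r; apply/orP; right.
by rewrite -[2%N]/(1 + 1)%N expnDn (bigD1 (Ordinal hk)) //= !exp1n !muln1 leq_addr.
Qed.

(** The factor (j + k)!/j! is at most 2^(j + k) k!, which halves the radius available: hence 2/r in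
    the bound and 4|z| <= r. *)
Lemma derive1n_bound c f r M k z : is_taylor c f -> 0 < r ->
  (forall m, nc (c m) * r ^+ m <= M) -> 4 * nc z <= r ->
  nc (derive1n k f z) <= 2 * (M * k`!%:R * (2 / r) ^+ k).
Proof.
move=> cf r0 hM zr; apply: (is_taylor_le (is_taylor_derive1n (k := k) cf) (nc_ge0 z)) => // j.
rewrite ncM ncM_nat.
have h1 : ((j + k) ^_ k)%:R <= 2 ^+ (j + k) * k`!%:R :> R.
  by rewrite -natrX -natrM ler_nat ffact_bin_le.
have h2 : (2 * nc z) ^+ j <= (r / 2) ^+ j.
  by rewrite lerXn2r ?nnegrE ?mulr_ge0 ?nc_ge0 ?invr_ge0 //; lra.
have h3 : nc (c (j + k)%N) <= M / r ^+ (j + k) by rewrite ler_pdivlMr ?exprn_gt0.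
apply: (@le_trans _ _ (2 ^+ (j + k) * k`!%:R * (M / r ^+ (j + k)) * (r / 2) ^+ j)).
  apply: ler_pM => //; first by rewrite mulr_ge0 ?nc_ge0.
    by rewrite exprn_ge0 // mulr_ge0 ?nc_ge0.
  by apply: ler_pM => //; exact: nc_ge0.
rewrite le_eqVlt; apply/orP; left; apply/eqP.
rewrite !exprD !expr_div_n; field.
by rewrite !expf_neq0 ?gt_eqF.
Qed.

End Derivatives.

(** * Dominated convergence for series, and the ratios n(n-1)...(n-k+1)/n^k *)

Section Tannery.
Variable R : realType.

Lemma cvg_harmonicZ (x : R) : (fun n => x / n.+1%:R) @ \oo --> (0 : R).
Proof.
have : (fun n => x * (@harmonic R n)) @ \oo --> x * 0.
  by apply: cvgM; [exact: cvg_cst|exact: cvg_harmonic].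
by rewrite mulr0.
Qed.

Lemma geom_small (M s e : R) : 0 <= s -> s < 1 -> 0 < e ->
  \forall n \near \oo, M * s ^+ n < e.
Proof.
move=> s0 s1 e0; have h : (fun n => M * s ^+ n) @ \oo --> M * 0.
  by apply: cvgM; [exact: cvg_cst|apply: cvg_expr; rewrite ger0_norm].
move: h; rewrite mulr0 => /cvgrPdist_lt /(_ _ e0); apply: filterS => n.
by rewrite sub0r normrN; apply: le_lt_trans; exact: ler_norm.
Qed.

Lemma sum_geom_tail (s : R) N K : 0 <= s -> s < 1 ->
  \sum_(N <= k < K) s ^+ k <= s ^+ N / (1 - s).
Proof.
move=> s0 s1; rewrite -{1}[N]add0n big_addn big_mkord.
under eq_bigr do rewrite exprD.
rewrite -mulr_suml mulrC ler_wpM2l ?exprn_ge0 //; exact: sum_geom_le.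
Qed.

(** The geometric majorant makes the tail beyond some N small for all n at once; the head is a
    finite sum tending to 0. Uniformity in K lets partial sums stand for the infinite sum. *)
Lemma tannery (x : nat -> nat -> R) (M s : R) : 0 <= s -> s < 1 ->
  (forall n k, 0 <= x n k <= M * s ^+ k) -> (forall k, x n k @[n --> \oo] --> (0 : R)) ->
  forall e, 0 < e -> \forall n \near \oo, forall K, \sum_(k < K) x n k < e.
Proof.
move=> s0 s1 hx x0 e e0.
have e2 : 0 < e / 2 by rewrite divr_gt0.
have [N _ hN] : \forall n \near \oo, M / (1 - s) * s ^+ n < e / 2 by exact: geom_small.
have : (fun n => \sum_(k < N) x n k) @ \oo --> (0 : R).
  elim: (N) => [|m IH].
    rewrite (_ : (fun n => _) = fun=> 0); first exact: cvg_cst.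
    by apply/funext => n; rewrite big_ord0.
  rewrite (_ : (fun n => _) = fun n => \sum_(k < m) x n k + x n m).
    by rewrite -[X in _ --> X]addr0; apply: cvgD.
  by apply/funext => n; rewrite big_ord_recr.
move=> /cvgrPdist_lt /(_ _ e2); apply: filterS => n.
rewrite sub0r normrN => h K.
have xp k : 0 <= x n k by have /andP[] := hx n k.
have h1 : \sum_(k < N) x n k < e / 2 by apply: le_lt_trans h; exact: ler_norm.
have h2 : \sum_(N <= k < N + K) x n k <= M / (1 - s) * s ^+ N.
  apply: (@le_trans _ _ (M * \sum_(N <= k < N + K) s ^+ k)).
    by rewrite mulr_sumr; apply: ler_sum => k _; have /andP[] := hx n k.
  have M0 : 0 <= M by have /andP[h3 h4] := hx n 0%N; move: h4; rewrite expr0 mulr1; exact: le_trans.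
  rewrite mulrAC -mulrA; apply: ler_wpM2l => //; exact: sum_geom_tail.
apply: (@le_lt_trans _ _ (\sum_(k < N + K) x n k)).
  rewrite -!(big_mkord xpredT (x n)) (big_cat_nat (n := K) (p := N + K)) ?leq_addl //=.
  by rewrite lerDl sumr_ge0.
rewrite -(big_mkord xpredT (x n)) (big_cat_nat (n := N)) ?leq_addr //= big_mkord.
by have := hN N (leqnn N); lra.
Qed.

(** The factor by which the coefficients of (1 + z/n)^n fall short of those of e^z, and also the
    multiplier of the Jensen transform. *)
Definition ffact_ratio (n k : nat) : R := (n ^_ k)%:R / n%:R ^+ k.

Lemma ffact_ratio0 n : ffact_ratio n 0 = 1.
Proof. by rewrite /ffact_ratio ffactn0 expr0 divr1. Qed.

Lemma ffact_ratioS n k : ffact_ratio n.+1 k.+1 = ffact_ratio n.+1 k * (1 - k%:R / n.+1%:R).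
Proof.
rewrite /ffact_ratio; have [kn|nk] := leqP k n.+1; last first.
  by rewrite !ffact_small ?mul0r // ltnW.
have N0 : n.+1%:R != 0 :> R by rewrite pnatr_eq0.
rewrite ffactnSr natrM natrB // exprS; move: (n.+1%:R) N0 => N N0.
by field; rewrite N0 expf_neq0.
Qed.

Lemma ffact_ratio_small n k : (n < k)%N -> ffact_ratio n k = 0.
Proof. by move=> h; rewrite /ffact_ratio ffact_small // mul0r. Qed.

Lemma ffact_ratio_ge0 n k : 0 <= ffact_ratio n k.
Proof. by rewrite /ffact_ratio divr_ge0 // exprn_ge0. Qed.

Lemma ffact_ratio_le1 n k : ffact_ratio n.+1 k <= 1.
Proof.
elim: k => [|k IH]; first by rewrite ffact_ratio0.
have [kn|nk] := leqP k n.+1; last by rewrite ffact_ratio_small // ltnW.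
rewrite ffact_ratioS -[leRHS]mulr1; apply: ler_pM => //.
- exact: ffact_ratio_ge0.
- by rewrite subr_ge0 ler_pdivrMr ?ltr0n // mul1r ler_nat.
Qed.

Lemma ffact_ratio_cvg k : ffact_ratio n.+1 k @[n --> \oo] --> (1 : R).
Proof.
elim: k => [|k IH].
  by under eq_fun do rewrite ffact_ratio0; exact: cvg_cst.
rewrite (_ : (fun n => _) = fun n => ffact_ratio n.+1 k * (1 - k%:R / n.+1%:R)); last first.
  by apply/funext => n; rewrite ffact_ratioS.
have h : (fun n => 1 - k%:R / n.+1%:R) @ \oo --> (1 - 0 : R).
  by apply: cvgB; [exact: cvg_cst|exact: cvg_harmonicZ].
have := cvgM IH h; rewrite subr0 mulr1; exact.
Qed.

End Tannery.

(** * The complex exponential: power series, remainders, compound interest *)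

Section ComplexExponential.
Variable R : realType.
Implicit Types (z w u : R[i]) (x y r e : R).

Lemma cexpD z w : cexp (z + w) = cexp z * cexp w.
Proof.
case: z w => [x y] [x' y']; rewrite /cexp /= expRD cosD sinD.
by apply/eqP; rewrite eq_complex /=; apply/andP; split; apply/eqP; ring.
Qed.

Lemma cexpR x : cexp x%:C = (expR x)%:C.
Proof. by rewrite /cexp /= cos0 sin0; apply/eqP; rewrite eq_complex /= !(mulr1,mulr0,mul0r,subr0,addr0) !eqxx. Qed.

Lemma cexp0 : cexp (0 : R[i]) = 1.
Proof. by rewrite -[0]/(0%:C) cexpR expR0. Qed.

Lemma nc_cexp z : nc (cexp z) = expR (complex.Re z).
Proof.
rewrite /cexp ncM ncR ger0_norm ?expR_ge0 //= cos2Dsin2 sqrtr1 mulr1 //.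
Qed.

Lemma cexpN z : cexp z * cexp (- z) = 1.
Proof. by rewrite -cexpD subrr cexp0. Qed.

Lemma cexp_neq0 z : cexp z != 0.
Proof. by rewrite -nc_gt0 nc_cexp expR_gt0. Qed.

Lemma cexpMn n z : cexp (n%:R * z) = cexp z ^+ n.
Proof.
elim: n => [|n IH]; first by rewrite mul0r cexp0.
by rewrite -natr1 mulrDl mul1r cexpD IH exprSr.
Qed.

Lemma nc_cexp_le z : nc (cexp z) <= expR (nc z).
Proof. by rewrite nc_cexp ler_expR; apply: le_trans (nc_ge_Re z); exact: ler_norm. Qed.

(** As [cexp] is given by Euler's formula, its power series is read off first on the two axes, from
    the real series of [expR], [cos] and [sin]. *)
Lemma exp_series_real x : series (fun k => x%:C ^+ k / k`!%:R) @ \oo --> cexp x%:C.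
Proof.
rewrite cexpR; apply/cvg_ncP => e e0.
have /cvgrPdist_lt /(_ _ e0) := is_cvg_series_exp_coeff x.
apply: filterS => n; rewrite distrC /series /=.
suff -> : \sum_(0 <= k < n) x%:C ^+ k / k`!%:R = (\sum_(0 <= k < n) exp_coeff x k)%:C.
  by rewrite -rmorphB ncR.
rewrite rmorph_sum; apply: eq_bigr => k _.
by rewrite /exp_coeff /= rmorphM /= rmorphXn /= fmorphV rmorph_nat.
Qed.

Lemma exp_series_imag y : series (fun k => ('i%C * y%:C) ^+ k / k`!%:R) @ \oo --> cexp ('i%C * y%:C).
Proof.
have -> : cexp ('i%C * y%:C) = cos y +i* sin y.
  by rewrite /cexp ReM ImM /= !(mul0r, mul1r, mulr0) subr0 add0r expR0 mul1r.
apply/cvg_ncP => e e0; have e2 : 0 < e / 2 by rewrite divr_gt0.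
have h1 := @is_cvg_series_cos_coeff _ y; have h2 := @is_cvg_series_sin_coeff _ y.
have c1 : lim (series (cos_coeff y) @ \oo) = cos y by rewrite cos.unlock.
have c2 : lim (series (sin_coeff y) @ \oo) = sin y by rewrite sin.unlock.
move/cvgrPdist_lt in h1; move/cvgrPdist_lt in h2; rewrite c1 in h1; rewrite c2 in h2.
have E n : series (fun k => ('i%C * y%:C) ^+ k / k`!%:R) n =
   series (cos_coeff y) n +i* series (sin_coeff y) n.
  rewrite /series /=; elim: n => [|n IH]; first by rewrite !big_geq.
  rewrite !big_nat_recr //= IH.
  suff -> : ('i%C * y%:C) ^+ n / n`!%:R = cos_coeff y n +i* sin_coeff y n by [].
  rewrite -(rmorph_nat (real_complex R)) -fmorphV exprMn -rmorphXn.
  rewrite /cos_coeff /sin_coeff /= -[in 'i%C ^+ n](odd_double_half n) exprD -mul2n exprM.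
  rewrite sqr_i; case nE : (odd n) => /=.
    rewrite expr1 (_ : n.-1./2 = n./2); last first.
      by rewrite -[in LHS](odd_double_half n) nE /= doubleK.
    have -> : (-1) ^+ n./2 = ((-1) ^+ n./2)%:C :> R[i] by rewrite rmorphXn rmorphN1.
    by apply/eqP; rewrite eq_complex /=; apply/andP; split; apply/eqP; ring.
  have -> : (-1) ^+ n./2 = ((-1) ^+ n./2)%:C :> R[i] by rewrite rmorphXn rmorphN1.
  rewrite expr0; apply/eqP; rewrite eq_complex /=; apply/andP; split; apply/eqP; [rewrite -exprnP; ring|rewrite !mul0r; ring].
near=> n; apply: le_lt_trans (nc_le_ReIm _) _.
rewrite E ReD ReN ImD ImN /= (splitr e); apply: ltrD; rewrite distrC; near: n.
  exact: h1.
exact: h2.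
Unshelve. all: by end_near. Qed.

Lemma exp_series_tail u (E : R[i]) n : series (fun k => u ^+ k / k`!%:R) @ \oo --> E ->
  nc u <= 1 / 2 -> nc (E - \sum_(k < n) u ^+ k / k`!%:R) <= 2 * nc u ^+ n.
Proof.
move=> uE u1; have u0 := nc_ge0 u.
have [|||l hl hn] := @geometric_series _ (fun k => u ^+ k / k`!%:R) 1 (nc u) => //; first lra.
  move=> k; rewrite mul1r ncM ncX ncV ncM_nat ler_pdivrMr ?ltr0n ?fact_gt0 //.
  by rewrite ler_peMr ?exprn_ge0 // ler1n fact_gt0.
rewrite -(cvg_unique_nc hl uE); apply: le_trans (hn n) _.
rewrite mul1r ler_pdivrMr; last lra.
have := exprn_ge0 n u0; set t := nc u ^+ n => t0; nra.
Qed.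

(** Obtained from the two axes through e^u = e^x e^(iy). The constant is 2 + 3 + 1: the real
    remainder, the imaginary one times |1 + x| <= 3/2, and the product xy. *)
Lemma cexp_second u : nc u <= 1 / 2 -> nc (cexp u - (1 + u)) <= 6 * nc u ^+ 2.
Proof.
move=> u1; have hRe := nc_ge_Re u; have hIm := nc_ge_Im u.
have uE : u = (complex.Re u)%:C + 'i%C * (complex.Im u)%:C by rewrite -complexE.
move: hRe hIm; set x := complex.Re u; set y := complex.Im u => hx hy.
have s2 (v : R[i]) : \sum_(k < 2) v ^+ k / k`!%:R = 1 + v.
  by rewrite !big_ord_recr big_ord0 /= add0r expr0 expr1 !divr1.
have nx : nc x%:C = `|x| by rewrite ncR.
have ny : nc ('i%C * y%:C) = `|y|.
  by rewrite ncM ncR /= expr0n add0r expr1n sqrtr1 mul1r.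
have h1 : nc (cexp x%:C - (1 + x%:C)) <= 2 * nc u ^+ 2.
  rewrite -s2. apply: le_trans (exp_series_tail 2 (@exp_series_real x) _) _; first by rewrite nx; lra.
  by rewrite ler_wpM2l // nx lerXn2r ?nnegrE ?nc_ge0.
have h2 : nc (cexp ('i%C * y%:C) - (1 + 'i%C * y%:C)) <= 2 * nc u ^+ 2.
  rewrite -s2; apply: le_trans (exp_series_tail 2 (@exp_series_imag y) _) _; first by rewrite ny; lra.
  by rewrite ler_wpM2l // ny lerXn2r ?nnegrE ?nc_ge0.
have -> : cexp u - (1 + u) = (cexp x%:C - (1 + x%:C)) * cexp ('i%C * y%:C) +
    (1 + x%:C) * (cexp ('i%C * y%:C) - (1 + 'i%C * y%:C)) + x%:C * ('i%C * y%:C).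
  by rewrite uE cexpD -/x -/y; ring.
have n1 : nc (cexp ('i%C * y%:C)) = 1.
  by rewrite nc_cexp ReM /= !mul0r mulr0 subr0 expR0.
have h3 : nc (1 + x%:C) <= 3 / 2 by apply: le_trans (ncD _ _) _; rewrite nc1 nx; lra.
apply: le_trans (ncD _ _) _; apply: le_trans (lerD (ncD _ _) (lexx _)) _.
rewrite (ncM _ (cexp _)) n1 mulr1 (ncM (1 + _)) (ncM x%:C) ny nx.
have h4 : `|x| * `|y| <= nc u * nc u by apply: ler_pM.
have h5 : nc (1 + x%:C) * nc (cexp ('i%C * y%:C) - (1 + 'i%C * y%:C)) <= 3 / 2 * (2 * nc u ^+ 2).
  by apply: ler_pM => //; exact: nc_ge0.
rewrite -expr2 in h4; lra.
Qed.

Lemma sub_exp_le (a b : R[i]) (B : R) n : nc a <= B -> nc b <= B -> 1 <= B ->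
  nc (a ^+ n - b ^+ n) <= n%:R * nc (a - b) * B ^+ n.
Proof.
move=> aB bB B1; rewrite subrXX ncM.
rewrite [leRHS](_ : _ = nc (a - b) * (B ^+ n * n%:R)); last by ring.
apply: ler_wpM2l; first exact: nc_ge0.
apply: le_trans (nc_sum _ _ _) _.
have -> : B ^+ n * n%:R = \sum_(i < n) B ^+ n by rewrite sumr_const card_ord mulr_natr.
apply: ler_sum => i _; rewrite ncM !ncX.
have B0 : 0 <= B by lra.
apply: (@le_trans _ _ (B ^+ (n.-1 - i) * B ^+ i)).
  by apply: ler_pM; rewrite ?exprn_ge0 ?nc_ge0 // lerXn2r ?nnegrE ?nc_ge0.
rewrite -exprD; apply: ler_weXn2l => //; have := ltn_ord i; lia.
Qed.

(** With N = n + 1, the N-th powers of 1 + z/N and e^(z/N) are compared: N times the second-order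
    error 6|z/N|^2 leaves O(1/N). *)
Lemma compound_cexp n z : 2 * nc z <= n.+1%:R ->
  nc ((1 + z / n.+1%:R) ^+ n.+1 - cexp z) <= 6 * nc z ^+ 2 * expR (nc z) / n.+1%:R.
Proof.
move=> zn; set N : R := n.+1%:R in zn *; have N0 : 0 < N by rewrite ltr0n.
set u := z / n.+1%:R; have nu : nc u = nc z / N by rewrite ncM ncV ncM_nat.
have -> : cexp z = cexp u ^+ n.+1.
  by rewrite -cexpMn /u mulrCA divff ?mulr1 // pnatr_eq0.
have u0 := nc_ge0 u; have u1 : nc u <= 1 / 2 by rewrite nu ler_pdivrMr //; lra.
have E1 : expR (nc u) ^+ n.+1 = expR (nc z).
  by rewrite -expRM_natl nu mulrCA divff ?mulr1 // gt_eqF.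
apply: le_trans (@sub_exp_le _ _ (expR (nc u)) _ _ _ _) _.
- by apply: le_trans (ncD _ _) _; rewrite nc1 expR_ge1Dx.
- exact: nc_cexp_le.
- by rewrite -expR0 ler_expR.
rewrite E1 nc_sub; have h := cexp_second u1.
rewrite [leRHS](_ : _ = N * (expR (nc z) * (6 * nc u ^+ 2))); last first.
  by rewrite nu; field; rewrite gt_eqF.
rewrite -mulrA [_ * expR _]mulrC; apply: ler_wpM2l; first exact: ltW.
by apply: ler_wpM2l; first exact: expR_ge0.
Qed.

(** Off the axes, the power series and [cexp] are both limits of (1 + z/N)^N: the former by
    dominated convergence, the latter by [compound_cexp]. *)
Lemma cexp_taylor : is_taylor (fun k => (k`!%:R)^-1) (@cexp R).
Proof.
have [g gt] : exists g, is_taylor (fun k => (k`!%:R)^-1 : R[i]) g.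
  apply: taylor_exists => r r0; exists (expR r) => k.
  rewrite ncV ncM_nat; case: k => [|k].
    by rewrite fact0 invr1 expr0 mulr1 -expR0 ler_expR ltW.
  apply: le_trans (expR_ge1Dxn k (ltW r0)); rewrite mulrC lerDr //.
move=> z; suff -> : cexp z = g z by [].
pose M := expR (2 * nc z);
pose u n k : R[i] := ((ffact_ratio R n.+1 k)%:C - 1) * (z ^+ k / k`!%:R).
have M0 : 0 <= M by exact: expR_ge0.
have zk k : nc (z ^+ k / k`!%:R) <= M * 2^-1 ^+ k.
  rewrite exprVn ler_pdivlMr ?exprn_gt0 // ncM ncX ncV ncM_nat mulrAC -exprMn mulrC.
  case: k => [|k]; first by rewrite fact0 invr1 expr0 mulr1 /M -expR0 ler_expR mulr_ge0 ?nc_ge0.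
  have z0 : 0 <= 2 * nc z by rewrite mulr_ge0 ?nc_ge0.
  by apply: le_trans (expR_ge1Dxn k z0); rewrite mulrC (mulrC 2) lerDr.
apply/eqP; rewrite -subr_eq0 -nc_eq0 eq_le nc_ge0 andbT; apply/ler_addgt0Pr => e e0.
rewrite add0r.
have e4 : 0 < e / 4 by rewrite divr_gt0.
have T : \forall n \near \oo, forall K, \sum_(k < K) nc (u n k) < e / 4.
  have s0 : 0 <= 2^-1 :> R by lra.
  have s1 : 2^-1 < 1 :> R by lra.
  apply: (@tannery _ (fun n k => nc (u n k)) M _ s0 s1 _ _ _ e4).
    move=> n k; rewrite nc_ge0 /= ncM -[leRHS]mul1r; apply: ler_pM; rewrite ?nc_ge0 //.
    rewrite -rmorphB ncR ler_norml; have := ffact_ratio_ge0 R n.+1 k.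
    by have := ffact_ratio_le1 R n k; lra.
  move=> k; have h := @ffact_ratio_cvg R k.
  apply/cvgrPdist_lt => d d0.
  have K0 : 0 < nc (z ^+ k / k`!%:R) + 1 by have := nc_ge0 (z ^+ k / k`!%:R); lra.
  have dK : 0 < d / (nc (z ^+ k / k`!%:R) + 1) by rewrite divr_gt0.
  move/cvgrPdist_lt : h => /(_ _ dK); apply: filterS => n h.
  rewrite sub0r normrN ger0_norm ?nc_ge0 // ncM -rmorphB ncR distrC.
  move: h; rewrite ltr_pdivlMr //; apply: le_lt_trans.
  by apply: ler_wpM2l => //; lra.
have C : \forall n \near \oo, 6 * nc z ^+ 2 * expR (nc z) / n.+1%:R < e / 4.
  have := @cvg_harmonicZ R (6 * nc z ^+ 2 * expR (nc z)).
  move=> /cvgrPdist_lt /(_ _ e4); apply: filterS => n.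
  by rewrite sub0r normrN; apply: le_lt_trans; exact: ler_norm.
have G : \forall n \near \oo, nc (series (fun k => (k`!%:R)^-1 * z ^+ k) n.+2 - g z) < e / 4.
  have /cvg_ncP /(_ _ e4) [N _ hN] := gt z.
  by exists N => // m /= Nm; apply: hN => /=; rewrite (leq_trans Nm) // ltnW.
near \oo => n.
have h1 : forall K, \sum_(k < K) nc (u n k) < e / 4 by near: n.
have h2 : nc ((1 + z / n.+1%:R) ^+ n.+1 - cexp z) < e / 4.
  apply: le_lt_trans (@compound_cexp n z _) _; last by near: n.
  apply: (@le_trans _ _ n%:R); last by rewrite ler_nat.
  by near: n; exact: nbhs_infty_ger.
have h3 : nc (series (fun k => (k`!%:R)^-1 * z ^+ k) n.+2 - g z) < e / 4 by near: n.
have E : (1 + z / n.+1%:R) ^+ n.+1 = series (fun k => (k`!%:R)^-1 * z ^+ k) n.+2 + \sum_(k < n.+2) u n k.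
  rewrite /series /= big_mkord -big_split /= exprDn; apply: eq_bigr => k _.
  rewrite expr1n mul1r /u mulrBl mul1r [_^-1 * _]mulrC addrC subrK.
  rewrite /ffact_ratio -bin_ffact natrM expr_div_n.
  rewrite -mulr_natr rmorphM /= fmorphV /= rmorphXn /= rmorphM /= !rmorph_nat.
  have k0 : k`!%:R != 0 :> R[i] by rewrite pnatr_eq0 -lt0n fact_gt0.
  by field; rewrite k0 /= expf_neq0 // pnatr_eq0.
have h4 := h1 n.+2; have h5 := nc_sum (index_enum 'I_n.+2) xpredT (fun k : 'I_n.+2 => u n k).
have -> : cexp z - g z = - ((1 + z / n.+1%:R) ^+ n.+1 - cexp z) +
   ((series (fun k => (k`!%:R)^-1 * z ^+ k) n.+2 - g z) + \sum_(k < n.+2) u n k).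
  by rewrite E; ring.
apply: le_trans (ncD _ _) _; rewrite ncN.
have := ncD (series (fun k => (k`!%:R)^-1 * z ^+ k) n.+2 - g z) (\sum_(k < n.+2) u n k).
lra.
Unshelve. all: by end_near. Qed.

Lemma cexp_third u : nc u <= 1 / 2 -> nc (cexp u - (1 + u + u ^+ 2 / 2)) <= 2 * nc u ^+ 3.
Proof.
move=> u1; have h : series (fun k => u ^+ k / k`!%:R) @ \oo --> cexp u.
  have := @cexp_taylor u; rewrite (_ : (fun k => _) = (fun k => u ^+ k / k`!%:R)) //.
  by apply/funext => k; rewrite mulrC.
have := exp_series_tail 3 h u1.
by rewrite !big_ord_recr big_ord0 /= add0r expr0 expr1 !divr1.
Qed.

End ComplexExponential.

(** * Operators of infinite order on Fock spaces *)

Section DifferentialOperator.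
Variable R : realType.
Implicit Types (z w : R[i]) (x y r e : R) (f g : R[i] -> R[i]) (b c d : nat -> R[i]).

(** The inverse square root of the Fock weight: coefficients of a function in F_x are O([rho x]),
    and O([rho x]) implies membership in F_y for all y > x. *)
Definition rho (x : R) (m : nat) : R := Num.sqrt (x ^+ m / m`!%:R).

Lemma rho_ge0 x m : 0 <= rho x m.
Proof. exact: sqrtr_ge0. Qed.

Lemma sqr_rho x m : 0 <= x -> rho x m ^+ 2 = x ^+ m / m`!%:R.
Proof. by move=> x0; rewrite sqr_sqrtr // divr_ge0 // exprn_ge0. Qed.

Lemma exp_coeff_le x m : 0 <= x -> x ^+ m / m`!%:R <= expR x.
Proof.
move=> x0; case: m => [|m]; first by rewrite expr0 fact0 divr1 -expR0 ler_expR.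
by apply: le_trans (expR_ge1Dxn m x0); rewrite lerDr.
Qed.

Lemma rho_bound x y m : 0 <= x -> 0 <= y -> rho x m * y ^+ m <= Num.sqrt (expR (x * y ^+ 2)).
Proof.
move=> x0 y0; have xy0 : 0 <= x * y ^+ 2 by rewrite mulr_ge0 // sqr_ge0.
rewrite -(@ler_pXn2r _ 2) ?nnegrE ?mulr_ge0 ?rho_ge0 ?exprn_ge0 ?sqrtr_ge0 //.
rewrite exprMn sqr_rho // sqr_sqrtr ?expR_ge0 //.
apply: le_trans (exp_coeff_le m xy0); rewrite exprMn -exprM mulnC exprM.
by rewrite mulrAC exprAC.
Qed.

(** The square of the left side is a^j/j! C(j + k, k) (t/2)^k with t = 2 k2 a, and C(j + k, k) t^k
    <= (1 - t)^(-j). The spare 2^(-k) makes the sum over k converge, while 1 - t becomes the loss in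
    the Fock parameter. *)
Lemma rho_mul_le (a k2 : R) j k : 0 < a -> 0 < k2 -> 2 * k2 * a < 1 ->
  ((j + k) ^_ k)%:R * rho a (j + k) * rho k2 k <=
    rho (a / (1 - 2 * k2 * a)) j * Num.sqrt 2^-1 ^+ k.
Proof.
move=> a0 k0 h; have q0 : 0 < 1 - 2 * k2 * a by lra.
have aq0 : 0 <= a / (1 - 2 * k2 * a) by rewrite divr_ge0 // ltW.
have [a0' k0'] := (ltW a0, ltW k0).
rewrite -(@ler_pXn2r _ 2) ?nnegrE ?mulr_ge0 ?rho_ge0 ?exprn_ge0 ?sqrtr_ge0 //.
rewrite !exprMn !sqr_rho // -exprM mulnC exprM sqr_sqrtr; last lra.
set t := 2 * k2 * a in h q0 *.
have B : 'C(j + k, k)%:R * t ^+ k * (1 - t) ^+ j <= 1.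
  have t0 : 0 <= t by rewrite /t !mulr_ge0.
  rewrite [leRHS](_ : _ = ((1 - t) + t) ^+ (j + k)); last by rewrite subrK expr1n.
  have hk : (k < (j + k).+1)%N by rewrite ltnS leq_addl.
  rewrite [leRHS]exprDn (bigD1 (Ordinal hk)) //= addnK.
  have -> : 'C(j + k, k)%:R * t ^+ k * (1 - t) ^+ j = (1 - t) ^+ j * t ^+ k *+ 'C(j + k, k).
    by rewrite -[RHS]mulr_natl; ring.
  rewrite lerDl sumr_ge0 // => i _; rewrite mulrn_wge0 // mulr_ge0 // exprn_ge0 //; exact: ltW.
have fE : ((j + k) ^_ k)%:R = 'C(j + k, k)%:R * k`!%:R :> R by rewrite -natrM bin_ffact.
have f2 : (j + k)`!%:R = 'C(j + k, k)%:R * (k`!%:R * j`!%:R) :> R.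
  by rewrite -!natrM -(@bin_fact (j + k) k) ?leq_addl // addnK.
have k1 : k`!%:R != 0 :> R by rewrite pnatr_eq0 -lt0n fact_gt0.
have j1 : j`!%:R != 0 :> R by rewrite pnatr_eq0 -lt0n fact_gt0.
have C1 : 'C(j + k, k)%:R != 0 :> R by rewrite pnatr_eq0 -lt0n bin_gt0 leq_addl.
rewrite fE f2 [leLHS](_ : _ = a ^+ j / j`!%:R * ('C(j + k, k)%:R * (k2 * a) ^+ k)); last first.
  by rewrite exprD [(k2 * a) ^+ k]exprMn; field; rewrite C1 k1 j1.
rewrite expr_div_n exprVn [leRHS](_ : _ = a ^+ j / j`!%:R * ((1 - t) ^- j * 2 ^- k)); last first.
  by field; rewrite j1 !expf_neq0 // gt_eqF.
apply: ler_wpM2l; first by rewrite divr_ge0 ?exprn_ge0.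
rewrite -invfM -[leRHS]mul1r ler_pdivlMr ?mulr_gt0 ?exprn_gt0 //.
apply: le_trans B; rewrite le_eqVlt; apply/orP; left; apply/eqP.
by rewrite /t !exprMn; ring.
Qed.

Lemma sqrt_half_lt1 : 0 <= Num.sqrt 2^-1 :> R /\ Num.sqrt 2^-1 < 1 :> R.
Proof.
split; first exact: sqrtr_ge0.
by rewrite -[ltRHS]sqrtr1 ltr_sqrt //; lra.
Qed.

Lemma derive1n_rho_bound c f (M a k2 r : R) : is_taylor c f -> 0 < a -> 0 < k2 -> 2 * k2 * a < 1 ->
  0 <= r -> (forall m, nc (c m) <= M * rho a m) ->
  exists2 K, 0 <= K & forall k z, nc z <= r ->
    nc (derive1n k f z) * rho k2 k <= K * Num.sqrt 2^-1 ^+ k.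
Proof.
move=> cf a0 k0 h r0 hM; set A := a / (1 - 2 * k2 * a).
have A0 : 0 <= A by rewrite divr_ge0 // ltW //; lra.
have M0 : 0 <= M.
  have := hM 0%N; rewrite /rho expr0 fact0 divr1 sqrtr1 mulr1; apply: le_trans; exact: nc_ge0.
have r2 : 0 <= 2 * r by lra.
exists (2 * (M * Num.sqrt (expR (A * (2 * r) ^+ 2)))).
  by rewrite !mulr_ge0 // sqrtr_ge0.
move=> k z zr; rewrite -mulrA.
have -> : nc (derive1n k f z) * rho k2 k = nc ((rho k2 k)%:C * derive1n k f z).
  by rewrite ncM ncR ger0_norm ?rho_ge0 // mulrC.
have dk := is_taylorZ (a := (rho k2 k)%:C) (is_taylor_derive1n (k := k) cf).
apply: (is_taylor_le dk r0) zr => j.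
rewrite !ncM ncM_nat ncR ger0_norm ?rho_ge0 //.
have h1 := rho_mul_le j k a0 k0 h; rewrite -/A in h1.
have h2 := rho_bound j A0 r2.
have h3 : rho k2 k * (((j + k) ^_ k)%:R * nc (c (j + k)%N)) <=
   M * (rho A j * Num.sqrt 2^-1 ^+ k).
  apply: (@le_trans _ _ (M * (((j + k) ^_ k)%:R * rho a (j + k) * rho k2 k))); last exact: ler_wpM2l.
  rewrite [leRHS](_ : _ = rho k2 k * (((j + k) ^_ k)%:R * (M * rho a (j + k)))); last by ring.
  by apply: ler_wpM2l; [exact: rho_ge0|apply: ler_wpM2l].
apply: le_trans (ler_wpM2r (exprn_ge0 _ r2) h3) _.
rewrite [leLHS](_ : _ = M * Num.sqrt 2^-1 ^+ k * (rho A j * (2 * r) ^+ j)); last by ring.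
rewrite [leRHS](_ : _ = M * Num.sqrt 2^-1 ^+ k * Num.sqrt (expR (A * (2 * r) ^+ 2))); last by ring.
by apply: ler_wpM2l => //; rewrite mulr_ge0 // exprn_ge0 // sqrtr_ge0.
Qed.

Lemma diffop_geo b f r (K s : R) : 0 <= s -> s < 1 ->
  (forall k z, nc z <= r -> nc (b k * derive1n k f z) <= K * s ^+ k) ->
  forall n z, nc z <= r -> nc (diffop b f z - diffop_partial b f n z) <= K * s ^+ n / (1 - s).
Proof.
move=> s0 s1 h n z zr.
have [l hl hn] := @geometric_series _ (fun k => b k * derive1n k f z) K s s0 s1 (fun k => h k z zr).
suff -> : diffop b f z = l by exact: hn.
rewrite /diffop; apply: cvg_lim; first exact: norm_hausdorff.
rewrite (_ : (fun n => _) = series (fun k => b k * derive1n k f z)) //.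
by apply/funext => m; rewrite /diffop_partial /series /= big_mkord.
Qed.

Lemma diffop_geo_cvg b f : (forall r, exists K s : R, [/\ 0 <= s, s < 1 &
  forall k z, nc z <= r -> nc (b k * derive1n k f z) <= K * s ^+ k]) -> diffop_cvg b f.
Proof.
move=> h; apply/compact_cvgP => r e e0; have [K [s [s0 s1 hb]]] := h r.
have : \forall n \near \oo, K / (1 - s) * s ^+ n < e by exact: geom_small.
apply: filterS => n hn z zr; rewrite nc_sub; apply: le_lt_trans hn.
by rewrite mulrAC; exact: diffop_geo zr.
Qed.

Lemma diffop_partial_taylor b c f n : is_taylor c f ->
  is_taylor (fun j => \sum_(k < n) b k * (((j + k) ^_ k)%:R * c (j + k)%N)) (diffop_partial b f n).
Proof.
move=> cf; elim: n => [|n IH].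
  move=> z; rewrite /diffop_partial big_ord0.
  rewrite (_ : series _ = fun=> 0); first exact: cvgc_cst.
  by apply/funext => n; rewrite /series /= big1 // => k _; rewrite big_ord0 mul0r.
have := is_taylorD IH (is_taylorZ (a := b n) (is_taylor_derive1n (k := n) cf)).
rewrite (_ : (fun j => _ + _) = (fun j => \sum_(k < n.+1) b k * (((j + k) ^_ k)%:R * c (j + k)%N))); last first.
  by apply/funext => j; rewrite big_ord_recr.
rewrite (_ : (fun z => _ + _) = diffop_partial b f n.+1) //.
by apply/funext => z; rewrite /diffop_partial big_ord_recr.
Qed.

(* The double series defining the image of f is dominated by
   B M rho(A, j) 2^(-k/2), which is summable in k and entire in j. *)
Lemma diffop_taylor b c f (B M a k2 : R) : is_taylor c f -> 0 < a -> 0 < k2 -> 2 * k2 * a < 1 ->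
  (forall m, nc (c m) <= M * rho a m) -> (forall k, nc (b k) <= B * rho k2 k) ->
  exists t (K : R), is_taylor t (diffop b f) /\
    forall j, nc (t j) <= K * rho (a / (1 - 2 * k2 * a)) j.
Proof.
move=> cf a0 k0 h hM hB; set A := a / (1 - 2 * k2 * a).
have A0 : 0 <= A by rewrite divr_ge0 // ltW //; lra.
have M0 : 0 <= M.
  have := hM 0%N; rewrite /rho expr0 fact0 divr1 sqrtr1 mulr1; apply: le_trans; exact: nc_ge0.
have B0 : 0 <= B.
  have := hB 0%N; rewrite /rho expr0 fact0 divr1 sqrtr1 mulr1; apply: le_trans; exact: nc_ge0.
have [s0 s1] := sqrt_half_lt1; set s := Num.sqrt 2^-1 in s0 s1.
have key j k : nc (b k * (((j + k) ^_ k)%:R * c (j + k)%N)) <= B * M * rho A j * s ^+ k.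
  rewrite !ncM ncM_nat.
  apply: (@le_trans _ _ (B * rho k2 k * (((j + k) ^_ k)%:R * (M * rho a (j + k))))).
    apply: ler_pM => //; rewrite ?nc_ge0 // ?mulr_ge0 ?nc_ge0 //.
    by apply: ler_wpM2l.
  rewrite [leLHS](_ : _ = B * M * (((j + k) ^_ k)%:R * rho a (j + k) * rho k2 k)); last by ring.
  rewrite -[leRHS]mulrA; apply: ler_wpM2l; first by rewrite mulr_ge0.
  exact: rho_mul_le.
have /choice [t ht] : forall j, exists t : R[i], forall n,
    nc (t - \sum_(k < n) b k * (((j + k) ^_ k)%:R * c (j + k)%N)) <= B * M * rho A j * s ^+ n / (1 - s).
  by move=> j; have [t _ ht] := geometric_series s0 s1 (key j); exists t.
have t_le j : nc (t j) <= B * M / (1 - s) * rho A j.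
  by have := ht j 0%N; rewrite big_ord0 subr0 expr0 mulr1 mulrAC.
exists t, (B * M / (1 - s)); split; last exact: t_le.
move=> z.
set r := nc z; have r0 : 0 <= r := nc_ge0 z.
have [K K0 hK] := derive1n_rho_bound cf a0 k0 h r0 hM.
have hb k w : nc w <= r -> nc (b k * derive1n k f w) <= B * K * s ^+ k.
  move=> wr; rewrite ncM; apply: (@le_trans _ _ (B * rho k2 k * nc (derive1n k f w))).
    by apply: ler_wpM2r => //; exact: nc_ge0.
  by rewrite -!mulrA; apply: ler_wpM2l => //; rewrite mulrC; exact: hK.
have hd n := diffop_geo s0 s1 hb n (lexx r).
set E := Num.sqrt (expR (A * (2 * r) ^+ 2)).
apply/cvg_ncP => e e0; have e3 : 0 < e / 3 by rewrite divr_gt0.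
have s1' : 0 < 1 - s by lra.
have [n h1 h2] : exists2 n, B * K / (1 - s) * s ^+ n < e / 3 &
    2 * (B * M / (1 - s) * E) * s ^+ n < e / 3.
  have [n [? ?]] := filter_ex (filterI (geom_small (B * K / (1 - s)) s0 s1 e3)
    (geom_small (2 * (B * M / (1 - s) * E)) s0 s1 e3)).
  by exists n.
have /cvg_ncP /(_ _ e3) := @diffop_partial_taylor b c f n cf z.
apply: filterS => J hJ.
set tn := fun j => \sum_(k < n) b k * (((j + k) ^_ k)%:R * c (j + k)%N) in hJ.
(* The sums over j and k are interchanged through a truncation at order n: the coefficient errors
   are small uniformly in J, the truncated operator has a genuine Taylor series, and the last
   difference is the tail of the operator series. *)
have -> : series (fun k => t k * z ^+ k) J - diffop b f z =
   \sum_(j < J) (t j - tn j) * z ^+ j + (series (fun k => tn k * z ^+ k) J - diffop_partial b f n z)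
   - (diffop b f z - diffop_partial b f n z).
  have -> : \sum_(j < J) (t j - tn j) * z ^+ j =
     series (fun k => t k * z ^+ k) J - series (fun k => tn k * z ^+ k) J.
    by rewrite /series /= !big_mkord -sumrB; apply: eq_bigr => j _; rewrite mulrBl.
  by ring.
have h3 := hd n.
have h4 : nc (\sum_(j < J) (t j - tn j) * z ^+ j) <= 2 * (B * M / (1 - s) * E) * s ^+ n.
  apply: le_trans (nc_sum _ _ _) _.
  apply: (@le_trans _ _ (\sum_(j < J) (B * M / (1 - s) * s ^+ n * E) * 2^-1 ^+ j)).
    apply: ler_sum => j _; rewrite ncM ncX -/r.
    apply: le_trans (ler_wpM2r (exprn_ge0 _ r0) (ht j n)) _.
    have := @rho_bound A (2 * r) j A0; rewrite mulr_ge0 // => /(_ isT) hh.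
    rewrite [leLHS](_ : _ = B * M / (1 - s) * s ^+ n * 2^-1 ^+ j * (rho A j * (2 * r) ^+ j)); last first.
      rewrite exprMn exprVn; field; rewrite expf_neq0 //; lra.
    rewrite [leRHS](_ : _ = B * M / (1 - s) * s ^+ n * 2^-1 ^+ j * E); last by ring.
    apply: ler_wpM2l => //.
    by rewrite !mulr_ge0 ?exprn_ge0 // ?invr_ge0 ?ltW.
  rewrite -mulr_sumr; have s2 : \sum_(j < J) 2^-1 ^+ j <= 2 :> R.
    apply: le_trans (@sum_geom_le _ 2^-1 J _ _) _; [lra|lra|].
    by rewrite (_ : 1 - 2^-1 = 2^-1) ?invrK //; lra.
  rewrite [leRHS](_ : _ = (B * M / (1 - s) * s ^+ n * E) * 2); last by ring.
  apply: ler_wpM2l => //; rewrite mulr_ge0 ?sqrtr_ge0 // mulr_ge0 ?exprn_ge0 //.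
  by rewrite mulr_ge0 ?invr_ge0 ?mulr_ge0 // ltW.
apply: le_lt_trans (ncB _ _) _; apply: le_lt_trans (lerD (ncD _ _) (lexx _)) _.
move: h3; rewrite mulrAC => h3; lra.
Qed.

Lemma Fock_rho a f : 0 < a -> Fock a f ->
  exists c (M : R), is_taylor c f /\ forall m, nc (c m) <= M * rho a m.
Proof.
move=> a0 [c cf cv]; exists c.
have [M hM] : exists M, forall k, k`!%:R / a ^+ k * nc (c k) ^+ 2 <= M.
  have [M [_ hM]] := cvg_seq_bounded (cvgP _ (cvg_series_cvg_0 cv)).
  exists (M + 1) => k; apply: le_trans (ler_norm _) _.
  by apply: hM => //; rewrite ltrDl.
have M0 : 0 <= M.
  apply: le_trans (hM 0%N); rewrite mulr_ge0 ?sqr_ge0 // divr_ge0 // exprn_ge0 // ltW.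
exists (Num.sqrt M); split => // m.
rewrite -(@ler_pXn2r _ 2) ?nnegrE ?nc_ge0 ?mulr_ge0 ?sqrtr_ge0 //.
rewrite exprMn sqr_sqrtr // sqr_rho; last exact: ltW.
have am : 0 < a ^+ m by rewrite exprn_gt0.
have mf : 0 < m`!%:R :> R by rewrite ltr0n fact_gt0.
rewrite mulrA ler_pdivlMr // -ler_pdivrMr // mulrAC -mulrA mulrC.
by rewrite mulrC [X in X <= _]mulrA mulrC mulrA [_ * _^-1]mulrC mulrA [a ^- m * _]mulrC; exact: hM.
Qed.

(** The gap A < y turns bounded weighted coefficients into a geometric series of ratio A/y; this is
    where strictness of the bound on b enters. *)
Lemma rho_Fock (y A K : R) f (t : nat -> R[i]) : 0 <= A -> A < y -> is_taylor t f ->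
  (forall j, nc (t j) <= K * rho A j) -> Fock y f.
Proof.
move=> A0 Ab tf h; exists t => //.
have b0 : 0 < y by lra.
apply: (@series_le_cvg _ _ (fun k => K ^+ 2 * (A / y) ^+ k)).
- by move=> k; rewrite mulr_ge0 ?sqr_ge0 // divr_ge0 // exprn_ge0 // ltW.
- by move=> k; rewrite mulr_ge0 ?sqr_ge0 // exprn_ge0 // divr_ge0 // ltW.
- move=> k; have bk : 0 < y ^+ k by rewrite exprn_gt0.
  have kf : 0 < k`!%:R :> R by rewrite ltr0n fact_gt0.
  have K0 : 0 <= K * rho A k by apply: le_trans (h k); exact: nc_ge0.
  have h2 : nc (t k) ^+ 2 <= (K * rho A k) ^+ 2 by rewrite lerXn2r ?nnegrE ?nc_ge0.
  apply: (@le_trans _ _ (k`!%:R / y ^+ k * (K * rho A k) ^+ 2)).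
    by apply: ler_wpM2l => //; rewrite divr_ge0 // ltW.
  rewrite exprMn sqr_rho // expr_div_n le_eqVlt; apply/orP; left; apply/eqP.
  by field; rewrite !gt_eqF.
- rewrite (_ : (fun k => _) = geometric (K ^+ 2) (A / y)) //.
  apply: is_cvg_geometric_series; rewrite ger0_norm; last by rewrite divr_ge0 // ltW.
  by rewrite ltr_pdivrMr // mul1r.
Qed.

End DifferentialOperator.

(** * Growth of functions of genus at most one and decay of their coefficients *)

Section Growth.
Variable R : realType.
Implicit Types (z w : R[i]) (x y r e : R) (f g h : R[i] -> R[i]).

Lemma primary_factor0 (u : R[i]) : nc (primary_factor 0 u) <= expR (nc u).
Proof.
rewrite /primary_factor big_geq // cexp0 mulr1.
by apply: le_trans (ncB _ _) _; rewrite nc1 expR_ge1Dx.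
Qed.

(** |1 - u|^2 = 1 - 2 Re u + |u|^2 <= e^(-2 Re u + |u|^2), and |e^u|^2 cancels the linear term. *)
Lemma nc_one_sub_cexp (u : R[i]) : nc ((1 - u) * cexp u) ^+ 2 <= expR (nc u ^+ 2).
Proof.
rewrite ncM nc_cexp exprMn -expRM_natl (sqr_nc (1 - u)) ReD ReN ImD ImN /= sub0r sqrrN.
have -> : (1 - complex.Re u) ^+ 2 + complex.Im u ^+ 2 = 1 + (- (2 * complex.Re u) + nc u ^+ 2).
  by rewrite sqr_nc; ring.
apply: le_trans (ler_wpM2r (expR_ge0 _) (expR_ge1Dx _)) _.
by rewrite -expRD ler_expR; lra.
Qed.

Lemma primary_factor1 (u : R[i]) :
  nc (primary_factor 1 u) <= expR (nc u ^+ 2 / 2) /\ nc (primary_factor 1 u) <= expR (2 * nc u).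
Proof.
have -> : primary_factor 1 u = (1 - u) * cexp u.
  by rewrite /primary_factor big_nat1 expr1 divr1.
split.
  rewrite -(@ler_pXn2r _ 2) ?nnegrE ?nc_ge0 ?expR_ge0 // -expRM_natl.
  by apply: le_trans (nc_one_sub_cexp u) _; rewrite ler_expR; lra.
rewrite ncM mulr2n mulrDl mul1r expRD; apply: ler_pM; rewrite ?nc_ge0 //.
  by apply: le_trans (ncB _ _) _; rewrite nc1 expR_ge1Dx.
exact: nc_cexp_le.
Qed.

(** For p = 1 the first N factors get the linear bound e^(2|u|), and the tail, whose sum of |r_k|^2
    is below e, the quadratic one. Hence the coefficient of |z|^2 can be made arbitrarily small. *)
Lemma product_growth p (rs : nat -> R[i]) e : (p <= 1)%N -> 0 < e ->
  cvgn (series (fun k => nc (rs k) ^+ p.+1)) ->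
  exists2 A, 0 <= A & forall n z,
    nc (\prod_(k < n) primary_factor p (rs k * z)) <= expR (A * nc z + e * nc z ^+ 2).
Proof.
move=> p1 e0 cv.
have nd : nondecreasing_seq (series (fun k => nc (rs k) ^+ p.+1)).
  by apply: nondecreasing_series => k _ _; rewrite exprn_ge0 // nc_ge0.
set S := limn (series (fun k => nc (rs k) ^+ p.+1)).
have Sn n : \sum_(k < n) nc (rs k) ^+ p.+1 <= S.
  by have := nondecreasing_cvgn_le nd cv n; rewrite /series /= big_mkord.
have S0 : 0 <= S by have := Sn 0%N; rewrite big_ord0.
case: p p1 cv nd @S Sn S0 => [|[|//]] _ cv nd S Sn S0.
  exists S => // n z; rewrite nc_prod.
  apply: (@le_trans _ _ (\prod_(k < n) expR (nc (rs k) * nc z))).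
    by apply: ler_prod => k _; rewrite nc_ge0 -ncM primary_factor0.
  rewrite -expR_sum ler_expR -mulr_suml.
  have h1 := ler_wpM2r (nc_ge0 z) (Sn n); have h2 := mulr_ge0 (ltW e0) (sqr_ge0 (nc z)).
  have -> : \sum_(i < n) nc (rs i) = \sum_(k < n) nc (rs k) ^+ 1 by [].
  by lra.
have [N _ hN] : \forall N \near \oo, S - \sum_(k < N) nc (rs k) ^+ 2 < e.
  move/cvgrPdist_lt : cv => /(_ _ e0); apply: filterS => n.
  by rewrite /series /= big_mkord; apply: le_lt_trans; exact: ler_norm.
exists (2 * \sum_(k < N) nc (rs k)).
  by rewrite mulr_ge0 // sumr_ge0 // => i _; exact: nc_ge0.
move=> n z; rewrite nc_prod.
pose E k := if (k < N)%N then 2 * nc (rs k) * nc z else nc (rs k) ^+ 2 * nc z ^+ 2.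
have zz := sqr_ge0 (nc z).
apply: (@le_trans _ _ (\prod_(k < n) expR (E k))).
  apply: ler_prod => k _; rewrite nc_ge0 /= /E.
  have [h1 h2] := primary_factor1 (rs k * z).
  case: ifP => _; first by apply: le_trans h2 _; rewrite ncM mulrA.
  apply: le_trans h1 _; rewrite ler_expR ncM exprMn.
  have := mulr_ge0 (sqr_ge0 (nc (rs k))) (sqr_ge0 (nc z)); lra.
rewrite -expR_sum ler_expR.
have E0 k : 0 <= E k by rewrite /E; case: ifP => _; rewrite !mulr_ge0 ?nc_ge0 ?sqr_ge0.
apply: (@le_trans _ _ (\sum_(k < N + n) E k)).
  rewrite -!(big_mkord xpredT E) (big_cat_nat (n := n) (p := N + n)) ?leq_addl //=.
  by rewrite lerDl sumr_ge0.
rewrite -(big_mkord xpredT E) (big_cat_nat (n := N)) ?leq_addr //= big_mkord.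
apply: lerD.
  rewrite -mulrA mulr_suml mulr_sumr; apply: ler_sum => k _.
  by rewrite /E ltn_ord mulrA.
apply: (@le_trans _ _ (\sum_(N <= k < N + n) nc (rs k) ^+ 2 * nc z ^+ 2)).
  rewrite big_nat_cond [leRHS]big_nat_cond; apply: ler_sum => k /andP[/andP[Nk _] _].
  by rewrite /E ltnNge Nk.
rewrite -mulr_suml; apply: ler_wpM2r => //.
have := Sn (N + n)%N; rewrite -(big_mkord xpredT (fun k => nc (rs k) ^+ 2)).
rewrite (big_cat_nat (n := N)) ?leq_addr //= big_mkord.
by have := hN N (leqnn N); lra.
Qed.

Lemma genus_growth h e : 0 < e -> genus_le 1 h ->
  exists2 C, 0 <= C & forall z, nc (h z) <= C * expR (e * nc z ^+ 2).
Proof.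
move=> e0 [h0|[p p1 [m [Q [rs [Qs cv hl]]]]]].
  by exists 0 => // z; rewrite h0 nc0 mul0r.
have e2 : 0 < e / 2 by rewrite divr_gt0.
have [A A0 hA] := product_growth p1 e2 cv.
pose q0 := nc Q`_0; pose q1 := nc Q`_1; pose B := 1 + q1 + A.
exists (m`!%:R * expR q0 * expR (B ^+ 2 / (2 * e))).
  by rewrite !mulr_ge0 ?expR_ge0.
move=> z; apply: (cvg_nc_le (hl z)); near=> n.
rewrite ncM (ncM (z ^+ m)) ncX nc_cexp; set x := nc z.
have x0 : 0 <= x := nc_ge0 z.
have h1 : x ^+ m <= m`!%:R * expR x.
  by have := exp_coeff_le m x0; rewrite ler_pdivrMr ?ltr0n ?fact_gt0 // mulrC.
have h2 : complex.Re Q.[z] <= q0 + q1 * x.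
  apply: le_trans (ler_norm _) _; apply: le_trans (nc_ge_Re _) _.
  rewrite (@horner_coef_wide _ 2); last by apply: leq_trans Qs _; rewrite ltnS.
  rewrite !big_ord_recr big_ord0 /= add0r expr0 mulr1 expr1.
  by apply: le_trans (ncD _ _) _; rewrite ncM.
apply: (@le_trans _ _ (m`!%:R * expR x * expR (q0 + q1 * x) * expR (A * x + e / 2 * x ^+ 2))).
  apply: ler_pM; rewrite ?nc_ge0 ?mulr_ge0 ?exprn_ge0 ?expR_ge0 //.
  by apply: ler_pM; rewrite ?exprn_ge0 ?expR_ge0 // ler_expR.
rewrite -!mulrA -!expRD; apply: ler_wpM2l => //; rewrite ler_expR.
(* B collects the linear exponents of z^m, of e^Q and of the product; completing the square trades
   them for the second half of e. *)
suff : B * x <= B ^+ 2 / (2 * e) + e / 2 * x ^+ 2 by rewrite /B; lra.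
rewrite -subr_ge0 (_ : _ - _ = (B - e * x) ^+ 2 / (2 * e)); last by field; lra.
by rewrite divr_ge0 ?sqr_ge0 //; lra.
Unshelve. all: by end_near. Qed.

Lemma gaussian_growth h h1 (gamma k : R) : 0 <= gamma -> gamma < k -> genus_le 1 h1 ->
  (forall w, h w = cexp (- (gamma%:C * w ^+ 2)) * h1 w) ->
  exists2 C, 0 <= C & forall z, nc (h z) <= C * expR (k * nc z ^+ 2).
Proof.
move=> g0 gk gh hh; have e0 : 0 < k - gamma by lra.
have [C C0 hC] := genus_growth e0 gh; exists C => // z.
have h2 : nc (cexp (- (gamma%:C * z ^+ 2))) <= expR (gamma * nc z ^+ 2).
  by apply: le_trans (nc_cexp_le _) _; rewrite ler_expR ncN ncM ncR ncX ger0_norm.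
rewrite hh (ncM (cexp _)); apply: le_trans (ler_pM (nc_ge0 _) (nc_ge0 _) h2 (hC z)) _.
rewrite mulrCA -expRD le_eqVlt; apply/orP; left; apply/eqP; congr (_ * expR _); ring.
Qed.

(** A crude Stirling bound; the induction step is (1 + 1/(n+1))^(n+2) >= e, from 1 - x <= e^(-x) at
    x = 1/(n+2). *)
Lemma fact_exp_le n : n.+1`!%:R * expR n.+1%:R <= expR 1 * n.+1%:R ^+ n.+2 :> R.
Proof.
elim: n => [|n IH]; first by rewrite (_ : 1`! = 1%N) // mul1r expr1n mulr1.
have n0 : 0 < n.+1%:R :> R by rewrite ltr0n.
have n1 : 0 < n.+2%:R :> R by rewrite ltr0n.
have key : expR 1 * n.+1%:R ^+ n.+2 <= n.+2%:R ^+ n.+2 :> R.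
  have h : expR n.+2%:R^-1 * n.+1%:R <= n.+2%:R :> R.
    have := expR_ge1Dx (- n.+2%:R^-1 : R).
    have -> : 1 + - n.+2%:R^-1 = n.+1%:R / n.+2%:R :> R.
      by apply: (mulIf (lt0r_neq0 n1)); rewrite mulfVK ?gt_eqF // mulrDl mul1r mulNr mulVf ?gt_eqF // -[n.+2%:R]natr1 addrK.
    rewrite ler_pdivrMr // expRN => h.
    by rewrite mulrC -ler_pdivlMr ?expR_gt0 // mulrC.
  have -> : expR 1 = expR (n.+2%:R^-1) ^+ n.+2 :> R.
    by rewrite -expRM_natl divff // gt_eqF.
  by rewrite -exprMn lerXn2r ?nnegrE // ?mulr_ge0 ?expR_ge0 // ltW.
have e1 : expR n.+2%:R = expR 1 * expR n.+1%:R :> R by rewrite -expRD -natr1 addrC.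
rewrite factS natrM e1.
rewrite [leLHS](_ : _ = n.+2%:R * expR 1 * (n.+1`!%:R * expR n.+1%:R)); last by ring.
have a0 : 0 <= n.+2%:R * expR 1 :> R by rewrite mulr_ge0 ?expR_ge0.
apply: le_trans (ler_wpM2l a0 IH) _.
rewrite [leLHS](_ : _ = n.+2%:R * expR 1 * (expR 1 * n.+1%:R ^+ n.+2)); last by ring.
rewrite [leRHS](_ : _ = n.+2%:R * expR 1 * n.+2%:R ^+ n.+2); last by rewrite exprS; ring.
exact: ler_wpM2l.
Qed.

Lemma linear_le_geom (t : R) : 1 < t -> exists2 D, 0 <= D & forall k, k.+1%:R <= D * t ^+ k.
Proof.
move=> t1; exists (1 + (t - 1)^-1).
  by rewrite addr_ge0 // invr_ge0; lra.
have t0 : 0 < t - 1 by lra.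
move=> k; have B : 1 + k%:R * (t - 1) <= t ^+ k.
  elim: k => [|k IH]; first by rewrite mul0r addr0 expr0.
  rewrite exprS -natr1; have k0 : 0 <= k%:R :> R by [].
  have h : t * (1 + k%:R * (t - 1)) <= t * t ^+ k by apply: ler_wpM2l => //; lra.
  apply: le_trans h; have := mulr_ge0 k0 (sqr_ge0 (t - 1)); lra.
have tk : 1 <= t ^+ k by apply: exprn_ege1; lra.
rewrite mulrDl mul1r -natr1 addrC; apply: lerD => //.
rewrite mulrC ler_pdivlMr //; lra.
Qed.

(** [rho y k] is [rho x k] times sqrt(y/x)^k, and a geometric sequence outgrows k + 1: polynomial
    factors are traded for a larger parameter. *)
Lemma rho_le_linear (x y : R) : 0 < x -> x < y ->
  exists2 D, 0 <= D & forall k, k.+1%:R * rho x k <= D * rho y k.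
Proof.
move=> x0 xy; have y0 : 0 < y by lra.
have t1 : 1 < Num.sqrt (y / x).
  by rewrite -[ltLHS]sqrtr1 ltr_sqrt ?divr_gt0 // ltr_pdivlMr // mul1r.
have [D D0 hD] := linear_le_geom t1; exists D => // k.
have -> : rho y k = Num.sqrt (y / x) ^+ k * rho x k.
  have yx : 0 <= y / x by rewrite divr_ge0 // ltW.
  apply/eqP; rewrite -(@eqrXn2 _ 2) ?rho_ge0 ?mulr_ge0 ?exprn_ge0 ?sqrtr_ge0 //.
  rewrite exprMn !sqr_rho ?ltW // -exprM mulnC exprM sqr_sqrtr //; apply/eqP.
  rewrite expr_div_n; field.
  by rewrite expf_neq0 ?gt_eqF // pnatr_eq0 -lt0n fact_gt0.
by rewrite mulrA; apply: ler_wpM2r => //; exact: rho_ge0.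
Qed.

(* Cauchy's estimate on the circle of radius sqrt(k / (2 kappa)). *)
Lemma growth_coef_bound h (C kappa kappa' : R) : 0 < kappa -> kappa < kappa' -> 0 <= C ->
  (forall z, nc (h z) <= C * expR (kappa * nc z ^+ 2)) ->
  exists2 B, 0 <= B & forall n, exists2 r, 0 < r & forall p : {poly R[i]},
    (forall z, nc z <= r -> nc (p.[z] - h z) < 1) -> forall k, (k <= n)%N ->
    nc p`_k <= B * rho (2 * kappa') k.
Proof.
move=> k0 kk' C0 hC.
have [D D0 hD] : exists2 D, 0 <= D & forall k, k.+1%:R * rho (2 * kappa) k <= D * rho (2 * kappa') k.
  by apply: rho_le_linear; lra.
exists ((C + 1) * expR 1 * D); first by rewrite !mulr_ge0 ?expR_ge0 //; lra.
(* One disc contains the optimal circles for all k <= n; the summand 1 keeps the radius positive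
   when n = 0. *)
move=> n; exists (Num.sqrt (n%:R / (2 * kappa)) + 1).
  by rewrite ltr_wpDl ?sqrtr_ge0.
move=> p hp k kn.
suff h1 : nc p`_k <= (C + 1) * expR 1 * (k.+1%:R * rho (2 * kappa) k).
  apply: le_trans h1 _; rewrite -[leRHS]mulrA; apply: ler_wpM2l => //.
  by rewrite mulr_ge0 ?expR_ge0 //; lra.
set r := Num.sqrt (k%:R / (2 * kappa)).
have k2 : 0 < 2 * kappa by lra.
have rr : r ^+ 2 = k%:R / (2 * kappa) by rewrite sqr_sqrtr // divr_ge0 // ltW.
have r0 : 0 <= r := sqrtr_ge0 _.
have E1 : 1 <= expR (k%:R / 2) :> R by rewrite -expR0 ler_expR divr_ge0.
have h2 : nc p`_k * r ^+ k <= (C + 1) * expR (k%:R / 2).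
  apply: poly_cauchy => // z zr.
  have h3 : nc (p.[z] - h z) < 1.
    apply: hp; apply: le_trans zr _; rewrite ler_wpDr // ler_wsqrtr //.
    by rewrite ler_wpM2r ?invr_ge0 ?(ltW k2) // ler_nat.
  have h4 : nc (h z) <= C * expR (k%:R / 2).
    apply: le_trans (hC z) _; apply: ler_wpM2l => //; rewrite ler_expR.
    have : nc z ^+ 2 <= r ^+ 2 by rewrite lerXn2r ?nnegrE ?nc_ge0.
    rewrite rr => h5; apply: le_trans (ler_wpM2l (ltW k0) h5) _.
    by rewrite le_eqVlt; apply/orP; left; apply/eqP; field; lra.
  have := ncD (p.[z] - h z) (h z); rewrite subrK mulrDl mul1r; lra.
case: k => [|k] in kn r rr r0 E1 h2 *.
  move: h2; rewrite mul0r expR0 expr0 !mulr1 => h2; apply: le_trans h2 _.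
  rewrite /rho expr0 fact0 divr1 sqrtr1 mul1r mulr1 ler_peMr //; first lra.
  by rewrite -expR0 ler_expR.
have rp : 0 < r by rewrite sqrtr_gt0 divr_gt0.
rewrite -(ler_pM2r (exprn_gt0 k.+1 rp)); apply: le_trans h2 _.
rewrite -[leRHS]mulrA -[leRHS]mulrA; apply: ler_wpM2l; first lra.
rewrite -(@ler_pXn2r _ 2) ?nnegrE ?mulr_ge0 ?expR_ge0 ?rho_ge0 ?exprn_ge0 //.
rewrite !exprMn sqr_rho ?(ltW k2) // -expRM_natl.
have -> : 2 * (k.+1%:R / 2) = k.+1%:R :> R by field.
rewrite -[r ^+ _ ^+ 2]exprM mulnC exprM rr expr_div_n.
have K0 : 0 < k.+1%:R :> R by rewrite ltr0n.
have F0 : 0 < k.+1`!%:R :> R by rewrite ltr0n fact_gt0.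
have := fact_exp_le k; rewrite mulrC -ler_pdivlMr // => hF.
apply: le_trans hF _.
rewrite [leRHS](_ : _ = expR 1 * (k.+1%:R ^+ k.+1 / k.+1`!%:R) * (expR 1 * k.+2%:R ^+ 2)); last first.
  by field; rewrite gt_eqF // expf_neq0 // gt_eqF.
rewrite [leLHS](_ : _ = expR 1 * (k.+1%:R ^+ k.+1 / k.+1`!%:R) * (1 * k.+1%:R)); last first.
  by rewrite (exprS _ k.+1); field; rewrite gt_eqF.
apply: ler_wpM2l.
  by rewrite mulr_ge0 ?expR_ge0 // divr_ge0 ?exprn_ge0.
apply: ler_pM => //; first by rewrite -expR0 ler_expR.
by rewrite -natrX ler_nat (leq_trans (leqnSn _)) // -{1}[k.+2]expn1 leq_exp2l.
Qed.

(** With t half of y - x and l = k - j, C(k, j) x^j t^l <= (x + t)^k controls the squared terms and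
    (L^2/t)^l / l! <= e^(L^2/t) the exponential part. The other half of the gap pays for the k + 1
    terms. D depends on x, y and L only, hence is uniform in the approximants. *)
Lemma rho_conv (x y L : R) : 0 < x -> x < y -> 0 <= L -> exists2 D, 0 <= D &
  forall (u v : nat -> R[i]) B k, 0 <= B -> (forall j, nc (u j) <= B * rho x j) ->
    (forall l, nc (v l) <= L ^+ l / l`!%:R) ->
    nc (\sum_(j < k.+1) u j * v (k - j)%N) <= D * B * rho y k.
Proof.
move=> x0 xy L0; pose t := (y - x) / 2; have t0 : 0 < t by rewrite /t; lra.
have [D D0 hD] : exists2 D, 0 <= D & forall k, k.+1%:R * rho (x + t) k <= D * rho y k.
  by apply: rho_le_linear; rewrite /t; lra.
pose E := Num.sqrt (expR (L ^+ 2 / t)).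
have E0 : 0 <= E by exact: sqrtr_ge0.
exists (E * D); first by rewrite mulr_ge0.
move=> u v B k B0 hu hv; apply: le_trans (nc_sum _ _ _) _.
apply: (@le_trans _ _ (\sum_(j < k.+1) E * B * rho (x + t) k)); last first.
  rewrite sumr_const card_ord -[leLHS]mulr_natl.
  rewrite [leLHS](_ : _ = E * B * (k.+1%:R * rho (x + t) k)); last by ring.
  rewrite [leRHS](_ : _ = E * B * (D * rho y k)); last by ring.
  by apply: ler_wpM2l => //; rewrite mulr_ge0.
apply: ler_sum => j _; have jk : (j <= k)%N by rewrite -ltnS ltn_ord.
rewrite ncM; apply: le_trans (ler_pM (nc_ge0 _) (nc_ge0 _) (hu j) (hv (k - j)%N)) _.
rewrite -[leLHS]mulrA [E * B]mulrC -[leRHS]mulrA; apply: ler_wpM2l => //.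
set l := (k - j)%N.
have l0 : 0 < l`!%:R :> R by rewrite ltr0n fact_gt0.
have j0 : 0 < j`!%:R :> R by rewrite ltr0n fact_gt0.
have kf : 0 < k`!%:R :> R by rewrite ltr0n fact_gt0.
have xt : 0 <= x + t by lra.
rewrite -(@ler_pXn2r _ 2) ?nnegrE ?mulr_ge0 ?rho_ge0 ?divr_ge0 ?exprn_ge0 //.
rewrite !exprMn !sqr_rho //; last lra.
rewrite sqr_sqrtr ?expR_ge0 //.
have h1 : 'C(k, j)%:R * (x ^+ j * t ^+ l) <= (x + t) ^+ k.
  rewrite [x + t]addrC [leRHS]exprDn.
  have jk' : (j < k.+1)%N by rewrite ltnS.
  rewrite (bigD1 (Ordinal jk')) //= -/l mulr_natl mulrC lerDl sumr_ge0 // => i _.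
  by rewrite mulrn_wge0 // mulr_ge0 // exprn_ge0 // ltW.
have h2 : (L ^+ 2 / t) ^+ l / l`!%:R <= expR (L ^+ 2 / t).
  by apply: exp_coeff_le; rewrite divr_ge0 ?sqr_ge0 // ltW.
have bE : 'C(k, j)%:R = k`!%:R / (j`!%:R * l`!%:R) :> R.
  by rewrite -(bin_fact jk) !natrM mulfK // mulf_neq0 ?gt_eqF.
have tl : 0 < t ^+ l by rewrite exprn_gt0.
have h3 : 0 <= (x + t) ^+ k / k`!%:R by rewrite divr_ge0 // exprn_ge0.
apply: le_trans (ler_wpM2r h3 h2).
have h4 : 'C(k, j)%:R * (x ^+ j * t ^+ l) / k`!%:R <= (x + t) ^+ k / k`!%:R.
  by rewrite ler_wpM2r // invr_ge0 ltW.
have h5 : 0 <= (L ^+ 2 / t) ^+ l / l`!%:R.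
  by rewrite divr_ge0 // exprn_ge0 // divr_ge0 ?sqr_ge0 // ltW.
apply: le_trans (ler_wpM2l h5 h4).
rewrite bE expr_div_n -[L ^+ 2 ^+ l]exprM mulnC exprM exprVn le_eqVlt; apply/orP; left; apply/eqP.
by field; rewrite !gt_eqF.
Qed.

End Growth.

(** * Zeros of polynomials: Gauss-Lucas, Hermite-Biehler, de Bruijn, Jensen *)

Section ZeroGeometry.
Variable R : realType.
Implicit Types (z w : R[i]) (x y r e : R) (p q F G : {poly R[i]}).

Lemma poly_split p : exists s : seq R[i], p = lead_coef p *: \prod_(a <- s) ('X - a%:P).
Proof. by have [s hs] := closed_field_poly_normal p; exists s. Qed.

Lemma deriv_prod_XsubC (s : seq R[i]) z : z \notin s ->
  (\prod_(a <- s) ('X - a%:P))^`().[z] =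
  (\prod_(a <- s) ('X - a%:P)).[z] * \sum_(a <- s) (z - a)^-1.
Proof.
elim: s => [|a s IH]; first by rewrite !big_nil derivC horner0 mulr0.
rewrite inE negb_or => /andP[za /IH {}IH].
rewrite !big_cons derivM derivXsubC mul1r hornerD !hornerM hornerXsubC IH.
by field; rewrite subr_eq0.
Qed.

Lemma inv_conj w : w^-1 = w^*%C * ((nc w ^+ 2)^-1)%:C.
Proof.
rewrite sqr_nc; case: w => a b /=.
by apply/eqP; rewrite eq_complex /=; apply/andP; split; apply/eqP; ring.
Qed.

Lemma Im_div_le0 z w : complex.Im (z * w^*%C) <= 0 -> complex.Im (z / w) <= 0.
Proof.
move=> h; have -> : z / w = z * w^*%C * ((nc w ^+ 2)^-1)%:C.
  by rewrite -mulrA -inv_conj.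
by rewrite ImM /= mulr0 add0r mulr_le0_ge0 // invr_ge0 sqr_ge0.
Qed.

Lemma root_notin p (s : seq R[i]) z : p = lead_coef p *: \prod_(a <- s) ('X - a%:P) ->
  p.[z] != 0 -> z \notin s.
Proof.
move=> pE pz; apply: contra pz => zs; rewrite pE hornerZ.
by have := root_prod_XsubC s z; rewrite zs rootE => /eqP ->; rewrite mulr0.
Qed.

Lemma root_in p (s : seq R[i]) a : p != 0 -> p = lead_coef p *: \prod_(a <- s) ('X - a%:P) ->
  a \in s -> root p a.
Proof.
by move=> p0 pE sa; rewrite pE rootZ ?lead_coef_eq0 // root_prod_XsubC.
Qed.

(** Gauss-Lucas in logarithmic form: p'/p is the sum of 1/(z - a) over the roots a, and z lies
    higher than each of them. *)
Lemma logderiv_im p d z : (forall w, d < complex.Im w -> p.[w] != 0) -> d < complex.Im z ->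
  complex.Im (p^`().[z] / p.[z]) <= 0.
Proof.
move=> hp zd; have pz := hp z zd.
have p0 : p != 0 by apply: contraNneq pz => ->; rewrite horner0.
have [s pE] := poly_split p; have zs := root_notin pE pz.
have -> : p^`().[z] / p.[z] = \sum_(a <- s) (z - a)^-1.
  rewrite pE in pz *; rewrite derivZ !hornerZ deriv_prod_XsubC // mulrA.
  by rewrite mulrC mulKf // -hornerZ.
rewrite Im_sum big_seq; apply: sumr_le0 => a sa.
rewrite ImV ImD ImN; have : ~~ (d < complex.Im a).
  by apply/negP => /hp; have := root_in p0 pE sa; rewrite rootE => ->.
rewrite -leNgt => ad; rewrite mulNr oppr_le0 divr_ge0 ?sqr_ge0 //; lra.
Qed.

Definition conj_poly p : {poly R[i]} := map_poly (@conjc R) p.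

Lemma horner_conj_poly p z : (conj_poly p).[z] = (p.[z^*%C])^*%C.
Proof. by rewrite /conj_poly -{1}[z]conjcK horner_map. Qed.

(** A Hermite-Biehler condition for the half-plane Im z > d. It is preserved by D - a for Im a > 0,
    and it excludes zeros of F + F* there. *)
Definition dominates_conj d F : Prop :=
  forall z, d < complex.Im z -> nc (conj_poly F).[z] < nc F.[z].

Lemma dominates_conjZ d F (a : R[i]) : a != 0 -> dominates_conj d F -> dominates_conj d (a *: F).
Proof.
move=> a0 h z zd; rewrite !horner_conj_poly !hornerZ rmorphM !ncM !ncJ.
have := h z zd; rewrite horner_conj_poly ncJ => h'.
by rewrite ltr_pM2l // nc_gt0.
Qed.

(* |F| > |F*| in a half-plane means that F + w F* has no zero there for |w| <= 1;
   Gauss-Lucas for F + w F* then gives the same for F' - a F. *)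
Lemma dominates_conj_deriv d F (a : R[i]) : 0 < complex.Im a -> dominates_conj d F ->
  dominates_conj d (F^`() - a *: F).
Proof.
move=> a0 hF z zd; set G := F^`() - a *: F.
have GE : conj_poly G = (conj_poly F)^`() - a^*%C *: conj_poly F.
  by rewrite /conj_poly /G rmorphB /= deriv_map map_polyZ.
suff key : forall w, nc w <= 1 -> G.[z] + w * (conj_poly G).[z] != 0.
  rewrite ltNge; apply/negP => h.
  have [g0|g0] := eqVneq (conj_poly G).[z] 0.
    have : G.[z] == 0 by rewrite -nc_eq0 eq_le nc_ge0 andbT -(nc0 R) -g0.
    by move=> /eqP G0; have := key 0; rewrite nc0 => /(_ ler01); rewrite G0 mul0r addr0 eqxx.
  have := key (- G.[z] / (conj_poly G).[z]); rewrite divfK // subrr eqxx.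
  rewrite ncM ncV ncN ler_pdivrMr ?nc_gt0 // mul1r => /(_ h) //.
move=> w w1; set P := F + w *: conj_poly F.
have hP u : d < complex.Im u -> P.[u] != 0.
  move=> ud; have h := hF u ud; rewrite /P hornerD hornerZ; apply/negP => /eqP /eqP.
  rewrite addr_eq0 => /eqP Fu; move: h; rewrite Fu ncN ncM ltNge => /negP; apply.
  by rewrite ler_piMl // nc_ge0.
apply/negP => /eqP E.
have Fz : F.[z] != 0 by rewrite -nc_gt0; apply: le_lt_trans (hF z zd); exact: nc_ge0.
pose s := w * (conj_poly F).[z] / F.[z].
have s1 : nc s < 1.
  rewrite /s !ncM ncV ltr_pdivrMr ?nc_gt0 // mul1r; apply: le_lt_trans (hF z zd).
  by rewrite ler_piMl // nc_ge0.
have PE : P.[z] = F.[z] * (1 + s) by rewrite /P hornerD hornerZ /s; field.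
have Pz := hP z zd.
have s0 : 1 + s != 0 by apply: contraNneq Pz => h; rewrite PE h mulr0.
have dPE : P^`().[z] = F.[z] * (a + s * a^*%C).
  have : P^`().[z] = G.[z] + w * (conj_poly G).[z] + (a * F.[z] + w * a^*%C * (conj_poly F).[z]).
    rewrite GE /G /P derivD derivZ !(hornerD, hornerZ, hornerN); ring.
  by rewrite E add0r => ->; rewrite /s; field.
have := logderiv_im hP zd; rewrite PE dPE -mulf_div divff // mul1r; apply/negP; rewrite -ltNge.
have -> : (a + s * a^*%C) / (1 + s) = (a + s * a^*%C) * (1 + s)^*%C * ((nc (1 + s) ^+ 2)^-1)%:C.
  by rewrite -mulrA -inv_conj.
rewrite ImM /= mulr0 add0r mulr_gt0 // ?invr_gt0 ?exprn_gt0 ?nc_gt0 //.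
have -> : complex.Im ((a + s * a^*%C) * (1 + s)^*%C) = complex.Im a * (1 - nc s ^+ 2).
  by rewrite sqr_nc; case: (a) (s) => [x y] [x' y'] /=; ring.
rewrite mulr_gt0 // subr_gt0 -[ltRHS](expr1n _ 2) ltrXn2r ?nnegrE ?nc_ge0 //.
Qed.

Definition polyD p F : {poly R[i]} := \sum_(k < size p) p`_k *: F^`(k).

Lemma polyD_wide p F n : (size p <= n)%N -> polyD p F = \sum_(k < n) p`_k *: F^`(k).
Proof.
move=> pn; rewrite /polyD !(big_ord_widen n (fun k => p`_k *: F^`(k)) pn).
rewrite big_mkcond; apply: eq_bigr => k _.
by case: ltnP => // kp; rewrite nth_default // scale0r.
Qed.

Lemma polyDZ p F (a : R[i]) : polyD (a *: p) F = a *: polyD p F.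
Proof.
rewrite (@polyD_wide _ _ (size p)) ?size_scale_leq // scaler_sumr.
by apply: eq_bigr => k _; rewrite coefZ scalerA.
Qed.

(** Multiplication of symbols is composition of operators; this lets p(D) be peeled off one root at
    a time. *)
Lemma polyD_XsubC p F (a : R[i]) : polyD (('X - a%:P) * p) F = (polyD p F)^`() - a *: polyD p F.
Proof.
have E k : (('X - a%:P) * p)`_k = (if k is k'.+1 then p`_k' else 0) - a * p`_k.
  by rewrite mulrBl coefB coefXM coefCM; case: k.
rewrite (@polyD_wide _ _ (size p).+1); last first.
  by apply: leq_trans (size_polyMleq _ _) _; rewrite size_XsubC.
under eq_bigr do rewrite E scalerBl -scalerA.
rewrite sumrB -scaler_sumr -(@polyD_wide p F (size p).+1) //; congr (_ - _).
rewrite big_ord_recl /= scale0r add0r /polyD linear_sum /=.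
by apply: eq_bigr => k _; rewrite derivZ -derivnS.
Qed.

Lemma polyD_dominates_conj d p F : p != 0 -> (forall a, root p a -> 0 < complex.Im a) ->
  dominates_conj d F -> dominates_conj d (polyD p F).
Proof.
move=> p0 hp hF; have [s pE] := poly_split p.
have {hp} hs a : a \in s -> 0 < complex.Im a by move=> /(root_in p0 pE); exact: hp.
rewrite pE polyDZ; apply: dominates_conjZ; first by rewrite lead_coef_eq0.
elim: s {p0 pE} hs => [|a s IH] hs.
  by rewrite big_nil /polyD size_poly1 big_ord1 coefC /= scale1r.
rewrite big_cons polyD_XsubC; apply: dominates_conj_deriv; first by apply: hs; rewrite inE eqxx.
by apply: IH => b sb; apply: hs; rewrite inE sb orbT.
Qed.

(** Above height d strict domination rules out F = -F*; the sum is its own conjugate, so a zero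
    below -d would reflect to one above d. *)
Lemma dominates_conj_strip d F : 0 <= d -> dominates_conj d F -> zeros_in_strip d (F + conj_poly F).
Proof.
move=> d0 hF.
have up z : d < complex.Im z -> (F + conj_poly F).[z] != 0.
  move=> /hF; rewrite hornerD addr_eq0 => h; apply: contraTneq h => ->.
  by rewrite ncN ltxx.
move=> z; rewrite rootE => /eqP h; rewrite ler_norml; apply/andP; split; rewrite leNgt; apply/negP => hz.
  have := up z^*%C; rewrite (_ : complex.Im z^*%C = - complex.Im z); last by case: (z).
  move=> /(_ _)/negP; apply; first by lra.
  move: h; rewrite !hornerD !horner_conj_poly conjcK => h.
  by rewrite -conjc_eq0 rmorphD /= ?conjcK addrC h.
by have /eqP := up z hz.
Qed.

(* de Bruijn: for real f, |f(w)|^2 = |c|^2 prod |w - a||w - a^*|, and each factor is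
   larger at z + i lambda than at z - i lambda as soon as (Im z)^2 > mu^2 - lambda^2. *)
Lemma shift_dominates_conj (mu lambda d : R) (f : {poly R[i]}) : 0 <= d -> 0 < lambda -> mu ^+ 2 <= d ^+ 2 + lambda ^+ 2 ->
  (1 < size f)%N -> conj_poly f = f -> zeros_in_strip mu f ->
  dominates_conj d (f \Po ('X + ('i%C * lambda%:C)%:P)).
Proof.
move=> d0 l0 mdl f1 fR hf z zd.
have f0 : f != 0 by rewrite -size_poly_gt0 ltnW.
have [s fE] := poly_split f.
rewrite horner_conj_poly !horner_comp !hornerE.
have conjE : (f.[z^*%C + 'i%C * lambda%:C])^*%C = f.[z - 'i%C * lambda%:C].
  rewrite -[in RHS]fR horner_conj_poly; congr (_.[_]^*)%C.
  by case: z {zd} => x y /=; apply/eqP; rewrite eq_complex /=; apply/andP; split; apply/eqP; ring.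
rewrite conjE -(@ltr_pXn2r _ 2) ?nnegrE ?nc_ge0 //.
set c := lead_coef f in fE.
have c0 : c != 0 by rewrite lead_coef_eq0.
have sqE w : nc f.[w] ^+ 2 = nc c ^+ 2 * \prod_(a <- s) (nc (w - a) * nc (w^*%C - a)).
  have E u : nc f.[u] = nc c * \prod_(a <- s) nc (u - a).
    rewrite fE hornerZ ncM horner_prod nc_prod; congr (_ * _).
    by apply: eq_bigr => a _; rewrite hornerXsubC.
  have -> : nc f.[w] ^+ 2 = nc f.[w] * nc f.[w^*%C].
    by rewrite expr2 -[in X in _ = _ * X]fR horner_conj_poly conjcK ncJ.
  by rewrite !E big_split /=; ring.
rewrite !sqE ltr_pM2l ?exprn_gt0 ?nc_gt0 //.
(* For a constant f both sides would agree; at least one root is what makes the product inequality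
   strict. *)
have s0 : s != [::].
  apply: contraTneq f1 => s0; rewrite fE s0 big_nil -leqNgt.
  by apply: leq_trans (size_scale_leq _ _) _; rewrite size_poly1.
have fac a : a \in s -> nc (z - 'i%C * lambda%:C - a) * nc ((z - 'i%C * lambda%:C)^*%C - a) <
    nc (z + 'i%C * lambda%:C - a) * nc ((z + 'i%C * lambda%:C)^*%C - a).
  move=> /(root_in f0 fE) /hf am.
  rewrite -(@ltr_pXn2r _ 2) ?nnegrE ?mulr_ge0 ?nc_ge0 // !exprMn !sqr_nc.
  move: zd am; case: z {conjE} => x y; case: a => a1 a2 /= zd.
  rewrite -(ger0_norm (_ : 0 <= `|a2|)) // => am.
  have am2 : a2 ^+ 2 <= mu ^+ 2.
    rewrite -(real_normK (num_real a2)) -(real_normK (num_real mu)) lerXn2r ?nnegrE //.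
    by move: am; rewrite normr_id => am; apply: le_trans am (ler_norm _).
  have dy : d ^+ 2 < y ^+ 2 by rewrite ltrXn2r ?nnegrE //; lra.
  have yl : 0 < y * lambda by rewrite mulr_gt0 //; lra.
  set X := x - a1.
  rewrite -subr_gt0 [X in 0 < X](_ : _ = 8 * (y * lambda) * (X ^+ 2 + (y ^+ 2 + lambda ^+ 2 - a2 ^+ 2))); last first.
    by rewrite /X; ring.
  rewrite mulr_gt0 //; first by rewrite mulr_gt0.
  have := sqr_ge0 X; lra.
have {s0} : (0 < size s)%N by case: (s) s0.
elim: s {fE sqE} fac => // a s IH fac _; rewrite !big_cons.
have ha := fac a; rewrite inE eqxx in ha; have {}ha := ha isT.
case: s IH fac => [|b s] IH fac; first by rewrite !big_nil !mulr1.
apply: ltr_pM => //; rewrite ?mulr_ge0 ?nc_ge0 //.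
  by apply: prodr_ge0 => k _; rewrite mulr_ge0 ?nc_ge0.
by apply: IH => // k sk; apply: fac; rewrite inE sk orbT.
Qed.

(** The multiplier vanishes for k > n.+1, so only those coefficients survive that Cauchy's estimate
    on a fixed disc controls; for fixed k it tends to 1 as n grows. *)
Definition jensen (n : nat) p : {poly R[i]} := \poly_(k < n.+2) ((ffact_ratio R n.+1 k)%:C * p`_k).

Lemma coef_jensen n p k : (jensen n p)`_k = (ffact_ratio R n.+1 k)%:C * p`_k.
Proof.
rewrite coef_poly; case: ltnP => // h.
by rewrite ffact_ratio_small ?mul0r.
Qed.

(** The multipliers at k + 1 and k have ratio 1 - k/(n+1), so multiplying p by X sends the transform
    g to X g - X^2 g'/(n+1). This recursion drives the induction over the roots. *)
Lemma jensen_XsubC n p (a : R[i]) : jensen n (('X - a%:P) * p) =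
  'X * jensen n p - (n.+1%:R^-1)%:P * 'X^2 * (jensen n p)^`() - a%:P * jensen n p.
Proof.
apply/polyP => k; rewrite !coefB -mulrA !coefCM !coefXnM coefXM !coef_jensen mulrBl coefB coefXM coefCM.
case: k => [|[|k]] /=.
- by rewrite ffact_ratio0; ring.
- rewrite ffact_ratioS ffact_ratio0 !rmorphM; ring.
have phiE : (ffact_ratio R n.+1 k.+2)%:C =
    (ffact_ratio R n.+1 k.+1)%:C * (1 - k.+1%:R / n.+1%:R) :> R[i].
  rewrite ffact_ratioS rmorphM; congr (_ * _).
  by rewrite rmorphB rmorphM fmorphV /= !rmorph_nat rmorph1.
rewrite coef_deriv coef_jensen !subSS subn0 phiE.
by move: (ffact_ratio R n.+1 k.+1)%:C => phi; ring.
Qed.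

Lemma jensen_scale n p (a : R[i]) : jensen n (a *: p) = a *: jensen n p.
Proof. by apply/polyP => k; rewrite coefZ !coef_jensen coefZ; ring. Qed.

(* With g of degree at most n and roots b_j, the equation
   (w - a) g(w) = w^2 g'(w) / n reads  mean_j (- w b_j / (w - b_j)) = a  (a missing
   root being counted as b = oo), and the left side has Im <= 0 for Im w <= 0. *)
Lemma jensen_no_root n p : p != 0 -> (forall a, root p a -> 0 < complex.Im a) ->
  forall a, root (jensen n p) a -> 0 < complex.Im a.
Proof.
move=> p0 hp; have [s pE] := poly_split p.
have {hp} hs a : a \in s -> 0 < complex.Im a by move=> /(root_in p0 pE); exact: hp.
have c0 : lead_coef p != 0 by rewrite lead_coef_eq0.
rewrite pE jensen_scale => a; rewrite rootZ // => {c0 pE p0} {p}.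
elim: s hs a => [|b s IH] hs a.
  rewrite big_nil rootE (_ : jensen n 1 = 1) ?hornerE ?oner_eq0 //.
  apply/polyP => k; rewrite coef_jensen !coefC; case: k => [|k]; last by rewrite mulr0.
  by rewrite ffact_ratio0 mulr1.
have {}IH := IH (fun c sc => hs c (mem_behead (s := b :: s) sc)).
have b0 : 0 < complex.Im b by apply: hs; rewrite inE eqxx.
rewrite big_cons jensen_XsubC; set g := jensen n _ in IH *.
rewrite ltNge; apply: contraTN => a0.
have ga : g.[a] != 0.
  by apply/negP => h; have := IH a; rewrite rootE => /(_ h); rewrite ltNge a0.
have g0 : g != 0 by apply: contraNneq ga => ->; rewrite horner0.
have [t gE] := poly_split g; have at_ := root_notin gE ga.
have tn : (size t <= n.+1)%N.
  have : (size g <= n.+2)%N by exact: size_poly.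
  by rewrite {1}gE size_scale ?lead_coef_eq0 // size_prod_XsubC ltnS.
rewrite rootE !(hornerD, hornerN, hornerM, hornerC, hornerX, hornerXn); apply/negP => /eqP E.
pose S := \sum_(c <- t) (a - c)^-1.
have dg : g^`().[a] = g.[a] * S.
  by rewrite gE derivZ !hornerZ deriv_prod_XsubC // mulrA.
have n0 : n.+1%:R != 0 :> R[i] by rewrite pnatr_eq0.
have E2 : n.+1%:R * a - a ^+ 2 * S - n.+1%:R * b = 0.
  apply: (mulfI ga); rewrite mulr0 -[RHS](mulr0 n.+1%:R) -E dg.
  by field.
have SE : a ^+ 2 * S = \sum_(c <- t) (a + a * c / (a - c)).
  rewrite /S mulr_sumr big_seq [RHS]big_seq; apply: eq_bigr => c tc.
  have ac : a - c != 0 by rewrite subr_eq0; apply: contraNneq at_ => ->.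
  by field.
have hc c : c \in t -> 0 <= complex.Im (a * c / (a - c)).
  move=> tc; have c0 := IH c (root_in g0 gE tc).
  suff : complex.Im (- (a * c) / (a - c)) <= 0 by rewrite mulNr ImN oppr_le0.
  apply: Im_div_le0.
  rewrite [X in X <= 0](_ : _ = - nc a ^+ 2 * complex.Im c + nc c ^+ 2 * complex.Im a); last first.
    by rewrite !sqr_nc; case: (a) (c) => [x y] [x' y'] /=; ring.
  have h1 := mulr_ge0 (sqr_ge0 (nc a)) (ltW c0).
  have h2 := mulr_ge0_le0 (sqr_ge0 (nc c)) a0.
  lra.
have SE2 : a ^+ 2 * S = (size t)%:R * a + \sum_(c <- t) a * c / (a - c).
  by rewrite SE big_split /= big_const_seq count_predT iter_addr_0 mulr_natl.
have : complex.Im (n.+1%:R * a - a ^+ 2 * S - n.+1%:R * b) < 0; last by rewrite E2 /= ltxx.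
(* The degree deficit contributes a multiple of a, with imaginary part <= 0; all three groups have
   the same sign and b makes the total strictly negative. *)
have -> : n.+1%:R * a - a ^+ 2 * S - n.+1%:R * b =
   (n.+1 - size t)%N%:R * a - \sum_(c <- t) a * c / (a - c) - n.+1%:R * b.
  by rewrite SE2 natrB //; ring.
rewrite !ImD !ImN Im_sum; have ImMn m w : complex.Im (m%:R * w) = m%:R * complex.Im w.
  by rewrite -(rmorph_nat (real_complex R)) ImM /= mul0r addr0.
rewrite !ImMn; have h1 : 0 < n.+1%:R * complex.Im b by rewrite mulr_gt0 // ltr0n.
have h2 : (n.+1 - size t)%N%:R * complex.Im a <= 0 by rewrite mulr_ge0_le0.
have h3 : 0 <= \sum_(c <- t) complex.Im (a * c / (a - c)).
  by rewrite big_seq; apply: sumr_ge0 => c tc; exact: hc.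
lra.
Qed.

End ZeroGeometry.

(** * The symmetrised operator on real polynomials *)

Section StripOperator.
Variable R : realType.
Implicit Types (z w : R[i]) (x y r e : R) (p q : {poly R[i]}).

Lemma derive1n_poly k q z : derive1n k (horner q) z = q^`(k).[z].
Proof.
have h := is_taylor_derive1n (k := k) (@poly_is_taylor _ q).
rewrite (_ : (fun j => _) = fun j => q^`(k)`_j) in h.
  exact: cvg_unique_nc (h z) (@poly_is_taylor _ q^`(k) z).
by apply/funext => j; rewrite coef_derivn mulr_natl addnC.
Qed.

Lemma derivn_eq0 q k : (size q <= k)%N -> q^`(k) = 0.
Proof.
move=> h; apply/polyP => j; rewrite coef_derivn nth_default ?mul0rn ?coef0 //.
exact: leq_trans h (leq_addr _ _).
Qed.

Lemma diffop_partial_poly_cvg (c : nat -> R[i]) q z :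
  diffop_partial c (horner q) n z @[n --> \oo] --> \sum_(k < size q) c k * q^`(k).[z].
Proof.
apply/cvg_ncP => e e0; near=> n.
have nq : (size q <= n)%N by near: n; exact: nbhs_infty_ge.
suff -> : diffop_partial c (horner q) n z = \sum_(k < size q) c k * q^`(k).[z].
  by rewrite subrr nc0.
rewrite /diffop_partial (big_ord_widen n (fun k => c k * q^`(k).[z]) nq) [RHS]big_mkcond.
apply: eq_bigr => k _; rewrite derive1n_poly; case: ltnP => // h.
by rewrite derivn_eq0 // horner0 mulr0.
Unshelve. all: by end_near. Qed.

Lemma diffop_poly (c : nat -> R[i]) q z :
  diffop c (horner q) z = \sum_(k < size q) c k * q^`(k).[z].
Proof. by apply: cvg_lim; [exact: norm_hausdorff|exact: diffop_partial_poly_cvg]. Qed.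

Lemma derivn_shift q (c : R[i]) k : (q \Po ('X + c%:P))^`(k) = q^`(k) \Po ('X + c%:P).
Proof.
elim: k => [|k IH]; first by rewrite !derivn0.
by rewrite !derivnS IH deriv_comp derivD derivX derivC addr0 mulr1.
Qed.

Lemma horner_derivn_shift q (c : R[i]) j z : q^`(j).[z + c] =
  \sum_(l < size q) c ^+ l / l`!%:R * q^`(j + l).[z].
Proof.
rewrite (@nderiv_taylor_wide _ (size q)); last 2 first.
- exact: mulrC.
- by apply/leq_sizeP => i qi; rewrite coef_derivn nth_default ?mul0rn // (leq_trans qi) // leq_addl.
apply: eq_bigr => l _.
have -> : q^`(j + l) = q^`(j)^`N(l) *+ l`! by rewrite -nderivn_def /derivn addnC iterD.
rewrite hornerMn -mulr_natr; field.
by rewrite pnatr_eq0 -lt0n fact_gt0.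
Qed.

(** Composition of two operators regrouped by total order; the vanishing of [D] from M on and of [u]
    from N on lets both ranges be extended or cut freely. *)
Lemma sum_conv (u v D : nat -> R[i]) M N : (forall k, (M <= k)%N -> D k = 0) ->
  (forall j, (N <= j)%N -> u j = 0) ->
  \sum_(j < N) u j * \sum_(l < M) v l * D (j + l)%N =
  \sum_(k < M) (\sum_(j < k.+1) u j * v (k - j)%N) * D k.
Proof.
move=> DM uN.
transitivity (\sum_(j < M) u j * \sum_(l < M) v l * D (j + l)%N).
  pose T j := u j * \sum_(l < M) v l * D (j + l)%N.
  have T1 j : (M <= j)%N -> T j = 0.
    move=> Mj; rewrite /T big1 ?mulr0 // => l _; rewrite DM ?mulr0 //.
    exact: leq_trans Mj (leq_addr _ _).
  have T2 j : (N <= j)%N -> T j = 0 by move=> Nj; rewrite /T uN // mul0r.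
  rewrite -/(T _) (big_ord_widen (M + N) T (leq_addl _ _)) [RHS](big_ord_widen (M + N) T (leq_addr _ _)).
  rewrite big_mkcond [RHS]big_mkcond; apply: eq_bigr => j _.
  case: ltnP => h1; first by case: ltnP => [h2|/T1 ->].
  by case: ltnP => [h2|//]; rewrite T2.
symmetry; transitivity (\sum_(k < M) \sum_(j < M | (j <= k)%N) u j * v (k - j)%N * D k).
  apply: eq_bigr => k _; rewrite mulr_suml.
  by rewrite (big_ord_widen M (fun j => u j * v (k - j)%N * D k)) ?ltn_ord.
rewrite (exchange_big_dep xpredT) //=; apply: eq_bigr => j _.
rewrite -(big_mkord (fun k => (j <= k)%N) (fun k => u j * v (k - j)%N * D k)).
rewrite (big_cat_nat (n := j)) ?(ltnW (ltn_ord j)) //=.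
rewrite big_nat_cond big1 ?add0r; last by move=> k /andP[/andP[_ kj] jk]; move: kj; rewrite ltnNge jk.
rewrite -{1}[nat_of_ord j]add0n big_addn mulr_sumr.
rewrite -(big_mkord xpredT (fun l => u j * (v l * D (j + l)%N))).
rewrite [RHS](big_cat_nat (n := M - j)) ?leq_subr //= [X in _ = _ + X]big_nat_cond [X in _ = _ + X]big1 ?addr0.
  apply: congr_big_nat => // l _; rewrite ?leq_addl // addnK addnC mulrA //.
by move=> l /andP[/andP[h _] _]; rewrite DM ?mulr0 // -leq_subLR.
Qed.

(** Coefficients of U(w) e^(cw) for U with coefficients [u]. As e^(cD) is translation by c, they
    describe U(D) applied to q(. + c). *)
Definition exp_conv (u : nat -> R[i]) (c : R[i]) (k : nat) : R[i] :=
  \sum_(j < k.+1) u j * (c ^+ (k - j) / (k - j)`!%:R).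

Lemma horner_polyD_shift p q (c : R[i]) z :
  (polyD p (q \Po ('X + c%:P))).[z] = \sum_(k < size q) exp_conv (fun j => p`_j) c k * q^`(k).[z].
Proof.
rewrite /exp_conv -(@sum_conv (fun j => p`_j) (fun l => c ^+ l / l`!%:R) (fun k => q^`(k).[z]) _ (size p)).
- rewrite /polyD horner_sum; apply: eq_bigr => j _.
  by rewrite hornerZ derivn_shift horner_comp !hornerE horner_derivn_shift.
- by move=> k h; rewrite derivn_eq0 // horner0.
- by move=> j h; rewrite nth_default.
Qed.

Lemma conj_polyK p : conj_poly (conj_poly p) = p.
Proof. by rewrite /conj_poly -map_poly_comp map_poly_id // => x _ /=; rewrite conjcK. Qed.

Lemma real_poly_conj p z : conj_poly p = p -> p.[z^*%C] = (p.[z])^*%C.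
Proof. by move=> h; rewrite -{1}h horner_conj_poly conjcK. Qed.

(** Let G be p(D) applied to q(. + i lambda). Since q is real, G* comes from the conjugate
    coefficients, so the symmetrised operator sends q to G + G*. *)
Lemma strip_operator (mu lambda d : R) p q : 0 <= d -> 0 < lambda ->
  mu ^+ 2 <= d ^+ 2 + lambda ^+ 2 -> p != 0 -> (forall a, root p a -> 0 < complex.Im a) ->
  (1 < size q)%N -> conj_poly q = q -> zeros_in_strip mu q ->
  let b := exp_conv (fun j => p`_j) ('i%C * lambda%:C) in
  exists S : {poly R[i]}, [/\ zeros_in_strip d S, conj_poly S = S &
    forall z, S.[z] = diffop (fun k => b k + (b k)^*%C) (horner q) z].
Proof.
move=> d0 l0 mdl p0 hp q1 qR hq b.
pose G := polyD p (q \Po ('X + ('i%C * lambda%:C)%:P)).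
exists (G + conj_poly G); split.
- apply: dominates_conj_strip => //; apply: polyD_dominates_conj => //.
  exact: (@shift_dominates_conj _ mu).
- by rewrite {1}/conj_poly rmorphD /= -!/(conj_poly _) conj_polyK addrC.
move=> z; rewrite diffop_poly hornerD horner_conj_poly !horner_polyD_shift -/b.
rewrite rmorph_sum -big_split /=; apply: eq_bigr => k _.
rewrite mulrDl rmorphM /=; congr (_ + _ * _).
rewrite real_poly_conj ?conjcK // /conj_poly -derivn_map -/(conj_poly q) qR //.
Qed.

End StripOperator.

(** * Approximation of the symbol with uniform coefficient bounds *)

Section OperatorApproximation.
Variable R : realType.
Implicit Types (z w : R[i]) (x y r e : R) (p q : {poly R[i]}).

Lemma poly_bounded p r : exists2 M, 0 <= M & forall z, nc z <= r -> nc p.[z] <= M.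
Proof.
have [M M0 hM] := is_taylor_bounded (2 * `|r|) (@poly_is_taylor _ p).
exists (2 * M); first by rewrite mulr_ge0.
move=> z zr; apply: (is_taylor_le (@poly_is_taylor _ p) (normr_ge0 r) hM).
exact: le_trans zr (ler_norm _).
Qed.

Lemma poly_shift_cvg p r e : 0 < e -> exists2 t, 0 < t &
  forall z u, nc z <= r -> nc u <= t -> nc (p.[z + u] - p.[z]) < e.
Proof.
move=> e0; have hM i : exists M, 0 <= M /\ forall z, nc z <= r -> nc (p^`N(i)).[z] <= M.
  by have [M M0 hM] := poly_bounded p^`N(i) r; exists M.
have [M {}hM] := choice hM.
pose S := \sum_(i < size p) M i; have S0 : 0 <= S by apply: sumr_ge0 => i _; exact: (hM i).1.
pose t := Num.min 1 (e / (S + 1)).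
have S1 : 0 < S + 1 by lra.
have t0 : 0 < t by rewrite /t lt_min ltr01 divr_gt0.
have t1 : t <= 1 by rewrite /t ge_min lexx.
have tS : t * (S + 1) <= e by rewrite -ler_pdivlMr // /t ge_min lexx orbT.
exists t => // z u zr ut.
have [->|p0] := eqVneq p 0; first by rewrite !horner0 subrr nc0.
rewrite nderiv_taylor; last exact: mulrC.
case sE : (size p) => [|n]; first by move/eqP: sE; rewrite size_poly_eq0 (negPf p0).
rewrite big_ord_recl /= nderivn0 expr0 mulr1 addrC addKr.
apply: le_lt_trans (nc_sum _ _ _) _.
apply: (@le_lt_trans _ _ (t * S)); last by lra.
rewrite /S sE big_ord_recl /= mulrDr mulr_sumr.
apply: (@le_trans _ _ (\sum_(i < n) t * M (lift ord0 i))).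
  apply: ler_sum => i _; rewrite ncM ncX mulrC; apply: ler_pM; rewrite ?nc_ge0 ?exprn_ge0 ?nc_ge0 //.
    rewrite /= /bump leq0n add1n exprS -[leRHS]mulr1; apply: ler_pM; rewrite ?nc_ge0 ?exprn_ge0 ?nc_ge0 //.
    by rewrite exprn_ile1 ?nc_ge0 //; lra.
  exact: (hM _).2.
by rewrite lerDr mulr_ge0 ?(ltW t0) //; exact: (hM _).1.
Qed.

(** Approximants may have real zeros, whereas D - a is controlled only for Im a > 0; a small upward
    translation makes the zeros strict and changes little on a disc. *)
Lemma Pbar_strict (h : R[i] -> R[i]) : Pbar_lower h -> forall r e, 0 < e ->
  exists p, [/\ p != 0, forall a, root p a -> 0 < complex.Im a &
    forall z, nc z <= r -> nc (p.[z] - h z) < e].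
Proof.
move=> /compact_closureP hP r e e0; have e2 : 0 < e / 2 by rewrite divr_gt0.
have [p hp pE] := hP r _ e2; have [t t0 ht] := poly_shift_cvg p r e2.
have nr z : complex.Im z < t -> ~~ root (p \Po ('X - ('i%C * t%:C)%:P)) z.
  move=> zt; rewrite /root horner_comp !hornerE -/(root _ _); apply: hp.
  by rewrite ImD ImN ImM /= !(mul0r, mul1r, add0r); lra.
exists (p \Po ('X - ('i%C * t%:C)%:P)); split.
- have /nr : complex.Im (0 : R[i]) < t by [].
  by apply: contraNneq => ->; rewrite root0.
- move=> a ra; rewrite ltNge; apply/negP => a0; have /nr : complex.Im a < t by lra.
  by rewrite ra.
move=> z zr; rewrite horner_comp !hornerE.
have -> : p.[z - 'i%C * t%:C] - h z = (p.[z - 'i%C * t%:C] - p.[z]) + (p.[z] - h z) by ring.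
have nt : nc (- ('i%C * t%:C)) <= t.
  by rewrite ncN ncM ncR gtr0_norm //= expr0n add0r expr1n sqrtr1 mul1r.
apply: le_lt_trans (ncD _ _) _; have := ht z _ zr nt; have := pE z zr; lra.
Qed.

Lemma cvgc0_bounded (u v : nat -> R[i]) M : (\forall n \near \oo, nc (u n) <= M) ->
  v @ \oo --> (0 : R[i]) -> (fun n => u n * v n) @ \oo --> (0 : R[i]).
Proof.
move=> uM /cvg_ncP v0; apply/cvg_ncP => e e0.
have M1 : 0 < `|M| + 1 by rewrite ltr_wpDl.
have eM : 0 < e / (`|M| + 1) by rewrite divr_gt0.
apply: filterS2 uM (v0 _ eM) => n h1; rewrite !subr0 ncM ltr_pdivlMr // mulrC => h2.
apply: le_lt_trans h2; apply: ler_wpM2r; first exact: nc_ge0.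
by apply: le_trans h1 _; have := ler_norm M; lra.
Qed.

Lemma cvgc_real (u : nat -> R) (l : R) : u @ \oo --> l -> (fun n => (u n)%:C) @ \oo --> l%:C.
Proof.
move=> /cvgrPdist_lt h; apply/cvg_ncP => e e0; apply: filterS (h _ e0) => n.
by rewrite -rmorphB ncR distrC.
Qed.

Lemma cvgcX (u : nat -> R[i]) (l : R[i]) k : u @ \oo --> l -> (fun n => u n ^+ k) @ \oo --> l ^+ k.
Proof.
move=> ul; elim: k => [|k IH]; first exact: (cvgc_cst 1).
rewrite exprS (_ : (fun n => _) = fun n => u n * u n ^+ k); first exact: (cvgcM ul IH).
by apply/funext => n; rewrite exprS.
Qed.

Definition compound_poly (c : R[i]) (n : nat) : {poly R[i]} := (1 + (c / n.+1%:R) *: 'X) ^+ n.+1.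

Lemma horner_compound_poly c n z : (compound_poly c n).[z] = (1 + (c * z) / n.+1%:R) ^+ n.+1.
Proof. by rewrite horner_exp !hornerE mulrAC. Qed.

Lemma coef_compound_poly c n l : (compound_poly c n)`_l =
  (ffact_ratio R n.+1 l)%:C * (c ^+ l / l`!%:R).
Proof.
rewrite /compound_poly exprDn coef_sum.
have n0 : n.+1%:R != 0 :> R[i] by rewrite pnatr_eq0.
have l0 : l`!%:R != 0 :> R[i] by rewrite pnatr_eq0 -lt0n fact_gt0.
have E (i : 'I_n.+2) : (1 ^+ (n.+1 - i) * ((c / n.+1%:R) *: 'X) ^+ i *+ 'C(n.+1, i))`_l =
   if l == i then (c / n.+1%:R) ^+ l *+ 'C(n.+1, l) else 0.
  rewrite expr1n mul1r exprZn coefMn coefZ coefXn.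
  by case: eqP => [->|_]; rewrite ?mulr1 // mulr0 mul0rn.
under eq_bigr do rewrite E.
have [ln|nl] := ltnP l n.+2; last first.
  rewrite ffact_ratio_small // mul0r big1 // => i _; case: eqP => // li.
  by have := ltn_ord i; rewrite -li ltnNge nl.
rewrite (bigD1 (Ordinal ln)) //= eqxx big1 ?addr0; last first.
  by move=> i; rewrite -val_eqE /= eq_sym => /negPf ->.
rewrite /ffact_ratio -bin_ffact natrM rmorphM fmorphV rmorphXn rmorphM /= !rmorph_nat.
rewrite -mulr_natr expr_div_n; field; rewrite l0 expf_neq0 //.
Qed.

Lemma operator_approximation (h : R[i] -> R[i]) (a_ : nat -> R[i]) (gamma lambda y : R) h1 :
  Pbar_lower h -> is_taylor a_ (fun w => h w * cexp ('i%C * lambda%:C * w)) ->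
  0 <= gamma -> genus_le 1 h1 ->
  (forall w, h w = cexp (- (gamma%:C * w ^+ 2)) * h1 w) ->
  0 <= lambda -> 2 * gamma < y ->
  exists (p : nat -> {poly R[i]}) (B : R),
    let b n := exp_conv (fun j => (p n)`_j) ('i%C * (lambda + n.+1%:R^-1)%:C) in
    [/\ 0 <= B, forall n, p n != 0, forall n a, root (p n) a -> 0 < complex.Im a,
      forall n k, nc (b n k) <= B * rho y k & forall k, b n k @[n --> \oo] --> a_ k].
Proof.
move=> hP hT g0 gh hE l0 gy.
(* gamma < k1 < k2 < y/2: the first gap absorbs the growth of h1, the second the polynomial factor
   in the coefficient bounds, the third the convolution with the exponential. *)
pose k1 := (3 * gamma + y / 2) / 4; pose k2 := (gamma + y / 2) / 2.
have gk1 : gamma < k1 by rewrite /k1; lra.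
have k1k2 : k1 < k2 by rewrite /k1 /k2; lra.
have k2y : 2 * k2 < y by rewrite /k2; lra.
have k10 : 0 < k1 by lra.
have [C C0 hC] := gaussian_growth g0 gk1 gh hE.
have [B B0 hB] := growth_coef_bound k10 k1k2 C0 hC.
have L0 : 0 <= lambda + 1 by lra.
have k20 : 0 < 2 * k2 by lra.
have [D D0 hD] := rho_conv k20 k2y L0.
(* One approximant serves two purposes: accuracy 1/(n+1) on the unit disc yields the limits of the
   coefficients, accuracy 1 on the disc of radius r bounds the coefficients up to n.+1. *)
have hP' n : exists p, [/\ p != 0, forall a, root p a -> 0 < complex.Im a,
    forall z, nc z <= 1 -> nc (p.[z] - h z) < n.+1%:R^-1 &
    forall k, (k <= n.+1)%N -> nc p`_k <= B * rho (2 * k2) k].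
  have [r r0 hr] := hB n.+1.
  have n1 : 0 < n.+1%:R^-1 :> R by rewrite invr_gt0.
  have [p [p0 pr ph]] := Pbar_strict hP (r + 1) n1.
  exists p; split => //; first by move=> z z1; apply: ph; lra.
  move=> k kn; apply: hr => // z zr; apply: lt_le_trans (ph z _) _; first lra.
  by rewrite invf_le1 // ler1n.
have [P {}hP'] := choice hP'.
have P1 n := let: And4 h1 _ _ _ := hP' n in h1.
have P2 n := let: And4 _ h1 _ _ := hP' n in h1.
have P3 n := let: And4 _ _ h1 _ := hP' n in h1.
have P4 n := let: And4 _ _ _ h1 := hP' n in h1.
pose p n := jensen n (P n).
have ln n : lambda <= lambda + n.+1%:R^-1 <= lambda + 1.
  by rewrite lerDl invr_ge0 ler0n lerD2l invf_le1 ?ler1n.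
exists p, (D * B); split.
- by rewrite mulr_ge0.
- move=> n; apply: contraNneq (P1 n) => pn0; apply/eqP.
  have : (jensen n (P n))`_0 = 0 by rewrite -/(p n) pn0 coef0.
  rewrite coef_jensen ffact_ratio0 mul1r => P0.
  by have : root (P n) 0; [rewrite rootE horner_coef0 P0|move/P2; rewrite /= ltxx].
- by move=> n; exact: jensen_no_root (P1 n) (P2 n).
- move=> n k; apply: (hD (fun j => (p n)`_j) (fun l => ('i%C * (lambda + n.+1%:R^-1)%:C) ^+ l / l`!%:R)) => //.
    move=> j; rewrite coef_jensen ncM ncR ger0_norm ?ffact_ratio_ge0 //.
    have [jn|nj] := leqP j n.+1; last by rewrite ffact_ratio_small // mul0r mulr_ge0 ?rho_ge0.
    rewrite -[leRHS]mul1r; apply: ler_pM; rewrite ?nc_ge0 ?ffact_ratio_ge0 ?ffact_ratio_le1 //.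
    exact: P4.
  move=> l; rewrite ncM ncX ncV ncM_nat; apply: ler_wpM2r; first by rewrite invr_ge0.
  have /andP[h2 h3] := ln n.
  rewrite ncM ncR /= expr0n add0r expr1n sqrtr1 mul1r.
  have hl : `|lambda + n.+1%:R^-1| <= lambda + 1 by rewrite ger0_norm // (le_trans l0).
  exact: lerXn2r.
move=> k; pose c : R[i] := 'i%C * lambda%:C.
have nc_c : nc c = lambda by rewrite ncM ncR /= expr0n add0r expr1n sqrtr1 mul1r ger0_norm.
(* The coefficients of [Q n] tend to those of h(w) e^(i lambda w) by Cauchy's estimate on the unit
   disc. The difference from the coefficients of the actual symbol is a finite sum over j <= k,
   where bounded [(P n)_j] multiply corrections [V j n] tending to 0. *)
pose Q n := P n * compound_poly c n.
pose K := C * expR k1.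
have K0 : 0 <= K by rewrite mulr_ge0 ?expR_ge0.
pose A := 6 * lambda ^+ 2 * expR lambda.
have A0 : 0 <= A by rewrite !mulr_ge0 ?expR_ge0 ?sqr_ge0.
have QE : (fun n => (Q n)`_k) @ \oo --> a_ k.
  apply/cvg_ncP => e e0; pose T := (expR lambda + A) + K * A.
  have hT0 := @cvg_harmonicZ R T.
  have T1 : \forall n \near \oo, T / n.+1%:R < e.
    move/cvgrPdist_lt : hT0 => /(_ _ e0); apply: filterS => n.
    by rewrite sub0r normrN; apply: le_lt_trans; exact: ler_norm.
  near=> n; have n1 : 0 < n.+1%:R :> R by rewrite ltr0n.
  have hn : T / n.+1%:R < e by near: n.
  have l2n : 2 * lambda <= n.+1%:R.
    apply: (@le_trans _ _ n%:R); last by rewrite ler_nat.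
    by near: n; exact: nbhs_infty_ger.
  apply: le_lt_trans hn.
  have := @cauchy_estimate _ _ _ 1 (T / n.+1%:R) (is_taylorB (@poly_is_taylor _ (Q n)) hT) ler01.
  move=> /(_ _ k); rewrite expr1n mulr1; apply => z z1.
  rewrite hornerM horner_compound_poly.
  have cz : nc (c * z) <= lambda by rewrite ncM nc_c ler_piMr.
  have h2 : nc ((1 + c * z / n.+1%:R) ^+ n.+1 - cexp (c * z)) <= A / n.+1%:R.
    apply: le_trans (compound_cexp _) _; first by apply: le_trans l2n; lra.
    rewrite ler_pM2r ?invr_gt0 //; apply: ler_pM; rewrite ?expR_ge0 ?ler_expR //.
      by rewrite mulr_ge0 ?sqr_ge0.
    by rewrite ler_pM2l // lerXn2r ?nnegrE ?nc_ge0.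
  have h3 : nc (cexp (c * z)) <= expR lambda.
    by apply: le_trans (nc_cexp_le _) _; rewrite ler_expR.
  have h4 : nc (h z) <= K.
    apply: le_trans (hC z) _; apply: ler_wpM2l => //; rewrite ler_expR.
    by rewrite ler_piMr ?(ltW k10) // exprn_ile1 ?nc_ge0.
  set E := (1 + c * z / n.+1%:R) ^+ n.+1 in h2 *; set X := cexp (c * z) in h2 h3 *.
  have -> : (P n).[z] * E - h z * X = ((P n).[z] - h z) * E + h z * (E - X) by ring.
  apply: le_trans (ncD _ _) _; rewrite !ncM.
  have h5 : nc E <= expR lambda + A.
    have := ncD (E - X) X; rewrite subrK => h5; apply: le_trans h5 _.
    rewrite addrC; apply: lerD => //; apply: le_trans h2 _.
    by rewrite ler_pdivrMr // ler_peMr // ler1n.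
  rewrite /T [leRHS]mulrDl; apply: lerD.
    by rewrite mulrC; apply: ler_pM; rewrite ?nc_ge0 // ltW // P3.
  by rewrite -[leRHS]mulrA; apply: ler_pM; rewrite ?nc_ge0.
rewrite -[a_ k]addr0.
pose dn n := exp_conv (fun j => (p n)`_j) ('i%C * (lambda + n.+1%:R^-1)%:C) k - (Q n)`_k.
rewrite (_ : (fun n => _) = fun n => (Q n)`_k + dn n); last first.
  by apply/funext => n; rewrite /dn addrCA subrr addr0.
apply: (cvgcD QE).
pose cn n : R[i] := 'i%C * (lambda + n.+1%:R^-1)%:C.
pose V (j : nat) n := (ffact_ratio R n.+1 j)%:C * (cn n ^+ (k - j) / (k - j)`!%:R) -
   (ffact_ratio R n.+1 (k - j))%:C * (c ^+ (k - j) / (k - j)`!%:R).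
have -> : dn = fun n => \sum_(j < k.+1) (P n)`_j * V j n.
  apply/funext => n; rewrite /dn /exp_conv /Q coefM -sumrB; apply: eq_bigr => j _.
  by rewrite coef_jensen coef_compound_poly /V -/c -/(cn n); ring.
have cnl : cn @ \oo --> c.
  apply: (cvgcM (cvgc_cst 'i%C)); apply: cvgc_real; rewrite -[X in _ --> X]addr0.
  by apply: cvgD; [exact: cvg_cst|exact: cvg_harmonic].
have fl j : (fun n => (ffact_ratio R n.+1 j)%:C) @ \oo --> (1 : R[i]).
  exact: cvgc_real (@ffact_ratio_cvg R j).
suff H (j : 'I_k.+1) : (fun n => (P n)`_j * V j n) @ \oo --> (0 : R[i]).
  have S0 : \sum_(j < k.+1) (0 : R[i]) = 0 by rewrite big1.
  have hs := @cvgc_sum R nat \oo eventually_filter _ (index_enum 'I_k.+1) (fun j n => (P n)`_j * V j n) (fun=> 0) H.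
  rewrite S0 in hs; exact hs.
apply: (@cvgc0_bounded _ _ (B * rho (2 * k2) j)).
  near=> n; apply: P4; apply: leq_trans (_ : k <= _)%N; first by rewrite -ltnS ltn_ord.
  by near: n; exists k => // n /= kn; exact: leqW.
have h6 := cvgcB (cvgcM (fl j) (cvgcM (cvgcX (k := (k - j)%N) cnl) (cvgc_cst (k - j)`!%:R^-1)))
  (cvgcM (fl (k - j)%N) (cvgc_cst (c ^+ (k - j) / (k - j)`!%:R))).
rewrite subrr in h6; exact (h6 _ _ _ _ _ _).
Unshelve. all: by end_near. Qed.

End OperatorApproximation.

(** * Relative errors and Gaussian factors *)

Section Closeness.
Variable R : realType.
Implicit Types (z w u v r : R[i]) (x y e : R).

(** A relative error measured by the second argument: it passes through products without bounds on
    the factors, and being non-strict it survives limits; b = 0 forces a = 0. *)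
Definition close e (a b : R[i]) : Prop := nc (a - b) <= e * nc b.

Lemma close_le e e' a b : e <= e' -> close e a b -> close e' a b.
Proof. by move=> ee h; apply: le_trans h _; rewrite ler_wpM2r // nc_ge0. Qed.

Lemma close_trans e e' a b c : 0 <= e -> close e a b -> close e' b c -> close (e + e' + e * e') a c.
Proof.
rewrite /close => e0 h1 h2; have -> : a - c = (a - b) + (b - c) by ring.
apply: le_trans (ncD _ _) _.
have h3 : nc b <= (1 + e') * nc c.
  by have := ncD (b - c) c; rewrite subrK => h3; apply: le_trans h3 _; lra.
have := ler_wpM2l e0 h3; lra.
Qed.

Lemma closeM e e' a b a' b' : 0 <= e -> close e a b -> close e' a' b' ->
  close (e + e' + e * e') (a * a') (b * b').
Proof.
rewrite /close => e0 h1 h2; have -> : a * a' - b * b' = (a - b) * (a' - b') + (a - b) * b' + b * (a' - b') by ring.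
apply: le_trans (ncD _ _) _; apply: le_trans (lerD (ncD _ _) (lexx _)) _; rewrite !ncM.
have h3 : nc (a - b) * nc (a' - b') <= (e * nc b) * (e' * nc b') by apply: ler_pM; rewrite ?nc_ge0.
have h4 := ler_wpM2r (nc_ge0 b') h1; have h5 := ler_wpM2l (nc_ge0 b) h2.
lra.
Qed.

Lemma closeMl e a b c : close e a b -> close e (c * a) (c * b).
Proof. by rewrite /close -mulrBr !ncM mulrCA => h; rewrite ler_wpM2l // nc_ge0. Qed.

Lemma close_sym e a b : 0 <= e -> e <= 1 / 2 -> close e a b -> close (2 * e) b a.
Proof.
rewrite /close => e0 e2 h; have b0 := nc_ge0 b; have := ncD (b - a) a; rewrite subrK (nc_sub b) => h2.
have h3 : e * nc b <= 1 / 2 * nc b by apply: ler_wpM2r.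
have h4 : nc b <= 2 * nc a by lra.
have := ler_wpM2l e0 h4; lra.
Qed.

Lemma close_nc e a b : close e a b -> (1 - e) * nc b <= nc a /\ nc a <= (1 + e) * nc b.
Proof.
rewrite /close => h; have := ncD (a - b) b; have := ncD (b - a) a.
by rewrite !subrK (nc_sub b a) => h1 h2; split; lra.
Qed.

Lemma close_cexp u : nc u <= 1 / 2 -> close (4 * nc u) (cexp u) 1.
Proof.
move=> u1; have h := cexp_second u1; rewrite /close nc1 mulr1.
have -> : cexp u - 1 = (cexp u - (1 + u)) + u by ring.
apply: le_trans (ncD _ _) _; have := nc_ge0 u; nra.
Qed.

Lemma prod_one_add (I : Type) (s : seq I) (x : I -> R[i]) :
  nc (\prod_(i <- s) (1 + x i) - 1) <= expR (\sum_(i <- s) nc (x i)) - 1.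
Proof.
elim: s => [|i s IH]; first by rewrite !big_nil expR0 !subrr nc0.
rewrite !big_cons expRD.
set P := \prod_(j <- s) _ in IH *; set S := \sum_(j <- s) _ in IH *.
have -> : (1 + x i) * P - 1 = (P - 1) + x i + x i * (P - 1) by ring.
apply: le_trans (ncD _ _) _; apply: le_trans (lerD (ncD _ _) (lexx _)) _; rewrite ncM.
have h1 := expR_ge1Dx (nc (x i)); have h2 := nc_ge0 (x i).
have h3 : 0 <= expR S - 1 by apply: le_trans IH; exact: nc_ge0.
have h4 := ler_wpM2l h2 IH; nra.
Qed.

(** The expansion log(1 + v) = v - v^2/2 + O(v^3) in exponential form: for u = v - v^2/2, the
    polynomial 1 + u + u^2/2 equals 1 + v up to third order. *)
Lemma log_factor v : nc v <= 1 / 4 ->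
  nc ((1 + v) * cexp (- (v - v ^+ 2 / 2)) - 1) <= 4 * expR 1 * nc v ^+ 3.
Proof.
move=> v1; have v0 := nc_ge0 v; set u := v - v ^+ 2 / 2.
have n2 : nc (2 : R[i]) = 2 by rewrite ncM_nat.
have nu : nc u <= 9 / 8 * nc v.
  by apply: le_trans (ncB _ _) _; rewrite ncM ncV ncX n2; nra.
have h := @cexp_third _ u; have {}h := h (_ : nc u <= 1 / 2); have {}h : nc (cexp u - (1 + u + u ^+ 2 / 2)) <= 2 * nc u ^+ 3 by apply: h; lra.
have -> : (1 + v) * cexp (- u) - 1 = - ((cexp u - (1 + u + u ^+ 2 / 2)) + (v ^+ 4 / 8 - v ^+ 3 / 2)) * cexp (- u).
  by rewrite -[X in _ - X = _](cexpN u) /u; field.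
rewrite (ncM _ (cexp _)) ncN.
have E : nc (cexp (- u)) <= expR 1.
  by apply: le_trans (nc_cexp_le _) _; rewrite ler_expR ncN; lra.
have n8 : nc (8 : R[i]) = 8 by rewrite ncM_nat.
have h2 : nc ((cexp u - (1 + u + u ^+ 2 / 2)) + (v ^+ 4 / 8 - v ^+ 3 / 2)) <= 4 * nc v ^+ 3.
  apply: le_trans (ncD _ _) _; apply: le_trans (lerD h (ncB _ _)) _.
  rewrite (ncM (v ^+ 4)) (ncM (v ^+ 3)) !ncV n2 n8 !ncX.
  have h3 : nc u ^+ 3 <= (9 / 8 * nc v) ^+ 3 by rewrite lerXn2r ?nnegrE ?nc_ge0 ?mulr_ge0 //; lra.
  have h4 : 0 <= nc v ^+ 3 by rewrite exprn_ge0.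
  have h5 : nc v ^+ 4 <= 1 / 4 * nc v ^+ 3 by rewrite exprS ler_wpM2r.
  rewrite exprMn in h3; lra.
rewrite [leRHS](_ : _ = 4 * nc v ^+ 3 * expR 1); last by ring.
by apply: ler_pM; rewrite ?nc_ge0.
Qed.

Definition gauss (S s u : R[i]) : R[i] := cexp (S * u - s * u ^+ 2 / 2).

Lemma gaussD S s S' s' u : gauss (S + S') (s + s') u = gauss S s u * gauss S' s' u.
Proof. by rewrite /gauss -cexpD; congr cexp; ring. Qed.

(** After the first two orders are removed the error is cubic, and sum |r|^3 <= eta sum |r|^2 <= eta
    C. Many small factors thus merge into one Gaussian although sum |r|^2 is merely bounded. *)
Lemma far_product (s : seq R[i]) (C eta : R) u : 0 <= eta ->
  (forall r, r \in s -> nc r <= eta) -> \sum_(r <- s) nc r ^+ 2 <= C -> nc u * eta <= 1 / 4 ->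
  close (expR (4 * expR 1 * (eta * C * nc u ^+ 3)) - 1) (\prod_(r <- s) (1 + u * r))
    (gauss (\sum_(r <- s) r) (\sum_(r <- s) r ^+ 2) u).
Proof.
move=> eta0 hs sC ue.
have gE : gauss (\sum_(r <- s) r) (\sum_(r <- s) r ^+ 2) u =
    \prod_(r <- s) cexp (u * r - (u * r) ^+ 2 / 2).
  elim: s {hs sC} => [|r s IH]; first by rewrite !big_nil /gauss !mul0r subrr cexp0.
  rewrite !big_cons gaussD IH; congr (_ * _); rewrite /gauss; congr cexp; ring.
rewrite /close gE.
have -> : \prod_(r <- s) (1 + u * r) - \prod_(r <- s) cexp (u * r - (u * r) ^+ 2 / 2) =
   (\prod_(r <- s) (1 + ((1 + u * r) * cexp (- (u * r - (u * r) ^+ 2 / 2)) - 1)) - 1) *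
   \prod_(r <- s) cexp (u * r - (u * r) ^+ 2 / 2).
  rewrite mulrBl mul1r -big_split /=; congr (_ - _); apply: eq_bigr => r _.
  by rewrite addrCA subrr addr0 -mulrA [cexp (- _) * _]mulrC cexpN mulr1.
rewrite (ncM _ (\prod_(r <- s) _)); apply: ler_wpM2r; first exact: nc_ge0.
apply: le_trans (prod_one_add _ _) _; rewrite lerD2r ler_expR.
have u3 : 0 <= nc u ^+ 3 by rewrite exprn_ge0 // nc_ge0.
apply: (@le_trans _ _ (\sum_(r <- s) 4 * expR 1 * (eta * nc u ^+ 3) * nc r ^+ 2)).
  rewrite big_seq [leRHS]big_seq; apply: ler_sum => r rs.
  have re := hs r rs.
  apply: le_trans (log_factor _) _.
    by rewrite ncM; apply: le_trans ue; rewrite ler_wpM2l // nc_ge0.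
  rewrite -[leRHS]mulrA; apply: ler_wpM2l; first by rewrite mulr_ge0 ?expR_ge0.
  rewrite ncM exprMn [nc r ^+ 3]exprS.
  rewrite [leLHS](_ : _ = nc u ^+ 3 * nc r ^+ 2 * nc r); last by ring.
  rewrite [leRHS](_ : _ = nc u ^+ 3 * nc r ^+ 2 * eta); last by ring.
  by apply: ler_wpM2l => //; rewrite mulr_ge0 ?sqr_ge0.
rewrite -mulr_sumr [leRHS](_ : _ = 4 * expR 1 * (eta * nc u ^+ 3) * C); last by ring.
apply: ler_wpM2l => //; apply: mulr_ge0; last exact: mulr_ge0.
by rewrite mulr_ge0 ?expR_ge0.
Qed.

End Closeness.

(** * Inverse distances from a base point to zeros in the strip *)

Section ReciprocalZeros.
Variable R : realType.
Implicit Types (z w u v r : R[i]) (x y e : R).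

(* For r != 0 this says that the zero z0 - 1/r lies in the strip; in this form the
   condition is closed and admits r = 0. *)
Definition strip_inv (mu y0 : R) (r : R[i]) : Prop :=
  `|y0 * nc r ^+ 2 + complex.Im r| <= mu * nc r ^+ 2.

Lemma strip_invP mu z0 (a : R[i]) : z0 - a != 0 -> `|complex.Im a| <= mu ->
  strip_inv mu (complex.Im z0) (z0 - a)^-1.
Proof.
move=> za am; rewrite /strip_inv ImV ncV exprVn ImD ImN.
have n0 : 0 < nc (z0 - a) ^+ 2 by rewrite exprn_gt0 // nc_gt0.
have -> : complex.Im z0 / nc (z0 - a) ^+ 2 + - (complex.Im z0 - complex.Im a) / nc (z0 - a) ^+ 2 =
   complex.Im a / nc (z0 - a) ^+ 2 by ring.
by rewrite normrM normfV (gtr0_norm n0) ler_wpM2r // invr_ge0 ltW.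
Qed.

Lemma strip_inv_root mu z0 r : r != 0 -> strip_inv mu (complex.Im z0) r ->
  `|complex.Im (z0 - r^-1)| <= mu.
Proof.
move=> r0; rewrite /strip_inv ImD ImN ImV.
have n0 : 0 < nc r ^+ 2 by rewrite exprn_gt0 // nc_gt0.
have -> : complex.Im z0 * nc r ^+ 2 + complex.Im r = (complex.Im z0 - - complex.Im r / nc r ^+ 2) * nc r ^+ 2.
  by field; rewrite nc_eq0.
by rewrite normrM (gtr0_norm n0) ler_pM2r.
Qed.

(** For r = 1/(z0 - a) one has Im r = -(Im z0 - Im a)|r|^2, where the bracket lies between 0 and y0
    + mu: all r lie on one side of the axis, and small ones are almost real. *)
Lemma strip_inv_Im mu y0 r : 0 <= mu -> mu <= y0 -> strip_inv mu y0 r ->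
  complex.Im r <= 0 /\ `|complex.Im r| <= (y0 + mu) * nc r ^+ 2.
Proof.
move=> m0 my; rewrite /strip_inv ler_norml => /andP[h1 h2].
have n0 := sqr_ge0 (nc r); split; first nra.
by rewrite ler_norml; apply/andP; split; nra.
Qed.

(** A small r is nearly real, so r^2 is nearly real and has nonnegative real part; summed over far
    zeros this gives the quadratic coefficient of the Gaussian. *)
Lemma strip_inv_sqr mu y0 eta r : 0 <= mu -> mu <= y0 -> strip_inv mu y0 r -> nc r <= eta ->
  2 * (y0 + mu) * eta <= 1 ->
  0 <= complex.Re (r ^+ 2) /\ `|complex.Im (r ^+ 2)| <= 2 * (y0 + mu) * eta * nc r ^+ 2.
Proof.
move=> m0 my hr re he; have [_ h] := strip_inv_Im m0 my hr.
have n0 := nc_ge0 r; have ym : 0 <= y0 + mu by lra.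
have h1 : `|complex.Im r| <= (y0 + mu) * eta * nc r.
  apply: le_trans h _; rewrite -mulrA; apply: ler_wpM2l => //.
  by rewrite expr2; apply: ler_wpM2r.
split.
  have -> : complex.Re (r ^+ 2) = nc r ^+ 2 - 2 * complex.Im r ^+ 2.
    by rewrite sqr_nc expr2 ReM; ring.
  have h2 : `|complex.Im r| ^+ 2 <= (1 / 2 * nc r) ^+ 2.
    have h0 : `|complex.Im r| <= 1 / 2 * nc r by apply: le_trans h1 _; apply: ler_wpM2r => //; lra.
    by rewrite lerXn2r ?nnegrE //; apply: le_trans h0.
  rewrite real_normK ?num_real // in h2; have := sqr_ge0 (nc r); rewrite exprMn in h2; lra.
have -> : complex.Im (r ^+ 2) = 2 * (complex.Re r * complex.Im r) by rewrite expr2 ImM; ring.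
rewrite normrM ger0_norm // normrM -!mulrA; apply: ler_wpM2l => //.
apply: (@le_trans _ _ (nc r * ((y0 + mu) * eta * nc r))).
  by apply: ler_pM => //; exact: nc_ge_Re.
by rewrite expr2 le_eqVlt; apply/orP; left; apply/eqP; ring.
Qed.

Lemma sum_le_prod_one_add (s : seq R) : (forall x, x \in s -> 0 <= x) ->
  1 + \sum_(x <- s) x <= \prod_(x <- s) (1 + x).
Proof.
elim: s => [|x s IH] hs; first by rewrite !big_nil addr0.
have x0 : 0 <= x by apply: hs; rewrite inE eqxx.
have hs' y : y \in s -> 0 <= y by move=> ys; apply: hs; rewrite inE ys orbT.
have h := IH hs'; rewrite !big_cons.
have s0 : 0 <= \sum_(j <- s) j by rewrite big_seq; apply: sumr_ge0.
have := ler_wpM2l (_ : 0 <= 1 + x) h; have x1 : 0 <= 1 + x by lra.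
move=> /(_ x1); have := mulr_ge0 x0 s0; lra.
Qed.

(** Im r <= 0 gives |1 + i r|^2 >= 1 + |r|^2, so the value at z0 + i controls the squares. The plain
    sum of the r is the linear coefficient of p(z0 + u)/p(z0), bounded by Cauchy's estimate. *)
Lemma strip_poly_inverse mu (p : {poly R[i]}) z0 : 0 <= mu -> mu <= complex.Im z0 ->
  zeros_in_strip mu p -> p.[z0] != 0 ->
  exists s : seq R[i], [/\ forall r, r \in s -> strip_inv mu (complex.Im z0) r,
    forall u, p.[z0 + u] = p.[z0] * \prod_(r <- s) (1 + u * r),
    \sum_(r <- s) nc r ^+ 2 <= (nc p.[z0 + 'i%C] / nc p.[z0]) ^+ 2 &
    forall M, (forall u, nc u <= 1 -> nc p.[z0 + u] <= M) -> nc (\sum_(r <- s) r) <= M / nc p.[z0]].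
Proof.
move=> m0 my hp pz; have [t pE] := poly_split p.
have p0 : p != 0 by apply: contraNneq pz => ->; rewrite horner0.
have zt : z0 \notin t := root_notin pE pz.
have za a : a \in t -> z0 - a != 0 by move=> ta; rewrite subr_eq0; apply: contraNneq zt => ->.
pose s := [seq (z0 - a)^-1 | a <- t].
have sg r : r \in s -> strip_inv mu (complex.Im z0) r.
  by move=> /mapP[a ta ->]; apply: strip_invP; [exact: za|apply: hp; exact: root_in ta].
have sE u : p.[z0 + u] = p.[z0] * \prod_(r <- s) (1 + u * r).
  rewrite pE !hornerZ -mulrA; congr (_ * _); rewrite !horner_prod big_map -big_split /=.
  rewrite big_seq [RHS]big_seq; apply: eq_bigr => a ta; rewrite !hornerXsubC.
  by field; exact: za.
have np : 0 < nc p.[z0] by rewrite nc_gt0.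
exists s; split => //.
  have h1 : 1 + \sum_(r <- s) nc r ^+ 2 <= \prod_(r <- s) (1 + nc r ^+ 2).
    have := @sum_le_prod_one_add [seq nc r ^+ 2 | r <- s]; rewrite !big_map; apply.
    by move=> x /mapP[r _ ->]; exact: sqr_ge0.
  have h2 : \prod_(r <- s) (1 + nc r ^+ 2) <= \prod_(r <- s) nc (1 + 'i%C * r) ^+ 2.
    rewrite big_seq [leRHS]big_seq; apply: ler_prod => r rs.
    have [h _] := strip_inv_Im m0 my (sg r rs).
    rewrite addr_ge0 ?sqr_ge0 //= !sqr_nc ReD ImD ReM ImM /= !(mul0r, mul1r, add0r, sub0r, addr0).
    lra.
  rewrite sE ncM mulrAC divff ?gt_eqF // mul1r nc_prod -prodrXl.
  by apply: le_trans h2; apply: le_trans h1; rewrite lerDr.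
move=> M hM; pose P := \prod_(r <- s) (1 + r *: 'X) : {poly R[i]}.
have PE u : P.[u] = \prod_(r <- s) (1 + u * r).
  by rewrite horner_prod; apply: eq_bigr => r _; rewrite !hornerE mulrC.
have P1 : P`_0 = 1 /\ P`_1 = \sum_(r <- s) r.
  rewrite /P; elim: (s) => [|r s' [IH0 IH1]]; first by rewrite !big_nil !coefC.
  rewrite !big_cons mulrDl mul1r -scalerAl !coefD !coefZ !coefXM /= IH0 IH1 mulr0 addr0 mulr1.
  by split => //; rewrite addrC.
rewrite -P1.2; have := @poly_cauchy _ P 1 (M / nc p.[z0]) ler01.
move=> /(_ _ 1%N); rewrite expr1 mulr1; apply => u u1.
by rewrite PE ler_pdivlMr // mulrC -ncM -sE; exact: hM.
Qed.

End ReciprocalZeros.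

(** * Limits along ultrafilters *)

Section UltraLimits.
Variable R : realType.
Implicit Types (z w u v r : R[i]) (x y e : R).

Section Continuity.
Context {T : Type} {F : set_system T} {FF : Filter F}.
Implicit Types (a : R[i]) (f : T -> R[i]).

Lemma cvgc_nc f a : f @ F --> a -> (fun t => nc (f t)) @ F --> nc a.
Proof.
move=> /cvg_ncP fa; apply/cvgrPdist_lt => e e0; apply: filterS (fa e e0) => t.
apply: le_lt_trans; have h1 := ncD (f t - a) a; have h2 := ncD (a - f t) (f t).
by rewrite !subrK (nc_sub a) in h1 h2; rewrite ler_norml; apply/andP; split; lra.
Qed.

Lemma cvgc_Im f a : f @ F --> a -> (fun t => complex.Im (f t)) @ F --> complex.Im a.
Proof.
move=> /cvg_ncP fa; apply/cvgrPdist_lt => e e0; apply: filterS (fa e e0) => t.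
by apply: le_lt_trans; rewrite distrC -ImN -ImD; exact: nc_ge_Im.
Qed.

Lemma cvgc_Re f a : f @ F --> a -> (fun t => complex.Re (f t)) @ F --> complex.Re a.
Proof.
move=> /cvg_ncP fa; apply/cvgrPdist_lt => e e0; apply: filterS (fa e e0) => t.
by apply: le_lt_trans; rewrite distrC -ReN -ReD; exact: nc_ge_Re.
Qed.

Lemma cvgc_conj f a : f @ F --> a -> (fun t => (f t)^*%C) @ F --> a^*%C.
Proof.
move=> /cvg_ncP fa; apply/cvg_ncP => e e0; apply: filterS (fa e e0) => t.
by rewrite -rmorphB /= ncJ.
Qed.

Lemma cvgc_cexp f a : f @ F --> a -> (fun t => cexp (f t)) @ F --> cexp a.
Proof.
move=> /cvg_ncP fa; apply/cvg_ncP => e e0.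
have N0 : 0 < nc (cexp a) by rewrite nc_cexp expR_gt0.
have d0 : 0 < Num.min (1 / 2) (e / (4 * nc (cexp a))).
  by rewrite lt_min divr_gt0 //= divr_gt0 // mulr_gt0.
apply: filterS (fa _ d0) => t; rewrite lt_min => /andP[h1 h2].
have -> : cexp (f t) - cexp a = cexp a * (cexp (f t - a) - 1).
  by rewrite mulrBr mulr1 -cexpD [a + _]addrC subrK.
rewrite (ncM (cexp a)); have := close_cexp (ltW h1); rewrite /close nc1 mulr1 => h3.
apply: le_lt_trans (ler_wpM2l (ltW N0) h3) _.
by move: h2; rewrite ltr_pdivlMr ?mulr_gt0 // => h2; lra.
Qed.

End Continuity.

(** Compactness in ultrafilter form: one ultrafilter makes all bounded sequences converge at once,
    in place of successive subsequences. *)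
Lemma bounded_ultra_cvg (T : Type) (U : set_system T) (f : T -> R[i]) M : UltraFilter U ->
  (\forall t \near U, nc (f t) <= M) -> exists l : R[i], f @ U --> l.
Proof.
move=> UU fM; have [A cA hA] := compact_disc M.
have UA : (f @ U) A by apply: filterS fM => t; exact: hA.
have [l [_ lU]] := cA _ (fmap_proper_filter f ultra_proper) UA.
exists l => B nB; have [//|UB] := in_ultra_setVsetC (f @^-1` B) UU.
have [t [h1 h2]] := lU (~` B) B UB nB; by [].
Qed.

End UltraLimits.

Lemma filter_ler (R : realType) (F : set_system nat) (FF : ProperFilter F) (f g : nat -> R) (a b : R) :
  f @ F --> a -> g @ F --> b -> (\forall t \near F, f t <= g t) -> a <= b.
Proof. by move=> h1 h2 h3; exact: (ler_cvg_to h1 h2 h3). Qed.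

(** Lists of varying length become families over a fixed ['I_N], for which termwise limits make
    sense. Below, the padding value is r = 0, a zero at infinity. *)
Lemma big_pad (V I : Type) (idx : V) (op : Monoid.com_law idx) (x0 : I) (s : seq I) (F : I -> V) N :
  (size s <= N)%N -> F x0 = idx ->
  \big[op/idx]_(x <- s) F x = \big[op/idx]_(i < N) F (nth x0 s i).
Proof.
move=> sN F0; rewrite (big_nth x0) big_mkord (big_ord_widen N (fun i => F (nth x0 s i)) sN).
rewrite big_mkcond; apply: eq_bigr => i _; case: ltnP => // h.
by rewrite nth_default.
Qed.

(** * Local form of a limit of strip polynomials: polynomial times Gaussian *)

Section StripNormalForm.
Variable R : realType.
Implicit Types (z w u v r : R[i]) (x y e : R) (f : R[i] -> R[i]).

Lemma Sbar_bounded mu f (r : R) : Sbar mu f -> exists2 M : R, 0 <= M & forall z, nc z <= r -> nc (f z) <= M.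
Proof.
move=> /compact_closureP h; have [p _ hp] := h r 1 ltr01.
have [M M0 hM] := poly_bounded p r; exists (M + 1); first lra.
move=> z zr; have := hp z zr; have := hM z zr; have := ncD (f z - p.[z]) p.[z].
rewrite subrK (nc_sub (f z)); lra.
Qed.

Lemma ratio_le (a b d : R) : 0 <= a -> a <= b -> 0 < b -> 0 <= d -> a * (d / b) <= d.
Proof.
move=> a0 ab b0 d0; rewrite mulrA ler_pdivrMr // mulrC; exact: ler_wpM2l.
Qed.

(** Each requirement bounds a multiple of eta by d; dividing d by 1 plus the sum of all multipliers
    settles them together. *)
Lemma choose_small (R1 C Y e : R) : 0 < R1 -> 0 <= C -> 0 <= Y -> 0 < e ->
  exists2 eta, 0 < eta & [/\ R1 * eta <= 1 / 4,
    forall x, 0 <= x -> x <= R1 -> expR (4 * expR 1 * (eta * C * x ^+ 3)) - 1 <= e,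
    Y * eta <= 1 & Y * eta * C <= e].
Proof.
move=> R10 C0 Y0 e0.
pose L := ln (1 + e); have L0 : 0 < L by apply: ln_gt0; lra.
have LE : expR L = 1 + e by rewrite lnK // posrE; lra.
pose d := Num.min (Num.min (1 / 4) L) e.
have d0 : 0 < d by rewrite !lt_min L0 e0 divr_gt0.
have [d1 d2 d3] : [/\ d <= 1 / 4, d <= L & d <= e] by rewrite /d !ge_min !lexx !orbT.
have c0 : 0 <= 4 * expR 1 :> R by rewrite mulr_ge0 ?expR_ge0.
pose T := 4 * expR 1 * (C * R1 ^+ 3).
have T0 : 0 <= T by apply: mulr_ge0 => //; apply: mulr_ge0 => //; rewrite exprn_ge0 // ltW.
have YC0 : 0 <= Y * C by rewrite mulr_ge0.
have small a b : 0 <= a -> 0 <= b -> a * (d / (1 + a + b)) <= d.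
  by move=> a0 b0; apply: ratio_le => //; [lra|lra|exact: ltW].
exists (d / (1 + R1 + T + Y + Y * C)); first by rewrite divr_gt0 //; lra.
set eta := d / _; have eta0 : 0 <= eta by rewrite divr_ge0 ?(ltW d0) //; lra.
have s1 : R1 * eta <= d.
  have := small R1 (T + Y + Y * C) (ltW R10) _; rewrite !addrA; apply; lra.
have s2 : T * eta <= d.
  by rewrite /eta (_ : 1 + R1 + T + Y + Y * C = 1 + T + (R1 + Y + Y * C)); [apply: small => //; lra|ring].
have s3 : Y * eta <= d.
  by rewrite /eta (_ : 1 + R1 + T + Y + Y * C = 1 + Y + (R1 + T + Y * C)); [apply: small => //; lra|ring].
have s4 : Y * C * eta <= d.
  by rewrite /eta (_ : 1 + R1 + T + Y + Y * C = 1 + Y * C + (R1 + T + Y)); [apply: small => //; lra|ring].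
split; [lra| |lra|by rewrite mulrAC; lra].
move=> x x0 xR; rewrite lerBlDl -LE ler_expR; apply: le_trans (le_trans s2 d2).
rewrite [leLHS](_ : _ = 4 * expR 1 * (C * eta) * x ^+ 3); last by ring.
rewrite [leRHS](_ : _ = 4 * expR 1 * (C * eta) * R1 ^+ 3); last by rewrite /T; ring.
apply: ler_wpM2l; first by apply: mulr_ge0 => //; exact: mulr_ge0.
by rewrite lerXn2r ?nnegrE // ltW.
Qed.

(** C is fixed before the radius and the precision, as it depends only on f at z0 and z0 + i. The
    order matters: the radius is later chosen from a threshold eta that depends on C. *)
Lemma strip_normal_form mu f z0 : 0 <= mu -> Sbar mu f -> mu <= complex.Im z0 -> f z0 != 0 ->
  exists2 C, 0 <= C & forall rr eps : R, 0 < rr -> 0 < eps ->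
  exists (s : seq R[i]) (S sg : R[i]),
   [/\ forall r, r \in s -> strip_inv mu (complex.Im z0) r,
    \sum_(r <- s) nc r ^+ 2 <= C, 0 <= complex.Re sg, `|complex.Im sg| <= eps &
    forall u, nc u <= rr ->
      close eps (f (z0 + u)) (f z0 * \prod_(r <- s) (1 + u * r) * gauss S sg u)].
Proof.
move=> m0 fS my fz; have Fp : 0 < nc (f z0) by rewrite nc_gt0.
set y0 := complex.Im z0 in my *; set f0 := nc (f z0) in Fp *.
(* Eventually |p_m(z0 + i)| <= |f(z0 + i)| + 1 and |p_m(z0)| >= |f(z0)|/2, which makes C a common
   bound for the sums of squares. *)
pose C := ((nc (f (z0 + 'i%C)) + 1) / (f0 / 2)) ^+ 2.
have C0 : 0 <= C by exact: sqr_ge0.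
exists C => // rr eps rr0 eps0.
pose Y := 2 * (y0 + mu); have Y0 : 0 <= Y by rewrite mulr_ge0 //; lra.
have [eta eta0 [e1 e2 e3 e4]] := choose_small rr0 C0 Y0 eps0.
pose r0 := nc z0 + rr + 2; have nz0 := nc_ge0 z0.
have [M M0 hM] := Sbar_bounded r0 fS.
have ni : nc ('i%C : R[i]) = 1 by rewrite /= expr0n add0r expr1n sqrtr1.
have /choice [p hp] : forall m : nat, exists p : {poly R[i]}, zeros_in_strip mu p /\
    forall z, nc z <= r0 -> nc (p.[z] - f z) < m.+1%:R^-1.
  move=> m; have m1 : 0 < m.+1%:R^-1 :> R by rewrite invr_gt0.
  by have /compact_closureP /(_ r0 _ m1) [p h1 h2] := fS; exists p.
have pl u : nc u <= rr + 1 -> (fun m => (p m).[z0 + u]) @ \oo --> f (z0 + u).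
  move=> ur; apply/cvg_ncP => e e0; near=> m; apply: (@lt_trans _ _ m.+1%:R^-1).
    by apply: (hp m).2; apply: le_trans (ncD _ _) _; rewrite /r0; lra.
  by near: m; exact: near_infty_natSinv_lt (PosNum e0).
have pz0 : (fun m => (p m).[z0]) @ \oo --> f z0.
  have h : nc (0 : R[i]) <= rr + 1 by rewrite nc0; lra.
  by have h2 := pl 0 h; rewrite addr0 in h2; exact h2.
have near1 : \forall m \near \oo, f0 / 2 <= nc (p m).[z0].
  have f2 : 0 < f0 / 2 by rewrite divr_gt0.
  move/cvg_ncP : pz0 => /(_ _ f2); apply: filterS => m.
  have := ncD (f z0 - (p m).[z0]) (p m).[z0]; rewrite subrK (nc_sub (f z0)) -/f0; lra.
have near2 : \forall m \near \oo, nc (p m).[z0 + 'i%C] <= nc (f (z0 + 'i%C)) + 1.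
  have h : nc ('i%C : R[i]) <= rr + 1 by rewrite ni; lra.
  move/cvg_ncP : (pl _ h) => /(_ _ ltr01); apply: filterS => m.
  have := ncD ((p m).[z0 + 'i%C] - f (z0 + 'i%C)) (f (z0 + 'i%C)); rewrite subrK; lra.
have pM m u : nc u <= 1 -> nc (p m).[z0 + u] <= M + 1.
  move=> u1; have h : nc (z0 + u) <= r0 by apply: le_trans (ncD _ _) _; rewrite /r0; lra.
  have h1 := (hp m).2 _ h; have h2 := hM _ h.
  have := ncD ((p m).[z0 + u] - f (z0 + u)) (f (z0 + u)); rewrite subrK => h3.
  have h4 : m.+1%:R^-1 <= 1 :> R by rewrite invf_le1 // ler1n.
  apply: le_trans h3 _; rewrite addrC; apply: lerD => //; apply: le_trans (ltW h1) h4.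
have /choice [s hs] : forall m, exists s : seq R[i], f0 / 2 <= nc (p m).[z0] ->
    nc (p m).[z0 + 'i%C] <= nc (f (z0 + 'i%C)) + 1 ->
    [/\ forall r, r \in s -> strip_inv mu y0 r,
      forall u, (p m).[z0 + u] = (p m).[z0] * \prod_(r <- s) (1 + u * r),
      \sum_(r <- s) nc r ^+ 2 <= C & nc (\sum_(r <- s) r) <= (M + 1) / (f0 / 2)].
  move=> m; case: (leP (f0 / 2) (nc (p m).[z0])) => [h1|_]; last by exists [::].
  have pz : (p m).[z0] != 0 by rewrite -nc_gt0; apply: lt_le_trans h1; rewrite divr_gt0.
  have [s [s1 s2 s3 s4]] := strip_poly_inverse m0 my (hp m).1 pz.
  exists s => _ h2; split => //.
    have q1 : 0 <= (nc (f (z0 + 'i%C)) + 1) / (f0 / 2).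
      by rewrite divr_ge0 ?addr_ge0 ?nc_ge0 // divr_ge0 // ltW.
    have q2 : 0 <= nc (p m).[z0 + 'i%C] / nc (p m).[z0] by rewrite divr_ge0 ?nc_ge0.
    apply: le_trans s3 _; rewrite lerXn2r ?nnegrE //.
    by rewrite ler_pM ?nc_ge0 ?invr_ge0 ?nc_ge0 // lef_pV2 ?posrE ?divr_gt0 // (lt_le_trans _ h1) ?divr_gt0.
  apply: le_trans (s4 _ (pM m)) _.
  by rewrite ler_wpM2l ?lef_pV2 ?posrE ?divr_gt0 ?(lt_le_trans _ h1) ?divr_gt0 //; lra.
have good : \forall m \near \oo, [/\ forall r, r \in s m -> strip_inv mu y0 r,
      forall u, (p m).[z0 + u] = (p m).[z0] * \prod_(r <- s m) (1 + u * r),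
      \sum_(r <- s m) nc r ^+ 2 <= C & nc (\sum_(r <- s m) r) <= (M + 1) / (f0 / 2)].
  by apply: filterS2 near1 near2 => m; exact: hs.
(* Zeros within 1/eta of z0 are followed individually, at most C/eta^2 of them for each good m; the
   others enter only through the sums of r and of r^2. *)
pose sn m := [seq r <- s m | eta <= nc r]; pose sf m := [seq r <- s m | ~~ (eta <= nc r)].
have split_big (V : Type) (idx : V) (op : Monoid.com_law idx) (F : R[i] -> V) m :
    \big[op/idx]_(r <- s m) F r = op (\big[op/idx]_(r <- sn m) F r) (\big[op/idx]_(r <- sf m) F r).
  by rewrite /sn /sf !big_filter (bigID (fun r => eta <= nc r)).
pose N := (Num.truncn (C / eta ^+ 2)).+1.
have snN m : \sum_(r <- s m) nc r ^+ 2 <= C -> (size (sn m) <= N)%N.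
  move=> h; have : (size (sn m))%:R * eta ^+ 2 <= C.
    apply: le_trans h; rewrite split_big /=.
    have h1 : (size (sn m))%:R * eta ^+ 2 <= \sum_(r <- sn m) nc r ^+ 2.
      rewrite (_ : _ * _ = \sum_(r <- sn m) eta ^+ 2); last first.
        by rewrite big_const_seq count_predT iter_addr_0 mulr_natl.
      rewrite big_seq [leRHS]big_seq; apply: ler_sum => r; rewrite mem_filter => /andP[er _].
      by rewrite lerXn2r ?nnegrE ?nc_ge0 ?(ltW eta0).
    by apply: le_trans h1 _; rewrite lerDl sumr_ge0 // => r _; exact: sqr_ge0.
  rewrite -ler_pdivlMr ?exprn_gt0 // => h1; rewrite -(ler_nat R); apply: le_trans h1 _.
  by apply: ltW; exact: truncnS_gt.
have [U [UU oU]] := ultraFilterLemma eventually_filter.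
have UP : ProperFilter U by exact: ultra_proper.
have FU : Filter U by exact: _.
have goodU := oU _ good.
pose X (i : 'I_N) m := nth 0 (sn m) i.
have XC : \forall m \near U, forall i, nc (X i m) ^+ 2 <= C /\ strip_inv mu y0 (X i m).
  apply: filterS goodU => m [g1 _ g3 _] i; rewrite /X.
  have [im|mi] := ltnP i (size (sn m)); last first.
    rewrite nth_default // nc0 expr0n; split => //.
    by rewrite /strip_inv nc0 expr0n /= !mulr0 addr0 normr0.
  have rs : nth 0 (sn m) i \in s m.
    by have := mem_nth 0 im; rewrite mem_filter => /andP[].
  split; last exact: g1.
  apply: le_trans g3; rewrite (big_rem _ rs) /= lerDl sumr_ge0 // => r _; exact: sqr_ge0.
have XB : \forall m \near U, forall i, nc (X i m) <= C + 1.
  by apply: filterS XC => m h i; have [h1 _] := h i; have := nc_ge0 (X i m); nra.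
have /choice [l lX] : forall i, exists l : R[i], X i @ U --> l.
  by move=> i; apply: bounded_ultra_cvg; apply: filterS XB => m; exact.
pose Sf m := \sum_(r <- sf m) r; pose Gf m := \sum_(r <- sf m) r ^+ 2.
have sfC m : \sum_(r <- s m) nc r ^+ 2 <= C -> \sum_(r <- sf m) nc r ^+ 2 <= C.
  move=> h; apply: le_trans h; rewrite [leRHS]split_big /= lerDr sumr_ge0 // => r _.
  exact: sqr_ge0.
have SnE m : (size (sn m) <= N)%N -> \sum_(r <- sn m) r = \sum_(i < N) X i m.
  by move=> h; rewrite (@big_pad _ _ _ _ 0 (sn m) id N).
have [S SU] : exists S : R[i], Sf @ U --> S.
  apply: (@bounded_ultra_cvg _ _ _ _ ((M + 1) / (f0 / 2) + \sum_(i < N) (C + 1))) => //.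
  apply: filterS2 goodU XB => m [_ _ g3 g4] xb.
  have -> : Sf m = \sum_(r <- s m) r - \sum_(i < N) X i m.
    by rewrite split_big /= SnE ?snN // [X in X - _]addrC addrK.
  apply: le_trans (ncB _ _) _; apply: lerD => //; apply: le_trans (nc_sum _ _ _) _.
  by apply: ler_sum => i _; exact: xb.
have [G GU] : exists G : R[i], Gf @ U --> G.
  apply: (@bounded_ultra_cvg _ _ _ _ C) => //; apply: filterS goodU => m [_ _ g3 _].
  apply: le_trans (nc_sum _ _ _) _; under eq_bigr do rewrite ncX; exact: sfC.
have sf_sqr m r : (forall r, r \in s m -> strip_inv mu y0 r) -> r \in sf m ->
    0 <= complex.Re (r ^+ 2) /\ `|complex.Im (r ^+ 2)| <= Y * eta * nc r ^+ 2.
  move=> g1; rewrite mem_filter -ltNge => /andP[re /g1 h]; rewrite /Y.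
  by apply: (strip_inv_sqr m0 my h (ltW re)).
exists [seq l i | i <- enum 'I_N], S, G; split.
- move=> r /mapP[i _ ->]; rewrite /strip_inv.
  have cX := @cvgc_nc R nat U FU _ _ (lX i).
  have c2 : (fun m => nc (X i m) ^+ 2) @ U --> nc (l i) ^+ 2.
    rewrite (_ : (fun m => _) = fun m => nc (X i m) * nc (X i m)).
      by rewrite expr2; exact: (cvgM cX cX).
    by apply/funext => m; rewrite expr2.
  apply: (@filter_ler R U UP (fun m => `|y0 * nc (X i m) ^+ 2 + complex.Im (X i m)|) (fun m => mu * nc (X i m) ^+ 2) _ _).
  + by apply: cvg_norm; apply: cvgD; [apply: cvgM; [exact: cvg_cst|exact: c2]|exact: (cvgc_Im (lX i))].
  + by apply: cvgM; [exact: cvg_cst|exact: c2].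
  + by apply: filterS XC => m h; have [] := h i.
- rewrite big_map big_enum /=.
  (* Written as the modulus of a complex sum, the sum of squares falls under the limit lemmas for
     [R[i]]. *)
  have E (q : 'I_N -> R[i]) : nc (\sum_(i < N) q i * (q i)^*%C) = \sum_(i < N) nc (q i) ^+ 2.
    have -> : \sum_(i < N) q i * (q i)^*%C = (\sum_(i < N) nc (q i) ^+ 2)%:C.
      rewrite rmorph_sum; apply: eq_bigr => i _; rewrite sqr_nc; case: (q i) => a b /=.
      by apply/eqP; rewrite eq_complex /=; apply/andP; split; apply/eqP; ring.
    by rewrite ncR ger0_norm // sumr_ge0 // => i _; exact: sqr_ge0.
  rewrite -E; have cv := @cvgc_sum R nat U FU _ (index_enum 'I_N) (fun i m => X i m * (X i m)^*%C)
     (fun i => l i * (l i)^*%C) (fun i => @cvgcM R nat U FU _ _ _ _ (lX i) (@cvgc_conj R nat U FU _ _ (lX i))).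
  apply: (cvg_nc_le cv); apply: filterS goodU => m [_ _ g3 _].
  rewrite (E (fun i => X i m)) -(@big_pad _ _ _ _ 0 (sn m) (fun r => nc r ^+ 2) N) ?snN //; last first.
    by rewrite nc0 expr0n.
  apply: le_trans g3; rewrite [leRHS]split_big /= lerDl sumr_ge0 // => r _; exact: sqr_ge0.
- apply: (@filter_ler R U UP (fun=> 0) (fun m => complex.Re (Gf m)) _ _).
  + exact: cvg_cst.
  + exact: (cvgc_Re GU).
  + apply: filterS goodU => m [g1 _ _ _]; rewrite /Gf Re_sum big_seq; apply: sumr_ge0 => r rs.
    by have [] := sf_sqr m r g1 rs.
- apply: (@filter_ler R U UP (fun m => `|complex.Im (Gf m)|) (fun=> eps) _ _).
  + by apply: cvg_norm; exact: (cvgc_Im GU).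
  + exact: cvg_cst.
  + apply: filterS goodU => m [g1 _ g3 _]; rewrite /Gf Im_sum; apply: le_trans (ler_norm_sum _ _ _) _.
    apply: (@le_trans _ _ (\sum_(r <- sf m) Y * eta * nc r ^+ 2)).
      by rewrite big_seq [leRHS]big_seq; apply: ler_sum => r rs; have [] := sf_sqr m r g1 rs.
    rewrite -mulr_sumr; have h := sfC m g3; have ye : 0 <= Y * eta by rewrite mulr_ge0 // ltW.
    by apply: le_trans (ler_wpM2l ye h) _.
move=> u ur.
have cpu : (fun m => (p m).[z0 + u]) @ U --> f (z0 + u).
  by apply: cvg_trans (pl u _); [exact: cvg_app|lra].
have cp0 : (fun m => (p m).[z0]) @ U --> f z0 by apply: cvg_trans pz0; exact: cvg_app.
pose Pn m := \prod_(i < N) (1 + u * X i m).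
have cP : Pn @ U --> \prod_(r <- [seq l i | i <- enum 'I_N]) (1 + u * r).
  rewrite big_map big_enum /=.
  exact: (@cvgc_prod R nat U FU _ (index_enum 'I_N) (fun i m => 1 + u * X i m)
     (fun i => 1 + u * l i) (fun i => @cvgcD R nat U FU _ _ _ _ (cvgc_cst 1) (@cvgcM R nat U FU _ _ _ _ (cvgc_cst u) (lX i)))).
have cG : (fun m => gauss (Sf m) (Gf m) u) @ U --> gauss S G u.
  apply: cvgc_cexp.
  exact: (cvgcB (cvgcM SU (cvgc_cst u)) (cvgcM (cvgcM GU (cvgc_cst (u ^+ 2))) (cvgc_cst (2^-1)))).
have cA := @cvgcM R nat U FU _ _ _ _ (@cvgcM R nat U FU _ _ _ _ cp0 cP) cG.
rewrite /close; apply: (@filter_ler R U UP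
    (fun m => nc ((p m).[z0 + u] - (p m).[z0] * Pn m * gauss (Sf m) (Gf m) u))
    (fun m => eps * nc ((p m).[z0] * Pn m * gauss (Sf m) (Gf m) u)) _ _).
- exact: (cvgc_nc (cvgcB cpu cA)).
- by apply: cvgM; [exact: cvg_cst|exact: (cvgc_nc cA)].
apply: filterS goodU => m [g1 g2 g3 _].
rewrite g2 split_big /= mulrA (@big_pad _ _ _ _ 0 (sn m) (fun r => 1 + u * r) N) ?snN ?mulr0 ?addr0 //.
rewrite -/(Pn m); apply: closeMl.
have fp := @far_product R (sf m) C eta u (ltW eta0) _ (sfC m g3) _.
apply: close_le (fp _ _).
- exact: e2 (nc_ge0 u) ur.
- by move=> r; rewrite mem_filter -ltNge => /andP[/ltW].
- by apply: le_trans e1; rewrite ler_wpM2r // ltW.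
Unshelve. all: by end_near. Qed.

End StripNormalForm.

(** * Splitting off a real polynomial factor *)

Section RealFactor.
Variable R : realType.
Implicit Types (z w u v r : R[i]) (x y e : R) (f : R[i] -> R[i]).

(** The series of imaginary parts sums to 0 at real x. When the terms before k vanish, division by
    x^k bounds the k-th one by 2 M x, and x > 0 is arbitrarily small. *)
Lemma real_taylor (c : nat -> R[i]) f : is_taylor c f -> (forall x, complex.Im (f x%:C) = 0) ->
  forall k, complex.Im (c k) = 0.
Proof.
move=> cf fR k; elim/ltn_ind: k => k IH.
have [M M0 hM] := is_taylor_bounded 1 cf.
pose d j := (complex.Im (c j))%:C : R[i].
have dM j : nc (d j) <= M.
  by rewrite ncR; apply: le_trans (nc_ge_Im _) _; have := hM j; rewrite expr1n mulr1.
have key x : 0 < x -> x <= 1 / 2 -> nc (d k) <= 2 * M * x.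
  move=> x0 x2; have [|||l hl hn] := @geometric_series _ (fun j => d j * x%:C ^+ j) M x; [lra|lra| |].
    by move=> j; rewrite ncM ncX ncR ger0_norm ?(ltW x0) // ler_wpM2r // exprn_ge0 // ltW.
  have l0 : l = 0.
    apply: (cvg_unique_nc hl); apply/cvg_ncP => e e0.
    have /cvg_ncP /(_ e e0) := cf x%:C; apply: filterS => n; rewrite subr0; apply: le_lt_trans.
    have -> : series (fun j => d j * x%:C ^+ j) n = (complex.Im (series (fun j => c j * x%:C ^+ j) n - f x%:C))%:C.
      rewrite ImD ImN fR subr0 /series /= Im_sum rmorph_sum; apply: eq_bigr => j _.
      by rewrite -rmorphXn ImM /= mulr0 add0r rmorphM.
    by rewrite ncR; exact: nc_ge_Im.
  have := hn k.+1; rewrite l0 sub0r ncN big_ord_recr /= big1 ?add0r; last first.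
    by move=> j _; rewrite /d (IH j (ltn_ord j)) mul0r.
  rewrite ncM ncX [nc x%:C]ncR (ger0_norm (ltW x0)) => h.
  have xk : 0 < x ^+ k by rewrite exprn_gt0.
  have h2 : M * x ^+ k.+1 / (1 - x) <= 2 * M * x * x ^+ k.
    rewrite ler_pdivrMr ?exprS; last lra.
    have := mulr_ge0 M0 (mulr_ge0 (ltW x0) (ltW xk)); set T := M * (x * x ^+ k) => T0.
    rewrite [leRHS](_ : _ = T * (2 * (1 - x))); last by rewrite /T; ring.
    by rewrite ler_peMr //; lra.
  by rewrite -(ler_pM2r xk); apply: le_trans h h2.
apply/eqP; rewrite -normr_eq0 -ncR eq_le nc_ge0 andbT -/(d k).
apply/ler_addgt0Pr => e e0; rewrite add0r.
have x0 : 0 < Num.min (1 / 2) (e / (2 * M + 1)).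
  by rewrite lt_min divr_gt0 //= divr_gt0 //; lra.
apply: le_trans (key _ x0 _) _; first by rewrite ge_min lexx.
have h : Num.min (1 / 2) (e / (2 * M + 1)) <= e / (2 * M + 1) by rewrite ge_min lexx orbT.
move: h x0; set x := Num.min _ _; rewrite ler_pdivlMr; last lra.
lra.
Qed.

Lemma taylor_conj (c : nat -> R[i]) f z : is_taylor c f -> (forall k, complex.Im (c k) = 0) ->
  f z^*%C = (f z)^*%C.
Proof.
move=> cf cR; have h := cvgc_conj (cf z); apply: (cvg_unique_nc (cf z^*%C)).
rewrite (_ : series _ = fun n => (series (fun k => c k * z ^+ k) n)^*%C); first exact: h.
apply/funext => n; rewrite /series /= rmorph_sum; apply: eq_bigr => k _.
rewrite rmorphM rmorphXn /=; congr (_ * _); have := cR k; case: (c k) => p q /= ->.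
by rewrite oppr0.
Qed.

(** Moving w to height |Im w| + 2 mu brings it no closer to any zero of the strip. Applied to
    approximants, this yields a base point above the strip where f does not vanish. *)
Lemma strip_poly_monotone mu (p : {poly R[i]}) w : 0 <= mu -> zeros_in_strip mu p ->
  nc p.[w] <= nc p.[complex.Re w +i* (`|complex.Im w| + 2 * mu)].
Proof.
move=> m0 hp; have [->|p0] := eqVneq p 0; first by rewrite !horner0.
have [s pE] := poly_split p; rewrite pE !hornerZ !ncM; apply: ler_wpM2l; first exact: nc_ge0.
rewrite !horner_prod !nc_prod big_seq [leRHS]big_seq; apply: ler_prod => a sa; rewrite nc_ge0 /=.
rewrite !hornerXsubC -(@ler_pXn2r _ 2) ?nnegrE ?nc_ge0 // !sqr_nc !ReD !ImD !ReN !ImN /=.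
rewrite lerD2l; have am : `|complex.Im a| <= mu by apply: hp; exact: root_in sa.
rewrite -(real_normK (num_real (complex.Im w - complex.Im a))) lerXn2r ?nnegrE //.
  have := ler_norm (complex.Im a); have := normr_ge0 (complex.Im w); lra.
apply: le_trans (ler_normB _ _) _; have := ler_norm (complex.Im a); lra.
Qed.

Lemma strip_base_point mu f w : 0 <= mu -> Sbar mu f -> f w != 0 ->
  exists2 z0, mu <= complex.Im z0 & f z0 != 0.
Proof.
move=> m0 fS fw; exists (complex.Re w +i* (`|complex.Im w| + 2 * mu)).
  by rewrite /=; have := normr_ge0 (complex.Im w); lra.
set z0 := _ +i* _; have n0 : 0 < nc (f w) by rewrite nc_gt0.
have e0 : 0 < nc (f w) / 3 by rewrite divr_gt0.
have /compact_closureP /(_ (nc w + nc z0) _ e0) [p hp h] := fS.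
have hw := nc_ge0 w; have hz := nc_ge0 z0.
have h1 := h w _; have {}h1 : nc (p.[w] - f w) < nc (f w) / 3 by apply: h1; lra.
have h2 := h z0 _; have {}h2 : nc (p.[z0] - f z0) < nc (f w) / 3 by apply: h2; lra.
have h3 := strip_poly_monotone w m0 hp; rewrite -/z0 in h3.
have := ncD (f w - p.[w]) p.[w]; have := ncD (p.[z0] - f z0) (f z0).
rewrite !subrK (nc_sub (f w)) => h4 h5; rewrite -nc_gt0; lra.
Qed.

Lemma poly_avoid (G : {poly R[i]}) (x : nat -> R[i]) : G != 0 -> injective x ->
  exists k, G.[x k] != 0.
Proof.
move=> G0 xi; apply/not_existsP => h.
have := max_poly_roots G0 (_ : all (root G) (map x (iota 0 (size G)))) (_ : uniq _).
rewrite size_map size_iota ltnn map_inj_uniq ?iota_uniq // => h2.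
suff : false by [].
apply: h2 => //; apply/allP => y /mapP[k _ ->]; rewrite rootE.
by apply/negP => /negP; exact: h.
Qed.

Lemma sum_mask_le (I : Type) (m : bitseq) (s : seq I) (F : I -> R) : (forall i, 0 <= F i) ->
  \sum_(i <- mask m s) F i <= \sum_(i <- s) F i.
Proof.
move=> F0; elim: s m => [|i s IH] [|[] m] //=; rewrite ?big_nil ?big_cons //.
- by rewrite addr_ge0 // sumr_ge0.
- by rewrite lerD2l.
- by apply: le_trans (IH m) _; rewrite lerDr.
Qed.

(** The gcd of P and its conjugate is fixed by conjugation only up to a scalar; making it monic
    makes it real. What remains of P shares no zero with its conjugate. *)
Lemma real_gcd (P : {poly R[i]}) : P != 0 -> exists G P1 : {poly R[i]},
  [/\ G != 0, conj_poly G = G, P = P1 * G & coprimep P1 (conj_poly P1)].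
Proof.
move=> P0; pose G0 := gcdp P (conj_poly P).
have G00 : G0 != 0 by rewrite gcdp_eq0 negb_and P0.
have l0 : lead_coef G0 != 0 by rewrite lead_coef_eq0.
pose G := (lead_coef G0)^-1 *: G0.
have Gm : G \is monic by rewrite monicE lead_coefZ mulVf.
have GR : conj_poly G = G.
  have mc : conj_poly G \is monic by rewrite map_monic.
  apply/eqP; rewrite -eqp_monic //; apply: (@eqp_trans _ (conj_poly G0)).
    by rewrite /G /conj_poly map_polyZ eqp_scale // fmorph_eq0 invr_eq0.
  apply: (@eqp_trans _ G0); last by rewrite eqp_sym eqp_scale // invr_eq0.
  rewrite /G0 /conj_poly gcdp_map -!/(conj_poly _) conj_polyK; exact: gcdpC.
pose P1 := lead_coef G0 *: (P %/ G0); pose Q1 := lead_coef G0 *: (conj_poly P %/ G0).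
have PE : P = P1 * G.
  by rewrite -scalerAl -scalerAr scalerA mulfV // scale1r divpK // dvdp_gcdl.
have QE : conj_poly P = Q1 * G.
  by rewrite -scalerAl -scalerAr scalerA mulfV // scale1r divpK // dvdp_gcdr.
have Gn0 : G != 0 by rewrite monic_neq0.
exists G, P1; split => //.
have -> : conj_poly P1 = Q1.
  have E : conj_poly P = conj_poly P1 * G by rewrite {1}PE /conj_poly rmorphM /= -!/(conj_poly _) GR.
  by apply: (mulIf Gn0); rewrite -QE -E.
by rewrite coprimepZl // coprimepZr // coprimep_div_gcd // P0.
Qed.

Lemma nc_gauss_bound S s u (r : R) : nc u <= r ->
  nc (gauss S s u) <= expR (nc S * r + nc s * r ^+ 2) /\
  expR (- (nc S * r + nc s * r ^+ 2)) <= nc (gauss S s u).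
Proof.
move=> ur; have B : nc (S * u - s * u ^+ 2 / 2) <= nc S * r + nc s * r ^+ 2.
  have u0 := nc_ge0 u; have n2 : nc (2 : R[i]) = 2 by rewrite ncM_nat.
  apply: le_trans (ncB _ _) _; rewrite (ncM S) (ncM (s * _)) (ncM s) ncV n2 ncX; apply: lerD.
    by rewrite ler_wpM2l // nc_ge0.
  have h : nc u ^+ 2 <= r ^+ 2 by rewrite lerXn2r ?nnegrE //; lra.
  have := ler_wpM2l (nc_ge0 s) h; have := mulr_ge0 (nc_ge0 s) (sqr_ge0 (nc u)); lra.
rewrite /gauss nc_cexp !ler_expR; have := nc_ge_Re (S * u - s * u ^+ 2 / 2).
by rewrite ler_norml => /andP[h1 h2]; split; lra.
Qed.

(* f is both A P near and, by its reality, A* P* there, with A and A* bounded away from 0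
   and oo; hence a zero of P1 = P / G near the base point would be a zero of P1*. *)
Lemma far_roots f z0 (P G P1 : {poly R[i]}) S sg (rr e q : R) : 0 <= e -> e <= 1 / 4 ->
  (forall z, f z^*%C = (f z)^*%C) -> f z0 != 0 -> G != 0 -> conj_poly G = G -> P = P1 * G ->
  coprimep P1 (conj_poly P1) -> q + 2 * nc z0 + 1 <= rr ->
  (forall u, nc u <= rr -> close e (f (z0 + u)) (f z0 * P.[z0 + u] * gauss S sg u)) ->
  forall b, root P1 b -> q <= nc (b - z0).
Proof.
move=> e0 e4 fR fz G0 GR PE co qrr hf b rb; rewrite leNgt; apply/negP => bq.
set Q := conj_poly P1 in co.
have Qb : Q.[b] != 0 := coprimep_root co rb.
(* e^B and e^(-B) bound the Gaussian on the disc of radius rr; the factor 2 covers (1 + e)/(1 - e)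
   <= 5/3. *)
pose B := nc S * rr + nc sg * rr ^+ 2; pose K := 2 * expR (2 * B).
have K0 : 0 < K by rewrite mulr_gt0 ?expR_gt0.
have key t : nc t <= 1 -> G.[b + t] != 0 -> nc Q.[b + t] <= K * nc P1.[b + t].
  move=> t1 Gt; set z := b + t in Gt *; have nz := nc_ge0 z0.
  have u1 : nc (z - z0) <= rr.
    have -> : z - z0 = (b - z0) + t by rewrite /z; ring.
    by apply: le_trans (ncD _ _) _; lra.
  (* Conjugation displaces the centre z0 by at most 2|z0|; the hypothesis on rr reserves this
     much. *)
  have u2 : nc (z^*%C - z0) <= rr.
    have -> : z^*%C - z0 = (b - z0)^*%C + t^*%C + (z0^*%C - z0).
      by rewrite /z rmorphD rmorphB /=; ring.
    apply: le_trans (ncD _ _) _; apply: le_trans (lerD (ncD _ _) (ncB _ _)) _.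
    rewrite !ncJ; lra.
  have [_ h1] := close_nc (hf _ u1); have [h2 _] := close_nc (hf _ u2).
  have E w : z0 + (w - z0) = w by ring.
  rewrite !E in h1 h2.
  have PJ : nc P.[z^*%C] = nc Q.[z] * nc G.[z].
    have -> : nc P.[z^*%C] = nc (conj_poly P).[z] by rewrite horner_conj_poly ncJ.
    by rewrite PE /conj_poly rmorphM /= -!/(conj_poly _) GR hornerM ncM.
  have fJ : nc (f z^*%C) = nc (f z) by rewrite fR ncJ.
  rewrite (ncM (f z0 * _)) (ncM (f z0)) PJ fJ in h2.
  rewrite (ncM (f z0 * _)) (ncM (f z0)) PE hornerM (ncM P1.[z]) in h1.
  have [a1 _] := nc_gauss_bound S sg u1; have [_ a2] := nc_gauss_bound S sg u2.
  rewrite -/B in a1 a2.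
  set A1 := nc (gauss _ _ _) in h1 a1; set A2 := nc (gauss _ _ _) in h2 a2.
  have F0 : 0 < nc (f z0) * nc G.[z] by rewrite mulr_gt0 ?nc_gt0.
  have h3 : (1 - e) * (nc Q.[z] * A2) <= (1 + e) * (nc P1.[z] * A1).
    rewrite -(ler_pM2l F0); apply: (@le_trans _ _ (nc (f z))).
      by apply: le_trans h2; rewrite le_eqVlt; apply/orP; left; apply/eqP; ring.
    by apply: le_trans h1 _; rewrite le_eqVlt; apply/orP; left; apply/eqP; ring.
  have P0 := nc_ge0 P1.[z]; have Q0 := nc_ge0 Q.[z].
  have h4 : nc P1.[z] * A1 <= nc P1.[z] * expR B by apply: ler_wpM2l.
  have h5 : nc Q.[z] * expR (- B) <= nc Q.[z] * A2 by apply: ler_wpM2l.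
  have h6 : 0 <= nc Q.[z] * expR (- B) by rewrite mulr_ge0 ?expR_ge0.
  have h7 : 0 <= nc P1.[z] * expR B by rewrite mulr_ge0 ?expR_ge0.
  have h8 : nc Q.[z] * expR (- B) <= 2 * (nc P1.[z] * expR B).
    have p1 : (1 - e) * (nc Q.[z] * expR (- B)) <= (1 - e) * (nc Q.[z] * A2) by apply: ler_wpM2l => //; lra.
    have p2 : (1 + e) * (nc P1.[z] * A1) <= (1 + e) * (nc P1.[z] * expR B) by apply: ler_wpM2l => //; lra.
    have p3 : 3 / 4 * (nc Q.[z] * expR (- B)) <= (1 - e) * (nc Q.[z] * expR (- B)).
      by apply: ler_wpM2r => //; lra.
    have p4 : (1 + e) * (nc P1.[z] * expR B) <= 5 / 4 * (nc P1.[z] * expR B).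
      by apply: ler_wpM2r => //; lra.
    lra.
  have eB := expR_gt0 B; rewrite -(ler_pM2r (expR_gt0 (- B))); apply: le_trans h8 _.
  have KE : K = 2 * (expR B * expR B).
    by rewrite /K -expRD; congr (_ * expR _); ring.
  have : K * nc P1.[z] * expR (- B) = 2 * (nc P1.[z] * expR B) * (expR B * expR (- B)).
    by rewrite KE; move: (expR B) (expR (- B)) (nc P1.[z]) => *; ring.
  by rewrite expRxMexpNx_1 mulr1 => ->.
have q0 : 0 < nc Q.[b] by rewrite nc_gt0.
have e1 : 0 < nc Q.[b] / (4 * K) by rewrite divr_gt0 // mulr_gt0.
have e2 : 0 < nc Q.[b] / 2 by rewrite divr_gt0.
have [t1 t10 ht1] := poly_shift_cvg P1 (nc b) e1.
have [t2 t20 ht2] := poly_shift_cvg Q (nc b) e2.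
pose t := Num.min (Num.min t1 t2) 1.
have t0 : 0 < t by rewrite !lt_min t10 t20 ltr01.
have [tt1 tt2 tt3] : [/\ t <= t1, t <= t2 & t <= 1] by rewrite /t !ge_min !lexx !orbT.
(* [key] cancels G, so b is approached through points where G is nonzero. At such a point |Q| is
   below |Q(b)|/4 by [key] and above |Q(b)|/2 by continuity. *)
have xi : injective (fun k : nat => b + (t / k.+1%:R)%:C).
  move=> j k /addrI [] /(mulfI (lt0r_neq0 t0)) /invr_inj /eqP.
  by rewrite eqr_nat eqSS => /eqP.
have [k Gk] := poly_avoid G0 xi.
set h := (t / k.+1%:R)%:C in Gk.
have ht : nc h <= t.
  rewrite /h ncR ger0_norm ?divr_ge0 ?(ltW t0) // ler_pdivrMr ?ltr0n //.
  by rewrite ler_peMr ?(ltW t0) // ler1n.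
have k1 := key h (le_trans ht tt3) Gk.
have k2 := ht1 b h (lexx _) (le_trans ht tt1).
have k3 := ht2 b h (lexx _) (le_trans ht tt2).
have Pb : P1.[b] = 0 by apply/eqP; rewrite -rootE.
have K4 : 0 < 4 * K by rewrite mulr_gt0.
rewrite Pb subr0 ltr_pdivlMr // in k2.
have := ncD (Q.[b] - Q.[b + h]) Q.[b + h]; rewrite subrK (nc_sub Q.[b]); lra.
Qed.

(** The zeros of P1 are far by [far_roots], so [far_product] merges P1 into the Gaussian and only
    the real G stays a polynomial. The centre moves back from z0 to 0. *)
Lemma strip_near_form mu f w (rad eps : R) : 0 <= mu -> Sbar mu f -> f w != 0 ->
  (forall z, f z^*%C = (f z)^*%C) -> 0 < rad -> 0 < eps -> eps <= 1 / 4 ->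
  exists (G : {poly R[i]}) (kappa beta sg : R[i]),
    [/\ G != 0 /\ kappa != 0, conj_poly G = G, zeros_in_strip mu G,
      0 <= complex.Re sg /\ `|complex.Im sg| <= eps &
      forall z, nc z <= rad -> close eps (f z) (kappa * G.[z] * gauss beta sg z)].
Proof.
move=> m0 fS fw fR rad0 eps0 eps4.
have [z0 my fz] := strip_base_point m0 fS fw.
have [C C0 hC] := strip_normal_form m0 fS my fz.
set y0 := complex.Im z0 in my hC; have nz0 := nc_ge0 z0.
pose e := eps / 3; have e0 : 0 < e by rewrite divr_gt0.
have e14 : e <= 1 / 4 by rewrite /e; lra.
pose R1 := rad + nc z0; have R10 : 0 < R1 by rewrite /R1; lra.
pose Y := 2 * (y0 + mu); have Y0 : 0 <= Y by rewrite mulr_ge0 //; lra.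
have [eta eta0 [e1 e2 e3 e4]] := choose_small R10 C0 Y0 e0.
(* The excess over 1/eta lets [far_roots] place every zero of P1 at distance at least 1/eta from z0,
   that is |r| <= eta; eta depends on C but not on rr. *)
pose rr := R1 + eta^-1 + 2 * nc z0 + 1.
have etai : 0 < eta^-1 by rewrite invr_gt0.
have rr0 : 0 < rr by rewrite /rr; lra.
have [s [S [sg [s1 s2 s3 s4 s5]]]] := hC rr e rr0 e0.
pose P : {poly R[i]} := \prod_(r <- s) (1 + r *: ('X - z0%:P)).
have PE u : P.[z0 + u] = \prod_(r <- s) (1 + u * r).
  rewrite horner_prod; apply: eq_bigr => r _.
  by rewrite hornerD hornerZ hornerXsubC hornerC [z0 + u]addrC addrK mulrC.
have Pz0 : P.[z0] = 1.
  by rewrite -[z0]addr0 PE big1 // => r _; rewrite mul0r addr0.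
have P0 : P != 0 by apply: contra_eq_neq Pz0 => ->; rewrite horner0 eq_sym oner_eq0.
have [G [P1 [G0 GR PG co]]] := real_gcd P0.
have hf u : nc u <= rr -> close e (f (z0 + u)) (f z0 * P.[z0 + u] * gauss S sg u).
  by move=> ur; rewrite PE; exact: s5.
have qrr : eta^-1 + 2 * nc z0 + 1 <= rr by rewrite /rr; clear -R10; lra.
have far := far_roots (ltW e0) e14 fR fz G0 GR PG co qrr hf.
pose s0 := [seq r <- s | r != 0].
have PX : P = (\prod_(r <- s0) r) *: \prod_(r <- s0) ('X - (z0 - r^-1)%:P).
  have -> : P = \prod_(r <- s0) (1 + r *: ('X - z0%:P)).
    rewrite /P /s0 big_filter [RHS]big_mkcond; apply: eq_bigr => r _.
    by have [->|//] := eqVneq r 0; rewrite scale0r addr0.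
  have : all (fun r => r != 0) s0 by exact: filter_all.
  elim: (s0) => [|r t IH] /=; first by rewrite !big_nil scale1r.
  move=> /andP[r0 /IH {}IH]; rewrite !big_cons IH.
  have -> : 1 + r *: ('X - z0%:P) = r *: ('X - (z0 - r^-1)%:P) :> {poly R[i]}.
    by apply/polyP => k; rewrite !(coefD, coefN, coefZ, coefC, coefX); case: eqP => _; field.
  by rewrite -scalerAl -scalerAr scalerA.
have Gs : zeros_in_strip mu G.
  move=> b rb; have : root P b by rewrite PG rootM rb orbT.
  rewrite PX rootZ; last by rewrite prodf_seq_neq0 filter_all.
  rewrite -(big_map (fun r => z0 - r^-1) xpredT (fun a => 'X - a%:P)) root_prod_XsubC => /mapP[r].
  rewrite mem_filter => /andP[r0 rs] ->; exact: strip_inv_root r0 (s1 r rs).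
have Pd : P1 %| \prod_(r <- s0) ('X - (z0 - r^-1)%:P).
  have s00 : \prod_(r <- s0) r != 0 by rewrite prodf_seq_neq0 filter_all.
  by rewrite -(dvdpZr _ _ s00) -PX PG dvdp_mulr.
have [m mE] := dvdp_prod_XsubC Pd.
pose t := mask m s0.
have ts r : r \in t -> r != 0 /\ r \in s.
  by move=> /mem_mask; rewrite mem_filter => /andP.
have P1E : P1 = lead_coef P1 *: \prod_(r <- t) ('X - (z0 - r^-1)%:P).
  have mo : \prod_(r <- t) ('X - (z0 - r^-1)%:P) \is monic by exact: monic_prod_XsubC.
  by have := eqp_eq mE; rewrite -/t (monicP mo) scale1r.
have t_eta r : r \in t -> nc r <= eta.
  move=> rt; have [r0 rs] := ts r rt; have : root P1 (z0 - r^-1).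
    rewrite P1E rootZ; last by rewrite lead_coef_eq0; apply: contraNneq P0 => P10; rewrite PG P10 mul0r.
    by rewrite -(big_map (fun r => z0 - r^-1) xpredT (fun a => 'X - a%:P)) root_prod_XsubC; apply/mapP; exists r.
  move=> /far; rewrite addrAC subrr sub0r ncN ncV lef_pV2 ?posrE ?nc_gt0 //.
have tC : \sum_(r <- t) nc r ^+ 2 <= C.
  apply: le_trans (sum_mask_le m s0 (fun r => sqr_ge0 (nc r))) _; apply: le_trans s2.
  rewrite big_filter big_mkcond; apply: ler_sum => r _; case: ifP => // _; exact: sqr_ge0.
have P1u u : P1.[z0 + u] = P1.[z0] * \prod_(r <- t) (1 + u * r).
  rewrite P1E !hornerZ -mulrA; congr (_ * _); rewrite !horner_prod -big_split /=.
  rewrite big_seq [RHS]big_seq; apply: eq_bigr => r rt; rewrite !hornerXsubC.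
  by have [r0 _] := ts r rt; field.
pose S' := \sum_(r <- t) r; pose g' := \sum_(r <- t) r ^+ 2.
have tsq r : r \in t -> 0 <= complex.Re (r ^+ 2) /\ `|complex.Im (r ^+ 2)| <= Y * eta * nc r ^+ 2.
  by move=> rt; have [_ rs] := ts r rt; exact: strip_inv_sqr m0 my (s1 r rs) (t_eta r rt) e3.
have g'0 : 0 <= complex.Re g'.
  by rewrite Re_sum big_seq; apply: sumr_ge0 => r rt; have [] := tsq r rt.
have g'i : `|complex.Im g'| <= e.
  rewrite Im_sum; apply: le_trans (ler_norm_sum _ _ _) _; apply: le_trans e4.
  have ye : 0 <= Y * eta by rewrite mulr_ge0 // ltW.
  apply: le_trans (ler_wpM2l ye tC); rewrite mulr_sumr big_seq [leRHS]big_seq.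
  by apply: ler_sum => r rt; have [] := tsq r rt.
(* Expansion of the exponent at u = z - z0: the cross term of u^2 shifts the linear coefficient, and
   the constant term goes into [K0]. *)
pose beta := S + S' + (sg + g') * z0.
pose K0 := cexp (- ((S + S') * z0 + (sg + g') * z0 ^+ 2 / 2)).
exists G, (f z0 * P1.[z0] * K0), beta, (sg + g'); split => //.
- split => //; apply: mulf_neq0; last exact: cexp_neq0.
  apply: mulf_neq0 => //; apply: contra_eq_neq Pz0 => h.
  by rewrite PG hornerM h mul0r eq_sym oner_eq0.
- rewrite ReD ImD; split; first lra.
  by apply: le_trans (ler_normD _ _) _; rewrite /e in s4 g'i; lra.
move=> z zr; pose u := z - z0; have zE : z = z0 + u by rewrite /u; ring.
have uR : nc u <= R1 by apply: le_trans (ncB _ _) _; rewrite /R1; lra.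
have urr : nc u <= rr by apply: le_trans uR _; rewrite /rr; lra.
have c1 := hf u urr; rewrite -zE in c1.
have c2 : close e (\prod_(r <- t) (1 + u * r)) (gauss S' g' u).
  apply: close_le (far_product (ltW eta0) t_eta tC _); first exact: e2 (nc_ge0 u) uR.
  by apply: le_trans e1; rewrite ler_wpM2r // ltW.
have c3 := closeMl (f z0 * P1.[z0] * G.[z] * gauss S sg u) c2.
have gE : f z0 * P1.[z0] * G.[z] * gauss S sg u * gauss S' g' u =
    f z0 * P1.[z0] * K0 * G.[z] * gauss beta (sg + g') z.
  have : gauss S sg u * gauss S' g' u = K0 * gauss beta (sg + g') z.
    by rewrite -gaussD /K0 /gauss -cexpD; congr cexp; rewrite /u /beta; field.
  by move=> h; rewrite -(mulrA _ (gauss S sg u)) h mulrA [_ * G.[z] * K0]mulrAC.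
rewrite gE in c3.
have fE : f z0 * P.[z] * gauss S sg u = f z0 * P1.[z0] * G.[z] * gauss S sg u * \prod_(r <- t) (1 + u * r).
  by rewrite PG hornerM {1}zE P1u; ring.
rewrite fE in c1.
apply: close_le (close_trans (ltW e0) c1 c3); rewrite /e.
have : eps * eps <= 1 / 4 * eps by apply: ler_wpM2r => //; exact: ltW.
by have := sqr_ge0 eps; lra.
Qed.

End RealFactor.

(** * Real polynomial approximants with zeros in the strip *)

Section RealApproximation.
Variable R : realType.
Implicit Types (z w u v : R[i]) (x y e : R) (f : R[i] -> R[i]).

(** A is nearly real and differs from kappa by a phase near 1, so kappa is nearly real: 12 e from
    the phase and one more e from A. *)
Lemma real_phase (kappa A : R[i]) (t e : R) : `|t| <= 3 * e -> 3 * e <= 1 / 2 ->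
  A = kappa * cexp ('i%C * t%:C) -> `|complex.Im A| <= e * nc A ->
  close (13 * e) (complex.Re kappa)%:C kappa.
Proof.
move=> te e2 AE hA.
have nt : nc ('i%C * t%:C) = `|t| by rewrite ncM ncR /= expr0n add0r expr1n sqrtr1 mul1r.
have c1 : close (4 * nc ('i%C * t%:C)) (cexp ('i%C * t%:C)) 1 by apply: close_cexp; rewrite nt; lra.
have nA : nc A = nc kappa.
  rewrite AE (ncM kappa) nc_cexp (_ : complex.Re _ = 0) ?expR0 ?mulr1 //.
  by rewrite ReM /=; ring.
have h : nc (A - kappa) <= 12 * e * nc kappa.
  have := closeMl kappa c1; rewrite /close -AE mulr1 nt => h; apply: le_trans h _.
  by apply: ler_wpM2r; [exact: nc_ge0|lra].
have -> : close (13 * e) (complex.Re kappa)%:C kappa = (`|complex.Im kappa| <= 13 * e * nc kappa).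
  rewrite /close; congr (is_true (_ <= _)).
  by case: kappa {AE nA h hA c1} => p q /=; rewrite subrr sub0r expr0n /= add0r sqrrN sqrtr_sqr.
have h2 := nc_ge_Im (A - kappa); rewrite ImD ImN in h2.
have h3 := ler_normB (complex.Im A) (complex.Im A - complex.Im kappa).
rewrite opprB addrC subrK in h3; rewrite nA in hA; lra.
Qed.

Lemma Im_conj_eq (z : R[i]) : z^*%C = z -> complex.Im z = 0.
Proof. by case: z => a b /= [] h; lra. Qed.

Lemma expR_double_small (x p : R) : 0 < x -> x <= 1 / 3 ->
  (1 - x) * expR (2 * p) <= 1 + x -> p <= x * 3 / 2.
Proof.
move=> x0 x1 h2.
have h3 : (1 - x) * (1 + 2 * p) <= (1 - x) * expR (2 * p).
  by apply: ler_wpM2l; [lra|exact: expR_ge1Dx].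
have h4 : (1 - x) * p <= x by lra.
have [p0|p0] := ltP p 0; first lra.
by have := ler_wpM2r p0 x1; lra.
Qed.

Lemma gauss_exponent (S s u : R[i]) :
  let: p +i* q := S in let: p' +i* q' := s in let: x +i* y := u in
  S * u - s * u ^+ 2 / 2 =
    (p * x - q * y - (p' * (x ^+ 2 - y ^+ 2) - 2 * q' * x * y) / 2) +i*
    (p * y + q * x - (q' * (x ^+ 2 - y ^+ 2) + 2 * p' * x * y) / 2).
Proof.
case: S s u => [p q] [p' q'] [x y].
have -> : 2^-1 = (2^-1)%:C :> R[i] by rewrite fmorphV /= rmorph_nat.
by rewrite expr2; apply/eqP; rewrite eq_complex /=; apply/andP; split; apply/eqP; field.
Qed.

(** Reality of f pins down the constants: |f(iy)| = |f(-iy)| makes Im beta small, a real point makes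
    kappa nearly real, and Im sg is small already. All three are then replaced by their real
    parts. *)
Lemma strip_real_form mu f w (rad e : R) : 0 <= mu -> Sbar mu f -> f w != 0 ->
  (forall z, f z^*%C = (f z)^*%C) -> 2 <= rad -> 0 < e -> e <= 1 / 2 ->
  exists (G : {poly R[i]}) (c b s : R),
    [/\ G != 0 /\ c != 0, conj_poly G = G, zeros_in_strip mu G, 0 <= s &
      forall z, nc z <= rad -> close e (f z) (c%:C * G.[z] * gauss b%:C s%:C z)].
Proof.
move=> m0 fS fw fR rad2 e0 e2.
(* The imaginary parts of beta and sg contribute an exponent of size at most eps (1 + rad)^2, hence
   a relative error e/10; the 40 leaves 40 eps <= e for kappa and f. *)
pose D := 40 * (1 + rad) ^+ 2.
have D1 : 40 <= D.
  have : 3 ^+ 2 <= (1 + rad) ^+ 2 by rewrite lerXn2r ?nnegrE //; lra.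
  by rewrite /D; lra.
pose eps := e / D; have eps0 : 0 < eps by rewrite divr_gt0 //; lra.
have epsD : eps * D = e by rewrite /eps divfK //; lra.
have epse : 40 * eps <= e by rewrite -epsD mulrC ler_wpM2l // ltW.
have DE : D = 40 * (1 + rad) ^+ 2 by [].
clearbody eps D.
have eps4 : eps <= 1 / 4 by lra.
have rad0 : 0 < rad by lra.
have [G [kappa [beta [sg [[G0 k0] GR Gs [sg0 sgi] hf]]]]] := strip_near_form m0 fS fw fR rad0 eps0 eps4.
have GJ z : G.[z^*%C] = (G.[z])^*%C by exact: real_poly_conj.
set b2 := complex.Im beta; set s2 := complex.Im sg in sgi.
have b2e : `|b2| <= 2 * eps.
  (* Among these points one has G nonzero, so G cancels from the comparison; y >= 1 yields the bound
     on Im beta, and y <= 2 keeps the point in the disc. *)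
  have xi : injective (fun k : nat => 'i%C * (1 + k.+1%:R^-1)%:C : R[i]).
    move=> j k /(mulfI _) h; have i0 : ('i%C : R[i]) != 0 by rewrite eq_complex /= oner_eq0 andbF.
    by move: (h i0) => [] /addrI /invr_inj /eqP; rewrite eqr_nat eqSS => /eqP.
  have [k Gk] := poly_avoid G0 xi; set y := 1 + k.+1%:R^-1 in Gk.
  have ki : k.+1%:R^-1 <= 1 :> R by rewrite invf_le1 // ler1n.
  have ki0 : 0 <= k.+1%:R^-1 :> R by rewrite invr_ge0.
  have y1 : 1 <= y by rewrite /y lerDl.
  have y2 : y <= rad by rewrite /y; apply: le_trans rad2; rewrite [leRHS](_ : 2 = 1 + 1) ?lerD2l //; lra.
  set z := 'i%C * y%:C in Gk.
  have nz : nc z = y by rewrite ncM ncR /= expr0n add0r expr1n sqrtr1 mul1r ger0_norm //; lra.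
  have zr : nc z <= rad by rewrite nz.
  have zr' : nc z^*%C <= rad by rewrite ncJ.
  have [l1 u1] := close_nc (hf z zr); have [l2 u2] := close_nc (hf _ zr').
  rewrite fR GJ ncJ in l2 u2.
  set V := complex.Re sg * y ^+ 2 / 2.
  have zE : z = 0 +i* y by rewrite /z; apply/eqP; rewrite eq_complex /=; apply/andP; split; apply/eqP; ring.
  have g1 : nc (gauss beta sg z) = expR (- b2 * y + V).
    rewrite /gauss nc_cexp; congr expR; rewrite zE /b2 /V.
    by have := gauss_exponent beta sg (0 +i* y); case: (beta) (sg) => [p q] [p' q'] -> /=; field.
  have g2 : nc (gauss beta sg z^*%C) = expR (b2 * y + V).
    rewrite /gauss nc_cexp; congr expR; rewrite zE /b2 /V.
    by have := gauss_exponent beta sg (0 +i* - y); case: (beta) (sg) => [p q] [p' q'] -> /=; field.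
  rewrite (ncM (kappa * _)) (ncM kappa) g1 in l1 u1.
  rewrite (ncM (kappa * _)) (ncM kappa) ncJ g2 in l2 u2.
  have N0 : 0 < nc kappa * nc G.[z] by rewrite mulr_gt0 ?nc_gt0.
  have both (p : R) : (1 - eps) * (nc kappa * nc G.[z] * expR (p + V)) <=
      (1 + eps) * (nc kappa * nc G.[z] * expR (- p + V)) -> p <= eps * 3 / 2.
    move=> h; have h1 : (1 - eps) * expR (p + V) <= (1 + eps) * expR (- p + V).
      by rewrite -(ler_pM2l N0) mulrCA [leRHS]mulrCA.
    have h2 : (1 - eps) * expR (2 * p) <= 1 + eps.
      rewrite -(ler_pM2r (expR_gt0 (- p + V))) -mulrA -expRD.
      by rewrite (_ : 2 * p + (- p + V) = p + V) //; ring.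
    by apply: expR_double_small h2 => //; lra.
  rewrite (mulNr b2) in l1 u1.
  have p1 : b2 * y <= eps * 3 / 2 by apply: both; exact: le_trans l2 u1.
  have p2 : - (b2 * y) <= eps * 3 / 2 by apply: both; rewrite opprK; exact: le_trans l1 u2.
  rewrite ler_norml; apply/andP; split; nra.
have kc : close (13 * eps) (complex.Re kappa)%:C kappa.
  have xi : injective (fun k : nat => (k.+1%:R^-1)%:C : R[i]).
    by move=> j k [] /invr_inj /eqP; rewrite eqr_nat eqSS => /eqP.
  have [k Gk] := poly_avoid G0 xi; set x := k.+1%:R^-1 in Gk.
  have x0 : 0 <= x by rewrite invr_ge0.
  have x1 : x <= 1 by rewrite invf_le1 // ler1n.
  pose t := b2 * x - s2 * x ^+ 2 / 2.
  pose E := expR (complex.Re beta * x - complex.Re sg * x ^+ 2 / 2).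
  have E0 : 0 < E by exact: expR_gt0.
  have gE : gauss beta sg x%:C = E%:C * cexp ('i%C * t%:C).
    rewrite /E -cexpR -cexpD /gauss /t /b2 /s2; congr cexp.
    have := gauss_exponent beta sg (x +i* 0); case: (beta) (sg) => [p q] [p' q'] -> /=.
    by apply/eqP; rewrite eq_complex /=; apply/andP; split; apply/eqP; field.
  have xr : nc x%:C <= rad by rewrite ncR ger0_norm //; lra.
  have xJ : (x%:C)^*%C = x%:C :> R[i] by rewrite /= oppr0.
  have fx : complex.Im (f x%:C) = 0 by apply: Im_conj_eq; rewrite -fR xJ.
  have Gx : complex.Im G.[x%:C] = 0 by apply: Im_conj_eq; rewrite -GJ xJ.
  have GxE : G.[x%:C] = (complex.Re G.[x%:C])%:C by move: Gx; case: (G.[_]) => p q /= ->.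
  set gx := complex.Re G.[x%:C] in GxE.
  have gx0 : gx != 0 by move: Gk; rewrite GxE; apply: contra_neq => ->.
  apply: (@real_phase _ (kappa * cexp ('i%C * t%:C)) t eps) => //.
  - apply: le_trans (ler_normB _ _) _; rewrite (normrM b2) (normrM (s2 * _)) (normrM s2) (ger0_norm x0) (ger0_norm (sqr_ge0 x)).
    have h1 : `|b2| * x <= 2 * eps * 1 by apply: ler_pM.
    have x2 : x ^+ 2 <= 1 by rewrite exprn_ile1.
    have h2 : `|s2| * x ^+ 2 <= eps * 1 by apply: ler_pM => //; exact: sqr_ge0.
    by rewrite (@ger0_norm _ 2^-1) ?invr_ge0 //; lra.
  - lra.
  have := hf _ xr; rewrite /close gE GxE => h.
  set A := kappa * cexp _.
  have AE : kappa * gx%:C * (E%:C * cexp ('i%C * t%:C)) = (gx * E)%:C * A.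
    by rewrite /A rmorphM /=; ring.
  rewrite AE in h.
  have gE0 : 0 < `|gx * E| by rewrite normr_gt0 mulf_neq0 // gt_eqF.
  have h2 := le_trans (nc_ge_Im _) h; rewrite ImD ImN fx sub0r normrN ImM /= mul0r addr0 in h2.
  rewrite (ncM (_%:C)) ncR normrM mulrCA ler_pM2l // in h2.
pose D2 := 4 * (eps * (1 + rad) ^+ 2).
have D2E : D2 = e / 10 by rewrite /D2 -epsD DE; field.
have gc z : nc z <= rad -> close D2 (gauss beta sg z) (gauss (complex.Re beta)%:C (complex.Re sg)%:C z).
  move=> zr; have -> : gauss beta sg z = gauss (complex.Re beta)%:C (complex.Re sg)%:C z *
     gauss ('i%C * b2%:C) ('i%C * s2%:C) z by rewrite -gaussD -!complexE.
  rewrite -[X in close _ _ X]mulr1; apply: closeMl.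
  set W := 'i%C * b2%:C * z - 'i%C * s2%:C * z ^+ 2 / 2.
  have n2 : nc (2 : R[i]) = 2 by rewrite ncM_nat.
  have ni : nc ('i%C : R[i]) = 1 by rewrite /= expr0n add0r expr1n sqrtr1.
  have zn := nc_ge0 z.
  have Wn : nc W <= eps * (1 + rad) ^+ 2.
    apply: le_trans (ncB _ _) _.
    rewrite (ncM (_ * _) z) (ncM 'i%C) ni mul1r (ncM (_ * _ ^+ 2)) (ncM (_ * _) (z ^+ 2)) (ncM 'i%C) ni mul1r ncV n2 !ncR ncX.
    have h1 : `|b2| * nc z <= 2 * eps * rad by apply: ler_pM.
    have z2 : nc z ^+ 2 <= rad ^+ 2 by rewrite lerXn2r ?nnegrE //; lra.
    have h2 : `|s2| * nc z ^+ 2 <= eps * rad ^+ 2 by apply: ler_pM => //; exact: sqr_ge0.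
    have := mulr_ge0 (ltW eps0) (sqr_ge0 rad); lra.
  have W2 : nc W <= 1 / 2 by apply: le_trans Wn _; rewrite /D2 in D2E; lra.
  by apply: close_le (close_cexp W2); rewrite /D2; lra.
have c0 : complex.Re kappa != 0.
  apply: contraTneq kc => ->; rewrite /close sub0r ncN -ltNge.
  by have := nc_gt0 kappa; rewrite k0 => h; rewrite gtr_pMl //; lra.
exists G, (complex.Re kappa), (complex.Re beta), (complex.Re sg); split => // z zr.
have kc' : close (26 * eps) kappa (complex.Re kappa)%:C.
  have p1 : 0 <= 13 * eps by lra.
  have p2 : 13 * eps <= 1 / 2 by lra.
  by apply: close_le (close_sym p1 p2 kc); lra.
have p3 : 0 <= 26 * eps by lra.
have m1 := closeM p3 kc' (closeMl G.[z] (gc z zr)).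
rewrite (mulrA kappa) (mulrA (_%:C)) in m1; have m2 := close_trans (ltW eps0) (hf z zr) m1.
apply: close_le m2; rewrite D2E.
have q1 : 26 * eps * (e / 10) <= 2 * eps by clear -eps0 e2; nra.
have q2 : eps * (26 * eps + e / 10 + 26 * eps * (e / 10)) <= eps * 1 by apply: ler_wpM2l; [exact: ltW|lra].
lra.
Qed.

(** Relative form of [compound_cexp]: dividing by |e^w| >= e^(-W) doubles W in the exponent. *)
Lemma compound_close n (W : R) w : nc w <= W -> 2 * W <= n.+1%:R ->
  close (6 * W ^+ 2 * expR (2 * W) / n.+1%:R) ((1 + w / n.+1%:R) ^+ n.+1) (cexp w).
Proof.
move=> wW W2; have w0 := nc_ge0 w; have W0 : 0 <= W by apply: le_trans wW.
have n0 : 0 < n.+1%:R :> R by rewrite ltr0n.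
rewrite /close; apply: le_trans (compound_cexp _) _; first by apply: le_trans W2; lra.
have h1 : expR (- W) <= nc (cexp w).
  rewrite nc_cexp ler_expR; have := nc_ge_Re w; rewrite ler_norml => /andP[h _]; lra.
have h2 : 6 * nc w ^+ 2 * expR (nc w) <= 6 * W ^+ 2 * expR (2 * W) * expR (- W).
  rewrite -[leRHS]mulrA -expRD (_ : 2 * W + - W = W); last by ring.
  apply: ler_pM; rewrite ?expR_ge0 ?ler_expR ?mulr_ge0 ?sqr_ge0 //.
  by rewrite ler_wpM2l // lerXn2r ?nnegrE.
rewrite [leRHS](_ : _ = 6 * W ^+ 2 * expR (2 * W) * nc (cexp w) / n.+1%:R); last by ring.
rewrite ler_pM2r ?invr_gt0 //; apply: le_trans h2 _; apply: ler_wpM2l => //.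
by rewrite !mulr_ge0 ?expR_ge0 ?sqr_ge0.
Qed.

Definition compound_square (s : R) (n : nat) : {poly R[i]} :=
  (1 + (- (s / 2) / n.+1%:R)%:C *: 'X^2) ^+ n.+1.

Lemma horner_compound_square s n z :
  (compound_square s n).[z] = (1 + (- (s%:C * z ^+ 2 / 2)) / n.+1%:R) ^+ n.+1.
Proof.
rewrite horner_exp hornerD hornerC hornerZ hornerXn; congr (_ ^+ _); congr (_ + _).
rewrite rmorphM rmorphN rmorphM !fmorphV !rmorph_nat; field.
by rewrite addrC natr1 pnatr_eq0.
Qed.

(** The sign of s decides: for s >= 0 the polynomial replacing e^(-s z^2/2) has only real zeros. The
    degree is kept positive because strict domination after the shift requires a zero. *)
Lemma real_strip_approx mu f : 0 <= mu -> SbarR mu f -> forall r e : R, 0 < e ->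
  exists q : {poly R[i]}, [/\ conj_poly q = q, (1 < size q)%N, zeros_in_strip mu q &
    forall z, nc z <= r -> nc (q.[z] - f z) < e].
Proof.
move=> m0 [[cf tf] fS fRx] r e e0.
pose ell (x : R) : {poly R[i]} := 1 + x%:C *: 'X.
have ellR x : conj_poly (ell x) = ell x.
  by rewrite /conj_poly /ell rmorphD rmorph1 /= map_polyZ map_polyX /= oppr0.
have ellz (x : R) z : (ell x).[z] = 1 + x%:C * z by rewrite !hornerE.
have rX (A : {poly R[i]}) m z : root (A ^+ m.+1) z = root A z by rewrite !rootE horner_exp expf_eq0.
have cM (A B : {poly R[i]}) : conj_poly (A * B) = conj_poly A * conj_poly B by rewrite /conj_poly rmorphM.
have cC (x : R) : conj_poly (x%:C)%:P = (x%:C)%:P by rewrite /conj_poly map_polyC /= oppr0.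
have ell_strip x z : root (ell x) z -> complex.Im z = 0.
  rewrite rootE ellz => /eqP h; have := congr1 (@complex.Im R) h; have := congr1 (@complex.Re R) h.
  rewrite ReD ImD ReM ImM /= => h1 h2.
  have x0 : x != 0 by apply: contra_eq_neq h1 => ->; rewrite !mul0r subr0 addr0 oner_eq0.
  by apply: (mulfI x0); lra.
have ell_size (x : R) (A : {poly R[i]}) : x != 0 -> A != 0 -> (1 < size (A * ell x)%R)%N.
  move=> x0 A0; have s2 : size (ell x) = 2%N.
    have xc : x%:C != 0 :> R[i] by rewrite eq_complex /= (negPf x0).
    by rewrite /ell addrC size_polyDl ?(size_scale _ xc) ?size_polyX ?size_poly1.
  rewrite size_mul // ?s2; last by rewrite -size_poly_eq0 s2.
  by rewrite addn2 /= ltnS size_poly_gt0.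
have [[w fw]|f0] := pselect (exists w, f w != 0); last first.
  have fz z : f z = 0 by apply/eqP; apply: contra_notT f0 => h; exists z.
  have r2 : 0 < 2 + `|r| by rewrite ltr_wpDr.
  pose c := e / (2 + `|r|); have c0 : 0 < c by rewrite divr_gt0.
  (* The zero function is approached by small multiples of 1 + z. *)
  exists ((c%:C)%:P * ell 1); split.
  - by rewrite cM cC ellR.
  - by apply: ell_size; rewrite ?oner_neq0 // polyC_eq0 eq_complex /= gt_eqF.
  - move=> z; rewrite rootM => /orP[|/ell_strip ->]; last by rewrite normr0.
    by rewrite rootC eq_complex /= gt_eqF.
  move=> z zr; rewrite fz subr0 hornerM hornerC ellz mul1r ncM ncR gtr0_norm //.
  have h : nc (1 + z) <= 1 + `|r|.
    by apply: le_trans (ncD _ _) _; rewrite nc1 lerD2l (le_trans zr) // ler_norm.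
  apply: (@le_lt_trans _ _ (c * (1 + `|r|))); first by rewrite ler_wpM2l // ltW.
  by rewrite /c -mulrAC ltr_pdivrMr // ltr_pM2l //; lra.
have cR := real_taylor tf fRx; have fR z := taylor_conj z tf cR.
pose rad := `|r| + 2; have r0 := normr_ge0 r; have rad2 : 2 <= rad by rewrite /rad; lra.
have [M M0 hM] := Sbar_bounded rad fS.
(* Both q and f will differ from Q by at most e1 |Q|, and |Q| <= 2 M, so the total error is at most
   4 M e1 < e. *)
pose e1 := Num.min (1 / 2) (e / (8 * (M + 1))).
have M1 : 0 < M + 1 by lra.
have e10 : 0 < e1 by rewrite lt_min divr_gt0 //= divr_gt0 // mulr_gt0.
have e12 : e1 <= 1 / 2 by rewrite /e1 ge_min lexx.
have e1e : e1 * (8 * (M + 1)) <= e by rewrite -ler_pdivlMr ?mulr_gt0 // /e1 ge_min lexx orbT.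
have [G [c [b [s [[G0 c0] GR Gs s0 hf]]]]] := strip_real_form m0 fS fw fR rad2 e10 e12.
pose W := `|b| * rad + s * rad ^+ 2.
have rad0 : 0 <= rad by lra.
have W1 : 0 <= `|b| * rad by rewrite mulr_ge0.
have W2 : 0 <= s * rad ^+ 2 by rewrite mulr_ge0 ?sqr_ge0.
have W0 : 0 <= W by rewrite /W addr_ge0.
(* Three factors of relative error e3 give 3 e3 + 3 e3^2 + e3^3 <= 7 e3. *)
pose e3 := e1 / 7; have e30 : 0 < e3 by rewrite divr_gt0.
have [n [n1 n2 n3]] : exists n : nat, [/\ 2 * W <= n.+1%:R,
    6 * W ^+ 2 * expR (2 * W) / n.+1%:R <= e3 & rad / n.+1%:R <= e3].
  have ev (x : R) : \forall n \near \oo, x / n.+1%:R <= e3.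
    have /cvgrPdist_lt /(_ _ e30) := @cvg_harmonicZ R x; apply: filterS => n.
    by rewrite sub0r normrN => h; apply: le_trans (ltW h); exact: ler_norm.
  near \oo => n; exists n; split.
  - by apply: (@le_trans _ _ n%:R); [near: n; exact: nbhs_infty_ger|rewrite ler_nat].
  - by near: n; exact: ev.
  - by near: n; exact: ev.
have N0 : n.+1%:R != 0 :> R by rewrite pnatr_eq0.
have Np : 0 < n.+1%:R :> R by rewrite ltr0n.
pose B := ell (b / n.+1%:R) ^+ n.+1; pose S := compound_square s n.
pose A := (c%:C)%:P * G * B * S.
have Bz z : B.[z] = (1 + (b%:C * z) / n.+1%:R) ^+ n.+1.
  by rewrite horner_exp ellz rmorphM fmorphV /= rmorph_nat mulrAC.
have B0 : B != 0.
  have : B.[0] != 0 by rewrite Bz mulr0 mul0r addr0 expr1n oner_eq0.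
  by apply: contraNneq => ->; rewrite horner0.
have S0 : S != 0.
  have : S.[0] != 0.
    by rewrite horner_compound_square expr0n /= mulr0 mul0r oppr0 mul0r addr0 expr1n oner_eq0.
  by apply: contraNneq => ->; rewrite horner0.
have cP : (c%:C)%:P != 0 :> {poly R[i]} by rewrite polyC_eq0 eq_complex /= (negPf c0).
have A0 : A != 0 by rewrite !mulf_neq0.
have SR : conj_poly S = S.
  rewrite /conj_poly rmorphXn rmorphD rmorph1 /= map_polyZ map_polyXn.
  by rewrite /= oppr0.
have BR : conj_poly B = B by rewrite {1}/conj_poly rmorphXn /= -/(conj_poly _) ellR.
(* The extra factor 1 + z/(n+1) is close to 1 on the disc and guarantees a real zero even when A is
   constant. *)
exists (A * ell n.+1%:R^-1); split.
- by rewrite !cM cC GR BR SR ellR.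
- by apply: ell_size; rewrite ?invr_neq0.
- move=> z; rewrite !rootM rootC eq_complex /= (negPf c0) /= => /orP[/orP[/orP[]|]|].
  + exact: Gs.
  + by rewrite /B rX => /ell_strip ->; rewrite normr0.
  + rewrite /S /compound_square rX rootE hornerD hornerC hornerZ hornerXn => /eqP h.
    have s1 := congr1 (@complex.Re R) h; have s2 := congr1 (@complex.Im R) h.
    suff -> : complex.Im z = 0 by rewrite normr0.
    move: s1 s2; rewrite expr2 ReD ImD !(ReM, ImM) /=; set k := - (s / 2) / _.
    case: (z) => x y /= h1 h2.
    have k0 : k <= 0 by rewrite /k mulr_le0_ge0 ?invr_ge0 // oppr_le0 divr_ge0.
    have kn : k != 0 by apply: contra_eq_neq h1 => ->; rewrite !mul0r subr0 addr0 oner_eq0.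
    have xy : x * y = 0 by apply: (mulfI kn); lra.
    have := mulf_eq0 x y; rewrite xy eqxx => /esym /orP[/eqP x0|/eqP //].
    have : k * (y * y) = 1 by move: h1; rewrite x0; lra.
    by have := mulr_le0_ge0 k0 (_ : 0 <= y * y); rewrite -expr2 sqr_ge0 => /(_ isT); lra.
  + by move=> /ell_strip ->; rewrite normr0.
move=> z zr; have zrad : nc z <= rad by apply: le_trans zr _; apply: le_trans (ler_norm r) _; rewrite /rad; lra.
have zn := nc_ge0 z.
have f1 := hf z zrad.
set Q := c%:C * G.[z] * gauss b%:C s%:C z in f1.
have cb : close e3 B.[z] (cexp (b%:C * z)).
  rewrite Bz; apply: close_le n2 (compound_close _ n1).
  rewrite ncM ncR; have : `|b| * nc z <= `|b| * rad by apply: ler_wpM2l.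
  by rewrite /W; lra.
have cs : close e3 S.[z] (cexp (- (s%:C * z ^+ 2 / 2))).
  rewrite horner_compound_square; apply: close_le n2 (compound_close _ n1).
  have nn2 : nc (2 : R[i]) = 2 by rewrite ncM_nat.
  rewrite ncN (ncM (_ * _)) (ncM s%:C) ncV nn2 ncR ncX ger0_norm //.
  have z2 : nc z ^+ 2 <= rad ^+ 2 by rewrite lerXn2r ?nnegrE.
  have := ler_wpM2l s0 z2; have := mulr_ge0 s0 (sqr_ge0 (nc z)); rewrite /W; lra.
have cl : close e3 (ell n.+1%:R^-1).[z] 1.
  rewrite /close ellz addrAC subrr add0r nc1 mulr1 ncM ncR ger0_norm ?invr_ge0 //.
  by apply: le_trans n3; rewrite mulrC ler_wpM2r ?invr_ge0.
have c1 := closeM (ltW e30) cb cs.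
have p1 : 0 <= e3 + e3 + e3 * e3 by have := mulr_ge0 (ltW e30) (ltW e30); lra.
have c2 := closeMl (c%:C * G.[z]) (closeM p1 c1 cl).
have qE : c%:C * G.[z] * (B.[z] * S.[z] * (ell n.+1%:R^-1).[z]) = (A * ell n.+1%:R^-1).[z].
  by rewrite /A !hornerM hornerC; ring.
have QE : c%:C * G.[z] * (cexp (b%:C * z) * cexp (- (s%:C * z ^+ 2 / 2)) * 1) = Q.
  by rewrite mulr1 -cexpD /Q /gauss.
rewrite qE QE in c2; set q := (A * ell _).[z] in c2 *.
have e31 : e3 <= 1 by rewrite /e3; lra.
have e33 : e3 * e3 <= e3 by rewrite ler_piMr // ltW.
have c3 : close e1 q Q.
  apply: close_le c2; have : e3 * e3 * e3 <= e3 by apply: le_trans e33; rewrite ler_piMr // mulr_ge0 // ltW.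
  have e7 : e1 = 7 * e3 by rewrite /e3; field.
  by move: e33 e7; move: (e3) (e1) => u v; lra.
have [f2 _] := close_nc f1; have Q0 := nc_ge0 Q.
have Q2 : nc Q <= 2 * M.
  have h : 1 / 2 * nc Q <= (1 - e1) * nc Q by apply: ler_wpM2r => //; lra.
  have := hM z zrad; lra.
have := ncB (q - Q) (f z - Q); rewrite opprB addrA subrK => h.
apply: le_lt_trans h _; rewrite /close in c3 f1.
have h4 : e1 * nc Q <= e1 * (2 * M) by apply: ler_wpM2l => //; exact: ltW.
have := mulr_ge0 (ltW e10) M0; nra.
Unshelve. all: by end_near. Qed.

End RealApproximation.

(** * Continuity of the operators, and the theorem *)

Section Assembly.
Variable R : realType.
Implicit Types (z w u v : R[i]) (x y e r : R) (f g : R[i] -> R[i]) (b c : nat -> R[i]).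

Lemma rho_gt0 x m : 0 < x -> 0 < rho x m.
Proof. by move=> x0; rewrite sqrtr_gt0 divr_gt0 ?exprn_gt0 // ltr0n fact_gt0. Qed.

Lemma diffop_partial_cvg b f : diffop_cvg b f ->
  forall z, diffop_partial b f n z @[n --> \oo] --> diffop b f z.
Proof.
move=> /compact_cvgP h z; apply/cvg_ncP => e e0.
by have := h (nc z) e e0; apply: filterS => n /(_ z); apply.
Qed.

Lemma diffop_dist b c f g z e :
  diffop_partial b f n z @[n --> \oo] --> diffop b f z ->
  diffop_partial c g n z @[n --> \oo] --> diffop c g z ->
  (forall n, nc (diffop_partial b f n z - diffop_partial c g n z) <= e) ->
  nc (diffop b f z - diffop c g z) <= e.
Proof.
move=> h1 h2 h.
have h3 := @cvgcB R nat \oo eventually_filter _ _ _ _ h1 h2.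
by apply: (@cvg_nc_le R nat \oo _ _ _ e h3); apply: filterE.
Qed.

Lemma diffopD b c f z : diffop_cvg b f -> diffop_cvg c f ->
  diffop_cvg (fun k => b k + c k) f ->
  diffop (fun k => b k + c k) f z = diffop b f z + diffop c f z.
Proof.
move=> /diffop_partial_cvg /(_ z) h1 /diffop_partial_cvg /(_ z) h2 /diffop_partial_cvg /(_ z) h3.
have h4 := @cvgcD R nat \oo eventually_filter _ _ _ _ h1 h2.
apply: (@cvg_unique_nc R nat \oo _ _ _ _ h3).
rewrite (_ : (fun n => _) = (fun n => diffop_partial b f n z + diffop_partial c f n z)) //.
apply/funext => n; rewrite /diffop_partial -big_split; apply: eq_bigr => k _.
by rewrite mulrDl.
Qed.

Lemma rho_diffop_cvg b c f (B M a y : R) : is_taylor c f -> 0 < a -> 0 < y -> 2 * y * a < 1 ->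
  (forall m, nc (c m) <= M * rho a m) -> 0 <= B -> (forall k, nc (b k) <= B * rho y k) ->
  diffop_cvg b f.
Proof.
move=> cf a0 y0 ya hM B0 hb; apply: diffop_geo_cvg => r.
have [K K0 hK] := derive1n_rho_bound cf a0 y0 ya (normr_ge0 r) hM.
exists (B * K), (Num.sqrt (2^-1 : R)); have [s0 s1] := sqrt_half_lt1 R; split => //.
move=> k z zr; rewrite ncM; have h := hK k z (le_trans zr (ler_norm r)).
apply: le_trans (ler_wpM2r (nc_ge0 _) (hb k)) _.
by rewrite -!mulrA; apply: ler_wpM2l => //; rewrite mulrC.
Qed.

Lemma derive1nB_taylor c d f g k z : is_taylor c f -> is_taylor d g ->
  derive1n k (fun w => f w - g w) z = derive1n k f z - derive1n k g z.
Proof.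
move=> cf dg.
have /(_ z) h1 : is_taylor _ (derive1n k f) := is_taylor_derive1n cf.
have /(_ z) h2 : is_taylor _ (derive1n k g) := is_taylor_derive1n dg.
have /(_ z) h3 : is_taylor _ (derive1n k (fun w => f w - g w)) := is_taylor_derive1n (is_taylorB cf dg).
have h4 := @cvgcB R nat \oo eventually_filter _ _ _ _ h1 h2.
apply: (@cvg_unique_nc R nat \oo _ _ _ _ h3).
rewrite (_ : series _ = (fun n => series (fun j => ((j + k) ^_ k)%:R * c (j + k)%N * z ^+ j) n -
  series (fun j => ((j + k) ^_ k)%:R * d (j + k)%N * z ^+ j) n)) //.
apply/funext => n; rewrite /series /= -sumrB; apply: eq_bigr => j _.
by rewrite mulrBr mulrBl.
Qed.

(** The symbol p(w) e^(uw) is of exponential type; the factorial it leaves over compensates the k!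
    of Cauchy's estimate for k-th derivatives. *)
Lemma exp_conv_bound (p : {poly R[i]}) (u : R[i]) : exists P L : R, [/\ 0 <= P, 1 <= L &
  forall k, nc (exp_conv (fun j => p`_j) u k) * k`!%:R <= P * L ^+ k].
Proof.
pose L := Num.max 1 (nc u); have L1 : 1 <= L by rewrite le_max lexx.
have L0 : 0 <= L by lra.
have uL : nc u <= L by rewrite le_max lexx orbT.
exists (\sum_(j < size p) nc p`_j * j`!%:R), (2 * L); split; [|lra|].
  by apply: sumr_ge0 => j _; rewrite mulr_ge0 ?nc_ge0.
move=> k; rewrite /exp_conv.
apply: le_trans (ler_wpM2r (ler0n _ _) (nc_sum _ _ _)) _; rewrite mulr_suml.
apply: (@le_trans _ _ (\sum_(j < k.+1) nc p`_j * j`!%:R * (2 * L) ^+ k)).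
  apply: ler_sum => j _; have jk : (j <= k)%N by rewrite -ltnS.
  have f0 : 0 < (k - j)`!%:R :> R by rewrite ltr0n fact_gt0.
  rewrite ncM -!mulrA; apply: ler_wpM2l; first exact: nc_ge0.
  have nf : nc ((k - j)`!%:R : R[i]) = (k - j)`!%:R by exact: ncM_nat.
  rewrite ncM ncV nf ncX exprMn.
  have h1 : nc u ^+ (k - j) <= L ^+ k.
    apply: (@le_trans _ _ (L ^+ (k - j))); first by rewrite lerXn2r ?nnegrE ?nc_ge0.
    by apply: ler_weXn2l => //; exact: leq_subr.
  have h2 : k`!%:R / (k - j)`!%:R <= 2 ^+ k * j`!%:R :> R.
    rewrite ler_pdivrMr // -natrX -!natrM ler_nat -(ffact_fact jk) leq_mul2r.
    by have := ffact_bin_le (k - j) j; rewrite subnK // => ->; rewrite orbT.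
  rewrite -mulrA (mulrC _^-1) [leRHS](_ : _ = L ^+ k * (2 ^+ k * j`!%:R)); last by ring.
  by apply: ler_pM => //; rewrite ?exprn_ge0 ?nc_ge0 // divr_ge0.
rewrite -mulr_suml; apply: ler_wpM2r; first by rewrite exprn_ge0 //; lra.
set F := fun j : nat => nc p`_j * j`!%:R.
have F0 j : 0 <= F j by rewrite /F mulr_ge0 ?nc_ge0.
have [kp|pk] := leqP k.+1 (size p).
  rewrite (big_ord_widen _ F kp) big_mkcond /=.
  by apply: ler_sum => j _; case: ifP => // _; exact: F0.
rewrite (big_ord_widen _ F (ltnW pk)) [leRHS]big_mkcond /=.
apply: ler_sum => j _; rewrite /F; case: ltnP => // h.
by rewrite nth_default // nc0 mul0r.
Qed.

Lemma diffop_near b c f (P L r e : R) : is_taylor c f -> diffop_cvg b f ->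
  0 <= P -> 1 <= L -> (forall k, nc (b k) * k`!%:R <= P * L ^+ k) -> 0 <= r -> 0 < e ->
  exists r' e' : R, 0 < e' /\ forall q : {poly R[i]},
    (forall z, nc z <= r' -> nc (q.[z] - f z) < e') ->
    forall z, nc z <= r -> nc (diffop b (horner q) z - diffop b f z) <= e.
Proof.
move=> cf bf P0 L1 hb r0 e0.
(* The k-th derivative of q - f is at most 2 e' k! (2/r')^k on the small disc. As r' >= 4 L, the
   operator series has ratio at most 1/2 and sum at most 4 e' P <= e. *)
pose r' := 4 * L * (1 + r); pose e' := e / (4 * (P + 1)).
have P1 : 0 < 4 * (P + 1) by lra.
have e'0 : 0 < e' by rewrite divr_gt0.
have Lr : 4 * r + 4 * L <= r' by rewrite /r'; have := ler_wpM2r r0 L1; lra.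
have r'0 : 0 < r' by lra.
have Pe : 4 * (e' * P) <= e.
  have h : e' * (4 * (P + 1)) = e by rewrite /e' divfK // gt_eqF.
  lra.
exists r', e'; split => // q hq z zr.
have dq := is_taylorB (@poly_is_taylor _ q) cf.
have ce := cauchy_estimate dq (ltW r'0) (fun z h => ltW (hq z h)).
have zr' : 4 * nc z <= r' by lra.
apply: diffop_dist.
- by rewrite diffop_poly; exact: diffop_partial_poly_cvg.
- exact: diffop_partial_cvg.
move=> n; rewrite /diffop_partial -sumrB; apply: le_trans (nc_sum _ _ _) _.
have h2 : 0 <= 1 / 2 :> R by lra.
have h21 : 1 / 2 < 1 :> R by lra.
apply: (@le_trans _ _ (\sum_(k < n) 2 * (e' * P) * (1 / 2) ^+ k)); last first.
  rewrite -mulr_sumr; have := sum_geom_le n h2 h21.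
  rewrite (_ : (1 - 1 / 2)^-1 = 2 :> R); last by field.
  have p0 : 0 <= 2 * (e' * P) by have := mulr_ge0 (ltW e'0) P0; lra.
  by move=> /(ler_wpM2l p0) => h; apply: le_trans h _; lra.
apply: ler_sum => k _; rewrite -mulrBr -(derive1nB_taylor _ _ (@poly_is_taylor _ q) cf) ncM.
have h := derive1n_bound k dq r'0 ce zr'.
apply: le_trans (ler_wpM2l (nc_ge0 _) h) _.
rewrite [leLHS](_ : _ = (2 * e') * (nc (b k) * k`!%:R * (2 / r') ^+ k)); last by ring.
rewrite [leRHS](_ : _ = (2 * e') * (P * (1 / 2) ^+ k)); last by ring.
apply: ler_wpM2l; first lra.
have q0 : 0 <= 2 / r' by rewrite divr_ge0 // ltW.
apply: le_trans (ler_wpM2r (exprn_ge0 k q0) (hb k)) _.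
rewrite -mulrA -exprMn; apply: ler_wpM2l => //.
have Lq : 0 <= L * (2 / r') by rewrite mulr_ge0 //; lra.
apply: lerXn2r; rewrite ?nnegrE //.
by rewrite mulrA ler_pdivrMr //; lra.
Qed.

(** Dominated convergence in k: |b n k - a_k| <= 2 B rho(y, k), while derivatives of f times rho(y,
    k) decay like 2^(-k/2) on the whole disc, so the majorant is independent of z. *)
Lemma diffop_limit (b : nat -> nat -> R[i]) (a_ c : nat -> R[i]) f (B M a y r e : R) :
  is_taylor c f -> 0 < a -> 0 < y -> 2 * y * a < 1 -> (forall m, nc (c m) <= M * rho a m) ->
  0 <= B -> (forall n k, nc (b n k) <= B * rho y k) -> (forall k, nc (a_ k) <= B * rho y k) ->
  (forall k, b n k @[n --> \oo] --> a_ k) -> 0 <= r -> 0 < e ->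
  exists n, forall z, nc z <= r -> nc (diffop (b n) f z - diffop a_ f z) <= e.
Proof.
move=> cf a0 y0 ya hM B0 hb ha hlim r0 e0.
have [K K0 hK] := derive1n_rho_bound cf a0 y0 ya r0 hM.
set s := Num.sqrt 2^-1 in hK; have [s0 s1] := sqrt_half_lt1 R; rewrite -/s in s0 s1.
pose C k := K * s ^+ k / rho y k.
have C0 k : 0 <= C k by rewrite divr_ge0 ?rho_ge0 // mulr_ge0 // exprn_ge0.
pose x n k := nc (b n k - a_ k) * C k.
have x0 n k : 0 <= x n k <= 2 * B * K * s ^+ k.
  rewrite mulr_ge0 ?nc_ge0 //=.
  have h : nc (b n k - a_ k) <= 2 * B * rho y k.
    by apply: le_trans (ncB _ _) _; have := hb n k; have := ha k; lra.
  apply: le_trans (ler_wpM2r (C0 k) h) _; rewrite /C le_eqVlt; apply/orP; left; apply/eqP.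
  by have := rho_gt0 k y0 => /lt0r_neq0 h0; field.
have xl k : x n k @[n --> \oo] --> 0.
  apply/cvgrPdist_lt => d d0.
  have /cvg_ncP /(_ (d / (C k + 1))) h := hlim k.
  have C1 : 0 < C k + 1 by have := C0 k; lra.
  have d1 : 0 < d / (C k + 1) by rewrite divr_gt0.
  apply: filterS (h d1) => n hn; rewrite sub0r normrN ger0_norm; last by have /andP[] := x0 n k.
  apply: (@le_lt_trans _ _ (d / (C k + 1) * C k)); first by apply: ler_wpM2r => //; exact: ltW.
  by rewrite mulrAC ltr_pdivrMr // ltr_pM2l //; lra.
have [n hn] := filter_ex (tannery s0 s1 x0 xl e0).
exists n => z zr.
have cv (d : nat -> R[i]) : (forall k, nc (d k) <= B * rho y k) ->
    diffop_partial d f n z @[n --> \oo] --> diffop d f z.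
  by move=> hd; apply: diffop_partial_cvg; exact: (rho_diffop_cvg cf a0 y0 ya hM B0 hd).
apply: (diffop_dist (cv _ (hb n)) (cv _ ha)) => N.
rewrite /diffop_partial -sumrB; apply: le_trans (nc_sum _ _ _) _.
apply: le_trans (ltW (hn N)); apply: ler_sum => k _.
rewrite -mulrBl ncM; apply: ler_wpM2l; first exact: nc_ge0.
by rewrite /C ler_pdivlMr ?rho_gt0 //; exact: hK.
Qed.

End Assembly.

Theorem theorem4p5 (R : realType) (a_ : nat -> R[i]) (h h1 : R[i] -> R[i])
    (gamma lambda mu a b : R)
    (hP : Pbar_lower h)
    (hT : is_taylor a_ (fun w => h w * cexp ('i%C * lambda%:C * w)))
    (gamma_ge0 : 0 <= gamma)
    (h1_entire : entire h1)
    (h1_genus : genus_le 1 h1)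
    (h_fact : forall w, h w = cexp (- (gamma%:C * w ^+ 2)) * h1 w)
    (lambda_ge0 : 0 <= lambda)
    (lambda_mu : lambda <= mu)
    (a_gt0 : 0 < a)
    (a_lt : 0 < gamma -> a < 1 / (4 * gamma))
    (b_gt : a / (1 - 4 * gamma * a) < b) :
  let T := diffop a_ in
  let Tstar := diffop (conj_coef a_) in
  let delta := Num.sqrt (Num.max (mu ^+ 2 - lambda ^+ 2) 0) in
  (forall f, Fock a f ->
     [/\ diffop_cvg a_ f,
         diffop_cvg (conj_coef a_) f &
         Fock b (fun z => T f z + Tstar f z)]) /\
  (forall f, (Fock a `&` SbarR mu) f ->
     SbarR delta (fun z => T f z + Tstar f z)).
Proof.
move=> T Tstar delta.
(* This form also covers gamma = 0, where 1/(4 gamma) stands for infinity. *)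
have ga : 4 * gamma * a < 1.
  move: gamma_ge0; rewrite le_eqVlt => /orP[/eqP <-|g0]; first by rewrite mulr0 mul0r.
  by have := a_lt g0; rewrite ltr_pdivlMr ?mulr_gt0 // mulrC.
have mu0 : 0 <= mu by lra.
have ga1 : 0 < 1 - 4 * gamma * a by lra.
have b0 : 0 < b by apply: le_lt_trans b_gt; rewrite divr_ge0 // ltW.
(* 2 y a is the midpoint of 4 gamma a and 1 - a/b. Hence y > 2 gamma, as the symbol bounds require,
   and a/(1 - 2 y a) < b, as membership in F_b requires. *)
pose y := (2 * gamma + (1 - a / b) / (2 * a)) / 2.
have ab : a / b < 1 - 4 * gamma * a.
  by rewrite ltr_pdivrMr // mulrC -ltr_pdivrMr.
have ab0 : 0 < a / b by rewrite divr_gt0.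
have ya2 : 2 * y * a = (4 * gamma * a + (1 - a / b)) / 2 by rewrite /y; field; rewrite !gt_eqF.
have gy : 2 * gamma < y.
  have h2 : 4 * gamma * a < 2 * y * a by rewrite ya2; lra.
  by move: h2; rewrite ltr_pM2r // => h2; lra.
have y0 : 0 < y by lra.
have ya : 2 * y * a < 1 by rewrite ya2; lra.
have yb : a / (1 - 2 * y * a) < b.
  by rewrite ltr_pdivrMr ?subr_gt0 // mulrC -ltr_pdivrMr //; rewrite ya2; lra.
have A0 : 0 <= a / (1 - 2 * y * a) by rewrite divr_ge0 ?ltW // subr_gt0.
have [p [B [B0 pn0 pr hb hlim]]] :=
  operator_approximation hP hT gamma_ge0 h1_genus h_fact lambda_ge0 gy.
pose bb n := exp_conv (fun j => (p n)`_j) ('i%C * (lambda + n.+1%:R^-1)%:C).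
have {}hb : forall n k, nc (bb n k) <= B * rho y k := hb.
have {}hlim : forall k, bb n k @[n --> \oo] --> a_ k := hlim.
have ha k : nc (a_ k) <= B * rho y k.
  by apply: (@cvg_nc_le R nat \oo _ _ _ _ (hlim k)); apply: filterE => n; exact: hb.
have ha' k : nc (conj_coef a_ k) <= B * rho y k by rewrite /conj_coef ncJ.
have main f : Fock a f -> [/\ diffop_cvg a_ f, diffop_cvg (conj_coef a_) f &
    Fock b (fun z => T f z + Tstar f z)].
  move=> /(Fock_rho a_gt0) [c [M [cf hM]]]; split.
  - exact: (rho_diffop_cvg cf a_gt0 y0 ya hM B0 ha).
  - exact: (rho_diffop_cvg cf a_gt0 y0 ya hM B0 ha').
  have [t1 [K1 [ht1 hK1]]] := diffop_taylor cf a_gt0 y0 ya hM ha.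
  have [t2 [K2 [ht2 hK2]]] := diffop_taylor cf a_gt0 y0 ya hM ha'.
  apply: (@rho_Fock R b _ (K1 + K2) _ _ A0 yb (is_taylorD ht1 ht2)) => j.
  by apply: le_trans (ncD _ _) _; rewrite mulrDl; exact: lerD.
split; first exact main.
move=> f [Ff fS].
have [ca ca' [t ht _]] := main f Ff.
have [c [M [cf hM]]] := Fock_rho a_gt0 Ff.
(* T + T* is treated as one operator with real coefficients, since only the symmetrised operator
   keeps zeros in the strip. *)
pose s k := a_ k + (a_ k)^*%C; pose bs n k := bb n k + (bb n k)^*%C.
have hs k : nc (s k) <= 2 * B * rho y k.
  by apply: le_trans (ncD _ _) _; rewrite ncJ; have := ha k; lra.
have hbs n k : nc (bs n k) <= 2 * B * rho y k.
  by apply: le_trans (ncD _ _) _; rewrite ncJ; have := hb n k; lra.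
have B2 : 0 <= 2 * B by lra.
have TE z : T f z + Tstar f z = diffop s f z.
  rewrite /T /Tstar -(diffopD z ca ca' _) //.
  exact: (rho_diffop_cvg cf a_gt0 y0 ya hM B2 hs).
have lims k : bs n k @[n --> \oo] --> s k.
  have hc := @cvgc_conj R nat \oo eventually_filter _ _ (hlim k).
  exact (@cvgcD R nat \oo eventually_filter _ _ _ _ (hlim k) hc).
(* A shift beyond lambda only helps, so the same delta serves every n. *)
have mud n : mu ^+ 2 <= delta ^+ 2 + (lambda + n.+1%:R^-1) ^+ 2.
  have d2 : mu ^+ 2 - lambda ^+ 2 <= delta ^+ 2.
    by rewrite /delta sqr_sqrtr ?le_max ?lexx ?orbT.
  have i0 : 0 <= n.+1%:R^-1 :> R by rewrite invr_ge0.
  have : lambda ^+ 2 <= (lambda + n.+1%:R^-1) ^+ 2.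
    by rewrite lerXn2r ?nnegrE ?addr_ge0 ?lerDl.
  by move=> h2; have := lerD d2 h2; rewrite subrK.
have key (r e : R) : 0 < e -> exists S : {poly R[i]}, [/\ zeros_in_strip delta S, conj_poly S = S &
    forall z, nc z <= r -> nc (S.[z] - (T f z + Tstar f z)) < e].
  move=> e0; have e4 : 0 < e / 4 by lra.
  have [n hn] := diffop_limit cf a_gt0 y0 ya hM B2 hbs hs lims (normr_ge0 r) e4.
  have [P [L [P0 L1 hPL]]] := exp_conv_bound (p n) ('i%C * (lambda + n.+1%:R^-1)%:C).
  have hPL2 k : nc (bs n k) * k`!%:R <= 2 * P * L ^+ k.
    apply: le_trans (ler_wpM2r (ler0n _ _) (ncD _ _)) _; rewrite ncJ.
    by have := hPL k; rewrite -/(bb n k); lra.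
  have P2 : 0 <= 2 * P by lra.
  have cbs := rho_diffop_cvg cf a_gt0 y0 ya hM B2 (hbs n).
  have [r' [e' [e'0 near]]] := diffop_near cf cbs P2 L1 hPL2 (normr_ge0 r) e4.
  have [q [qR q1 qs qf]] := real_strip_approx mu0 fS r' e'0.
  have l0 : 0 < lambda + n.+1%:R^-1 by rewrite ltr_wpDl // invr_gt0 ltr0n.
  have [S [Ss SR SE]] := strip_operator (sqrtr_ge0 _) l0 (mud n) (pn0 n) (pr n) q1 qR qs.
  exists S; split => // z zr; rewrite TE SE -/(bs n).
  have zr' : nc z <= `|r| by apply: le_trans zr (ler_norm r).
  have k1 := near q qf z zr'; have k2 := hn z zr'.
  have k3 := ncD (diffop (bs n) (horner q) z - diffop (bs n) f z)
    (diffop (bs n) f z - diffop s f z).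
  by rewrite addrA subrK in k3; lra.
split; first by exists t.
- apply/compact_closureP => r e e0; have [S [Ss _ hS]] := key r e e0.
  by exists S.
(* The approximants S are real on the axis, so the imaginary part of the limit is below every e. *)
move=> x; apply/eqP; rewrite -normr_eq0 eq_le normr_ge0 andbT.
apply/ler_addgt0Pr => e e0; rewrite add0r.
have [S [_ SR hS]] := key `|x| e e0.
have := hS x%:C; rewrite ncR => /(_ (lexx _)) hx.
have SX : complex.Im S.[x%:C] = 0.
  by apply: Im_conj_eq; rewrite -real_poly_conj //= oppr0.
apply: le_trans (ltW hx); apply: le_trans (nc_ge_Im _).
by rewrite (ImD S.[x%:C]) SX ImN add0r normrN.
Qed.
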